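(* Let $d\ge1$ be an integer, $0<\alpha\le H<1$, let $\{B^\alpha(t):t\in[0,1]\}$ be a $d$-dimensional fractional Brownian motion of Hurst index $\alpha$, and let $A\subset[0,1]$ be a Borel set. Then $$\dim_{\Psi,H}(Gr_A(B^\alpha))=\min\left\{\frac{H}{\alpha}\dim(A),\ \dim(A)+d(H-\alpha)\right\}\quad\text{almost surely.}$$ Moreover, if $\alpha<H$, then $\dim_{\Psi,H}(Gr_A(B^\alpha))>\dim(A)$ almost surely.
   Context: A real-valued fractional Brownian motion of Hurst index $\alpha\in(0,1)$ is a centered Gaussian process $B_0^\alpha$ with covariance $\mathbb{E}(B_0^\alpha(s)B_0^\alpha(t))=\frac12(|t|^{2\alpha}+|s|^{2\alpha}-|t-s|^{2\alpha})$. A $d$-dimensional fractional Brownian motion of Hurst index $\alpha$ is $B^\alpha=(B_1^\alpha,\dots,B_d^\alpha)$ with $B_1^\alpha,\dots,B_d^\alpha$ independent copies of $B_0^\alpha$. Processes are defined on a complete probability space and taken with continuous sample paths. $\dim$ denotes the usual Hausdorff dimension of subsets of $\mathbb{R}$, and $Gr_A(f)=\{(t,f(t)):t\in A\}\subset\mathbb{R}_+\times\mathbb{R}^d$ is the graph of $f$ over $A$. For $H\in(0,1)$, $\beta>0$ and $F\subset\mathbb{R}_+\times\mathbb{R}^d$, the $H$-parabolic $\beta$-dimensional Hausdorff content is $$\Psi_H^\beta(F)=\inf\Big\{\sum_j\delta_j^\beta:\ F\subseteq\bigcup_j [a_j,a_j+\delta_j]\times[b_{j,1},b_{j,1}+\delta_j^H]\times\cdots\times[b_{j,d},b_{j,d}+\delta_j^H]\Big\},$$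 the infimum being over all countable covers of $F$ by sets of this form. The $H$-parabolic Hausdorff dimension is $\dim_{\Psi,H}(F)=\inf\{\beta>0:\Psi_H^\beta(F)=0\}$.
   Formalization: The ''Moreover'' clause is stated under the added hypothesis dim(A) > 0; as printed it fails when dim(A) = 0 (e.g. A empty or a singleton), since then both dimensions equal 0. *)

(* Defs.v *)
From HB Require Import structures.
From mathcomp Require Import all_boot all_order all_algebra.
From mathcomp Require Import all_classical all_reals all_analysis.

Set Implicit Arguments.
Unset Strict Implicit.
Unset Printing Implicit Defensive.
Import Order.TTheory GRing.Theory Num.Theory.
Import numFieldNormedType.Exports.
Local Open Scope classical_set_scope.
Local Open Scope ring_scope.
Local Open Scope ereal_scope.

Section Dimensions.
Context {R : realType}.

(* The supremum over an empty set is -oo in \bar R, hence the maximum with 0. *)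
Definition diam (U : set R) : \bar R :=
  maxe 0 (ereal_sup [set (`|x - y|%R)%:E | x in U & y in U]).

Definition hausdorff_premeasure (delta s : R) (A : set R) : \bar R :=
  ereal_inf [set \sum_(0 <= j <oo) diam (U j) `^ s | U in
    [set U : nat -> set R |
      A `<=` \bigcup_j U j /\ forall j, diam (U j) <= delta%:E]].

Definition hausdorff_measure (s : R) (A : set R) : \bar R :=
  ereal_sup [set hausdorff_premeasure delta s A | delta in
    [set delta : R | (0 < delta)%R]].

(* Restricting to s > 0 does not change the infimum, and avoids 0 `^ 0 = 1. *)
Definition hausdorff_dim (A : set R) : \bar R :=
  ereal_inf [set s%:E | s in
    [set s : R | (0 < s)%R /\ hausdorff_measure s A = 0]].

Definition parabolic_box {d : nat} (H delta a : R) (b : 'rV[R]_d) :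
    set (R * 'rV[R]_d) :=
  [set z : R * 'rV[R]_d | (a <= z.1 <= a + delta)%R /\
    forall i : 'I_d, (b ord0 i <= z.2 ord0 i <= b ord0 i + delta `^ H)%R].

(* Degenerate boxes (delta j = 0) are allowed: they cost nothing, so that
   finite covers are covers indexed by nat. *)
Definition parabolic_content {d : nat} (H beta : R) (F : set (R * 'rV[R]_d)) :
    \bar R :=
  ereal_inf [set y | exists (delta a : nat -> R) (b : nat -> 'rV[R]_d),
    [/\ forall j, (0 <= delta j)%R,
        F `<=` \bigcup_j parabolic_box H (delta j) (a j) (b j) &
        y = \sum_(0 <= j <oo) (delta j `^ beta)%:E]].

Definition parabolic_dim {d : nat} (H : R) (F : set (R * 'rV[R]_d)) : \bar R :=
  ereal_inf [set beta%:E | beta in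
    [set beta : R | (0 < beta)%R /\ parabolic_content H beta F = 0]].

Definition graph_over {d : nat} (A : set R) (f : R -> 'rV[R]_d) :
    set (R * 'rV[R]_d) :=
  [set (t, f t) | t in A].

End Dimensions.

Section FractionalBrownianMotion.
Context {disp : measure_display} {T : measurableType disp} {R : realType}.
Variable P : probability T R.

(* Degenerate Gaussian laws are included; they are treated apart because
   [normal_prob m 0] is not the Dirac mass at m. *)
Definition is_gaussian (X : T -> R) : Prop :=
  exists m sigma : R, (0 <= sigma)%R /\
    forall U : set R, measurable U ->
      P (X @^-1` U) = if sigma == 0%R then \d_m U else normal_prob m sigma U.

Definition gaussian_process (I : set R) (X : R -> {RV P >-> R}) : Prop :=
  forall (n : nat) (t : 'I_n -> R) (c : 'I_n -> R), (forall k, I (t k)) ->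
    is_gaussian (fun w => \sum_(k < n) c k * X (t k) w)%R.

Record is_fbm1 (alpha : R) (I : set R) (X : R -> {RV P >-> R}) : Prop := {
  fbm1_gaussian : gaussian_process I X;
  fbm1_centered : forall t, I t -> 'E_P[X t] = 0;
  fbm1_cov : forall s t, I s -> I t ->
    'E_P[X s \* X t] =
      (2^-1 * (`|t| `^ (2 * alpha) + `|s| `^ (2 * alpha)
                 - `|t - s| `^ (2 * alpha)))%R%:E;
  fbm1_continuous : forall w, {within I, continuous (fun t => X t w)} }.

Definition process_sigma_algebra (I : set R) (X : R -> {RV P >-> R}) :
    set (set T) :=
  <<s [set X t @^-1` U | t in I & U in [set U : set R | measurable U]] >>.

Definition mutually_independent {d : nat} (G : 'I_d -> set (set T)) : Prop :=
  forall (J : {set 'I_d}) (E : 'I_d -> set T),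
    (forall i, i \in J -> G i (E i)) ->
    P (\bigcap_(i in [set` J]) E i) = \prod_(i in J) P (E i).

Record is_fbm {d : nat} (alpha : R) (I : set R)
    (B : 'I_d -> R -> {RV P >-> R}) : Prop := {
  fbm_components : forall i, is_fbm1 alpha I (B i);
  fbm_independent :
    mutually_independent (fun i => process_sigma_algebra I (B i)) }.

Definition sample_path {d : nat} (B : 'I_d -> R -> {RV P >-> R}) (w : T)
    (t : R) : 'rV[R]_d :=
  (\row_i B i t w)%R.

End FractionalBrownianMotion.

(* Main.v *)
Require Import Defs.
From HB Require Import structures.
From mathcomp Require Import all_boot all_order all_algebra.
From mathcomp Require Import all_classical all_reals all_analysis.
From mathcomp Require Import measurable_realfun.
From mathcomp Require Import ring lra.
Import Order.TTheory GRing.Theory Num.Theory.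
Import numFieldNormedType.Exports.
Set Implicit Arguments.
Unset Strict Implicit.
Unset Printing Implicit Defensive.
Local Open Scope classical_set_scope.
Local Open Scope ring_scope.
Local Open Scope ereal_scope.

(** The parabolic cost of covering the graph of B is governed by the competition
between the oscillation of B, of order r^alpha over a time interval of length
r, and the spatial side r^H <= r^alpha that a box of time-length r allows.  An
interval of length r must be covered either by one box of time-length about
r^(alpha/H), which is wide enough in space, or by about r^(-d(H-alpha)) boxes
of time-length r, a grid in space.  Applying one or the other recipe to every
set of an almost optimal Hausdorff cover of A yields the two upper bounds
(H/alpha) dim A and dim A + d(H-alpha)
([parabolic_content_holder_box], [parabolic_content_holder_grid]).  The
oscillation is controlled by Kolmogorov's criterion: almost surely the paths
are locally gamma-Hölder for every gamma < alpha ([fbm_locally_holder]), and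
gamma increases to alpha along a sequence.

The lower bound is an energy argument.  For 0 < s < dim A, Frostman's lemma
([frostman]) gives a measure mu <> 0 carried by a closed subset of A with
mu ]x, y] <= C (y - x)^s.  If a box of time-length about 2^-n meets the graph
at time t, then the times of the graph that it contains are t itself and
times s' with 0 < |s' - t| <= 2^-n and |B_s' - B_t| <= 2^(-nH) in each
coordinate.  So, if the mu-mass of this set of times is at most
M 2^(-n beta) for all n and for t in a set G with mu G > 0, a cover of the
graph costs at least a constant times mu G ([mass_distribution]); such a G
exists as soon as the sum over n of 2^(n beta) (mu x mu){close pairs at scale
n} is finite ([parabolic_content_gt0]).  The expectation of this sum is
estimated by Fubini: by independence of the coordinates and the bound
P(|B_s' - B_t| <= r) <= 4 r / |s' - t|^alpha for each of them, a pair at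
distance about 2^-k is close at scale n with probability at most a constant
times (2^(-nH) 2^(k alpha))^tau, for every tau in [0, d], because a
probability is at most min(1, x) <= x^theta for theta in [0, 1].  Summing over
the dyadic shells k >= n, of mu x mu measure at most a constant times 2^(-ks),
shows that every beta < s + (H - alpha) tau is admissible if alpha tau < s
([energy_ae]).  Letting s tend to dim A and tau to min(d, dim A / alpha), the
exponent tends to dim A + (H - alpha) min(d, dim A / alpha), which is the
minimum of the two upper bounds.

For Frostman's lemma with a Borel set, Hausdorff measure is replaced by the
content of covers by dyadic intervals.  This content is continuous along
increasing sequences ([net_content_bigcup_le]) and outer regular, hence every
Souslin subset of [0, 1] of positive content contains a compact set of positive content
([souslin_capacitable]).  On the line a Frostman measure of a compact K can
then be written down: the function x |-> content(K `&` ]-oo, x]) is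
nondecreasing and its increments are at most C (y - x)^s, so its
Lebesgue-Stieltjes measure is the measure wanted ([frostman_compact]). *)

(** * Contents built on nested boxes *)

Section NetContent.
Context {R : realType} {X : Type} {I : choiceType}.
Variables (box : I -> set X) (level : I -> nat) (cost : I -> R).
Hypothesis cost_ge0 : forall i, (0 <= cost i)%R.

Definition net_cost (C : set I) : \bar R := \esum_(i in C) (cost i)%:E.

Definition net_content (A : set X) : \bar R :=
  ereal_inf [set net_cost C | C in
    [set C : set I | A `<=` \bigcup_(i in C) box i]].

Definition maximal_boxes (C : set I) : set I :=
  [set i | C i /\ forall j, C j -> box i `<=` box j -> j = i].

(** In a nested family, the boxes that cover the intersection of the sets covered
by C and by D: of two boxes that meet, the smaller. *)
Definition common_refinement (C D : set I) : set I :=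
  [set i | (C i /\ exists2 j, D j & box i `<=` box j) \/
           (D i /\ exists2 j, C j & box i `<=` box j)].

Lemma net_content_le (A : set X) (C : set I) :
  A `<=` \bigcup_(i in C) box i -> net_content A <= net_cost C.
Proof. by move=> AC; apply: ereal_inf_lbound; exists C. Qed.

Lemma net_content_lt (A : set X) (c : \bar R) : net_content A < c ->
  exists2 C : set I, A `<=` \bigcup_(i in C) box i & net_cost C < c.
Proof. by move=> /ereal_inf_lt[_ [C AC <-] Cc]; exists C. Qed.

Lemma le_net_content (A B : set X) : A `<=` B ->
  net_content A <= net_content B.
Proof.
move=> AB; apply: ereal_inf_le_tmp => _ [C BC <-]; exists C => //.
exact: subset_trans BC.
Qed.

Lemma net_cost_ge0 (C : set I) : 0 <= net_cost C.
Proof. by apply: esum_ge0 => i _; rewrite lee_fin. Qed.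

Lemma net_content_ge0 (A : set X) : 0 <= net_content A.
Proof. by apply: le_ereal_inf_tmp => _ [C _ <-]; exact: net_cost_ge0. Qed.

Let cost_on (C : set I) (i : I) : \bar R := if i \in C then (cost i)%:E else 0.

Let cost_on_ge0 C i : 0 <= cost_on C i.
Proof. by rewrite /cost_on; case: ifP => // _; rewrite lee_fin. Qed.

Let net_costE C : net_cost C = \esum_(i in [set: I]) cost_on C i.
Proof. by rewrite /net_cost esum_mkcond. Qed.

Lemma le_net_cost (C D : set I) : C `<=` D -> net_cost C <= net_cost D.
Proof.
move=> CD; rewrite !net_costE; apply: le_esum => i _; rewrite /cost_on.
have [/set_mem/CD/mem_set -> //|_] := boolP (i \in C).
by case: ifP => // _; rewrite lee_fin.
Qed.

Lemma net_costU (C D : set I) : net_cost (C `|` D) <= net_cost C + net_cost D.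
Proof.
rewrite !net_costE -esumD; [|by move=> *; exact: cost_on_ge0..].
apply: le_esum => i _; rewrite /cost_on in_setU.
by case: (i \in C); case: (i \in D); rewrite /= ?adde0 ?add0e ?lexx// leeDl// lee_fin.
Qed.

Lemma net_content_subadditive (A B : set X) :
  net_content (A `|` B) <= net_content A + net_content B.
Proof.
have [->|] := eqVneq (net_content A) +oo; first by rewrite addye ?leey// gt_eqF// (lt_le_trans _ (net_content_ge0 _)).
have [->|] := eqVneq (net_content B) +oo; first by rewrite addey ?leey// gt_eqF// (lt_le_trans _ (net_content_ge0 _)).
move=> Boo Aoo; apply/lee_addgt0Pr => e e0.
have e20 : (0 < e / 2)%R by rewrite divr_gt0.
have fA : net_content A \is a fin_num by rewrite ge0_fin_numE ?net_content_ge0 ?ltey.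
have fB : net_content B \is a fin_num by rewrite ge0_fin_numE ?net_content_ge0 ?ltey.
have [C AC Cc] : exists2 C : set I, A `<=` \bigcup_(i in C) box i &
    net_cost C < net_content A + (e / 2)%:E.
  by apply: net_content_lt; rewrite lteDl// lte_fin.
have [D BD Dc] : exists2 D : set I, B `<=` \bigcup_(i in D) box i &
    net_cost D < net_content B + (e / 2)%:E.
  by apply: net_content_lt; rewrite lteDl// lte_fin.
apply: (@le_trans _ _ (net_cost (C `|` D))).
  by apply: net_content_le; rewrite bigcup_setU; exact: setUSS.
apply: (le_trans (net_costU _ _)).
apply: (le_trans (leeD (ltW Cc) (ltW Dc))).
by rewrite addeACA -EFinD -splitr.
Qed.

Hypothesis box_inj : injective box.
Hypothesis nested : forall i j,
  box i `&` box j !=set0 -> (level j <= level i)%N -> box i `<=` box j.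

(** Only finitely many levels lie above that of a given box, and boxes of minimal
level are maximal by nestedness. *)
Lemma maximal_boxes_above (C : set I) (i : I) : C i -> box i !=set0 ->
  exists2 j, maximal_boxes C j & box i `<=` box j.
Proof.
move=> Ci [x xi].
pose p n := `[< exists j, [/\ C j, box i `<=` box j & level j = n] >].
have exp : exists n, p n by exists (level i); apply/asboolP; exists i; split.
case: (ex_minnP exp) => n /asboolP[j [Cj ij <-]] jmin; exists j => //; split=> // k Ck jk.
have ik := subset_trans ij jk.
have jk' : (level j <= level k)%N by apply: jmin; apply/asboolP; exists k.
apply: box_inj; apply/seteqP; split=> //.
by apply: nested => //; exists x; split; [exact: ik|exact: ij].
Qed.

Lemma bigcup_maximal_boxes (C : set I) :
  \bigcup_(i in C) box i `<=` \bigcup_(i in maximal_boxes C) box i.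
Proof.
move=> x [i Ci xi]; have [|j mj ij] := maximal_boxes_above Ci; first by exists x.
by exists j => //; exact: ij.
Qed.

Lemma common_refinement_cover (C D : set I) :
  \bigcup_(i in C) box i `&` \bigcup_(i in D) box i `<=`
  \bigcup_(i in common_refinement C D) box i.
Proof.
move=> x [[i Ci xi] [j Dj xj]].
have [ji|/ltnW ij] := leqP (level j) (level i).
  exists i => //; left; split=> //; exists j => //.
  by apply: nested => //; exists x.
exists j => //; right; split=> //; exists i => //.
by apply: nested => //; exists x.
Qed.

(** Strong subadditivity of the cost: a box counted twice on the left is both a
maximal box of C and a box of D, and a box counted once on the left belongs
to one of them. *)
Lemma net_cost_modular (C D : set I) :
  net_cost (maximal_boxes (C `|` D)) +
    net_cost (common_refinement (maximal_boxes C) D) <=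
  net_cost (maximal_boxes C) + net_cost D.
Proof.
rewrite !net_costE -!esumD; [|by move=> *; exact: cost_on_ge0..].
apply: le_esum => i _; rewrite /cost_on.
have c0 : 0 <= (cost i)%:E by rewrite lee_fin.
have [/set_mem[CDi imax]|_] := boolP (i \in maximal_boxes (C `|` D)); last first.
  rewrite add0e; case: ifPn => [/set_mem|_]; last first.
    by apply: adde_ge0; exact: cost_on_ge0.
  by case=> -[/mem_set -> _]; rewrite ?leeDl ?leeDr//; exact: cost_on_ge0.
have [/set_mem ri|_] := boolP (i \in common_refinement _ _); last first.
  rewrite adde0; case: CDi => [Ci|Di]; last by rewrite (mem_set Di) leeDr//; exact: cost_on_ge0.
  have /mem_set -> : maximal_boxes C i by split=> // j Cj; apply: imax; left.
  by rewrite leeDl//; exact: cost_on_ge0.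
suff [mi Di] : maximal_boxes C i /\ D i by rewrite (mem_set mi) (mem_set Di).
case: ri => -[mDi [j Hj ij]].
  by have ji : j = i by [apply: imax => //; right]; rewrite -{2}ji.
have ji : j = i by apply: imax => //; left; case: Hj.
by rewrite -{1}ji.
Qed.

(** Continuity along increasing sequences, by Davies' argument for net measures.
Covers C n of A n, optimal up to e / 2^(n+1), are merged successively: by strong
subadditivity merging C (n+1) into the maximal boxes of the first n covers
adds at most content (A (n+1)) - content (A n) + e / 2^(n+2), since the common refinement
still covers A n.  The errors are summable, and a finite part of the maximal boxes of
the union of all covers already consists of maximal boxes at some stage n. *)
Lemma net_content_bigcup_le (A : nat -> set X) (c : \bar R) :
  (forall n, A n `<=` A n.+1) -> (forall n, net_content (A n) <= c) ->
  net_content (\bigcup_n A n) <= c.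
Proof.
move=> ndA Ac; have := Ac 0%N; have := le_trans (net_content_ge0 (A 0%N)) (Ac 0%N).
case: c Ac => [c Ac c0 _|_ _ _|_]; [|by rewrite leey|by []].
apply/lee_addgt0Pr => e e0.
pose a n := fine (net_content (A n)).
have aE n : net_content (A n) = (a n)%:E.
  by rewrite fineK// ge0_fin_numE ?net_content_ge0// (le_lt_trans (Ac n))// ltry.
pose eps n : R := (e / 2 ^+ n.+1)%R.
have eps0 n : (0 < eps n)%R by rewrite divr_gt0// exprn_gt0.
have [C CP] : {C : nat -> set I & forall n, A n `<=` \bigcup_(i in C n) box i /\
    net_cost (C n) <= (a n + eps n)%:E}.
  apply: (@choice _ _ (fun n D => A n `<=` \bigcup_(i in D) box i /\
     net_cost D <= (a n + eps n)%:E)) => n.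
  have /net_content_lt[D AD Dc] : net_content (A n) < (a n + eps n)%:E.
    by rewrite aE lte_fin ltrDl.
  by exists D; split=> //; exact: ltW.
pose U n := \bigcup_(k in [set k | (k <= n)%N]) C k.
have US n : U n.+1 = U n `|` C n.+1.
  apply/seteqP; split=> i.
    move=> [k /= +Ck]; rewrite leq_eqVlt => /orP[/eqP <-|kn]; first by right.
    by left; exists k.
  by move=> [[k /= kn Ck]|Cn]; [exists k => //=; exact: leqW|exists n.+1 => /=].
have AU n : A n `<=` \bigcup_(i in maximal_boxes (U n)) box i.
  move=> x /(CP n).1[i Ci xi]; apply: bigcup_maximal_boxes.
  by exists i => //; exists n => /=.
have cU n : net_cost (maximal_boxes (U n)) <= (a n + e * (1 - 1 / 2 ^+ n.+1))%:E.
  elim: n => [|n IH].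
    apply: (le_trans _ (_ : net_cost (C 0%N) <= _)).
      by apply: le_net_cost => i -[[k /=]]; rewrite leqn0 => /eqP ->.
    by apply: (le_trans (CP 0%N).2); rewrite lee_fin /eps expr1; lra.
  have := net_cost_modular (U n) (C n.+1); rewrite -US.
  have : (a n)%:E <= net_cost (common_refinement (maximal_boxes (U n)) (C n.+1)).
    rewrite -aE; apply: net_content_le; apply: subset_trans (@common_refinement_cover _ _).
    by move=> x Ax; split; [exact: AU|exact/(CP n.+1).1/ndA].
  have fU : net_cost (maximal_boxes (U n)) \is a fin_num.
    by rewrite ge0_fin_numE ?net_cost_ge0// (le_lt_trans IH)// ltry.
  have fC : net_cost (C n.+1) \is a fin_num.
    by rewrite ge0_fin_numE ?net_cost_ge0// (le_lt_trans (CP _).2)// ltry.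
  move: IH (CP n.+1).2; rewrite -(fineK fU) -(fineK fC).
  move: (fine _) (fine _) => u v; rewrite !lee_fin.
  have := net_cost_ge0 (maximal_boxes (U n.+1)).
  have := net_cost_ge0 (common_refinement (maximal_boxes (U n)) (C n.+1)).
  move: (net_cost _) (net_cost _) => [x| |] [y| |]//=; rewrite !lee_fin.
  move=> x0 y0 IH Cn ax xy; apply: (@le_trans _ _ (u + v - y)%R); first by lra.
  apply: (@le_trans _ _ (a n.+1 + e * (1 - 1 / 2 ^+ n.+1) + eps n.+1)%R); first by lra.
  rewrite -addrA lerD2l /eps [in leRHS]exprS !exprS.
  have : (2 ^+ n != 0 :> R)%R by rewrite expf_neq0.
  move: (2 ^+ n)%R => z z0.
  rewrite le_eqVlt; apply/orP; left; apply/eqP; field.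
  by [].
(* V covers the union; each of its finite subsets is contained in the maximal
   boxes of U n for n large. *)
pose V := maximal_boxes (\bigcup_n C n).
apply: (@le_trans _ _ (net_cost V)).
  apply: net_content_le => x [n _ /(CP n).1[i Ci xi]].
  by apply: bigcup_maximal_boxes; exists i => //; exists n.
apply: ge_ereal_sup => _ [F [finF FV] <-].
have [N NP] : {N : I -> nat & forall i, V i -> C (N i) i}.
  apply: (@choice _ _ (fun i n => V i -> C n i)) => i.
  have [[[n _ Cn] _]|nV] := pselect (V i); first by exists n.
  by exists 0%N => /nV.
have /finite_seqP[s sF] := finF.
pose n := \max_(i <- s) N i.
have Fn : F `<=` maximal_boxes (U n).
  move=> i Fi; have [Ci imax] := FV _ Fi; split.
    exists (N i); last exact: NP (FV _ Fi).
    by apply: leq_bigmax_seq => //; move: Fi; rewrite sF.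
  by move=> j [k _ Cj]; apply: imax; exists k.
apply: (@le_trans _ _ (net_cost (maximal_boxes (U n)))).
  by apply: ereal_sup_ubound; exists F.
apply: (le_trans (cU n)); rewrite lee_fin.
have : (a n <= c)%R by have := Ac n; rewrite aE lee_fin.
have : (0 <= e * (1 / 2 ^+ n.+1))%R by rewrite mulr_ge0 ?divr_ge0 ?exprn_ge0// ltW.
lra.
Qed.

End NetContent.

(** * The dyadic content on the line *)

Lemma le_powRl (R : realType) (a b s : R) : (0 <= s)%R -> (0 <= a)%R ->
  (a <= b)%R -> (a `^ s <= b `^ s)%R.
Proof. by move=> s0 a0 ab; rewrite ge0_ler_powR ?nnegrE// (le_trans a0). Qed.

Lemma half_expn_gt0 (R : realType) (n : nat) : (0 < 2 ^- n :> R)%R.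
Proof. by rewrite invr_gt0 exprn_gt0. Qed.

Lemma exists_half_expn_lt (R : realType) (e : R) : (0 < e)%R ->
  exists n : nat, (2 ^- n < e)%R.
Proof.
move=> e0; exists (Num.truncn e^-1).
rewrite invf_plt ?posrE ?exprn_gt0//.
apply: (lt_le_trans (truncnS_gt e^-1)).
by rewrite -natrX ler_nat ltn_expl.
Qed.

Lemma exists_dyadic_scale (R : realType) (e : R) : (0 < e <= 1)%R ->
  exists n : nat, (2 ^- n.+1 < e)%R /\ (e <= 2 ^- n)%R.
Proof.
move=> /andP[e0 e1]; have ex := exists_half_expn_lt e0.
case: (ex_minnP ex) => -[|n] ne nmin.
  by move: ne; rewrite expr0 invr1 ltNge e1.
exists n; split=> //; rewrite leNgt; apply/negP => /nmin.
by rewrite ltnn.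
Qed.

Lemma half_expn_powR (R : realType) n (x : R) : ((2 ^- n) `^ x = (2^-1 `^ x) ^+ n)%R.
Proof. by rewrite -powR_mulrn ?powR_ge0// powRAC powR_mulrn// exprVn. Qed.

Lemma half_powR_lt1 (R : realType) (x : R) : (0 < x)%R -> (2^-1 `^ x < 1)%R.
Proof.
move=> x0; suff : (2^-1 `^ x < 1 `^ x)%R by rewrite powR1.
by apply: gt0_ltr_powR; rewrite ?nnegrE//; lra.
Qed.

Lemma nneseries_pickle_inv (R : realType) (I : countType) (a : I -> \bar R) :
  (forall i, 0 <= a i) ->
  \sum_(0 <= j <oo) oapp a 0 (pickle_inv j) = \esum_(i in [set: I]) a i.
Proof.
move=> a0; rewrite nneseries_esumT; last by move=> j; case: pickle_inv.
have pinj : set_inj [set: I] (@pickle I) by move=> i j _ _; exact: (pcan_inj pickleK).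
transitivity (\esum_(j in range (@pickle I)) oapp a 0 (pickle_inv j)).
  rewrite [RHS]esum_mkcond; apply: eq_esum => j _.
  case: ifPn => // /negP jp; case E : (pickle_inv j) => [i|//]; exfalso; apply: jp.
  rewrite inE; exists i => //.
  by have := @pickle_invK I j; rewrite /= E.
by rewrite esum_image//; apply: eq_esum => i _; rewrite pickleK_inv.
Qed.

Section DyadicContent.
Context {R : realType}.
Implicit Types (s : R) (A : set R) (i : nat * int).

Definition dyadic_box i : set R :=
  [set x | (i.2%:~R <= x * 2 ^+ i.1 < (i.2 + 1)%:~R)%R].

Definition dyadic_cost s i : R := ((2 ^- i.1) `^ s)%R.

Definition dyadic_content s A : \bar R :=
  net_content dyadic_box (dyadic_cost s) A.

Lemma dyadic_cost_ge0 s i : (0 <= dyadic_cost s i)%R.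
Proof. exact: powR_ge0. Qed.

Lemma dyadic_content_ge0 s A : 0 <= dyadic_content s A.
Proof. by apply: net_content_ge0; exact: dyadic_cost_ge0. Qed.

Lemma le_dyadic_content s A B : A `<=` B -> dyadic_content s A <= dyadic_content s B.
Proof. exact: le_net_content. Qed.

Lemma dyadic_content0 s : dyadic_content s set0 = 0.
Proof.
apply/eqP; rewrite eq_le dyadic_content_ge0 andbT.
by rewrite (le_trans (@net_content_le _ _ _ _ _ _ set0 _))// /net_cost esum_set0.
Qed.

Lemma dyadic_contentU s A B :
  dyadic_content s (A `|` B) <= dyadic_content s A + dyadic_content s B.
Proof. by apply: net_content_subadditive; exact: dyadic_cost_ge0. Qed.

Lemma dyadic_nested i j : dyadic_box i `&` dyadic_box j !=set0 ->
  (j.1 <= i.1)%N -> dyadic_box i `<=` dyadic_box j.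
Proof.
case: i j => [n k] [m l] /= [x [/= /andP[kx xk] /andP[lx xl]]] mn y /= /andP[ky yk].
rewrite -(subnKC mn) exprD in kx xk ky yk.
set q := (2 ^+ (n - m) : R)%R in kx xk ky yk.
have q0 : (0 < q)%R by rewrite exprn_gt0.
have qE : q = (2 ^+ (n - m) : int)%:~R by rewrite /q rmorphXn.
have lk : (l * 2 ^+ (n - m) <= k)%R.
  rewrite -ltzD1 -(@ltr_int R) rmorphM/= -qE; apply: le_lt_trans xk.
  by rewrite mulrA ler_pM2r.
have kl : (k + 1 <= (l + 1) * 2 ^+ (n - m))%R.
  rewrite lezD1 -(@ltr_int R) [ltRHS]rmorphM/= -qE; apply: (le_lt_trans kx).
  by rewrite mulrA ltr_pM2r.
move: lk kl; rewrite -!(ler_int R) !rmorphM /= -qE => lk kl.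
apply/andP; split.
  by rewrite -(ler_pM2r q0) -mulrA (le_trans lk).
by rewrite -(ltr_pM2r q0) -mulrA (lt_le_trans yk).
Qed.

Lemma dyadic_box_inj : injective dyadic_box.
Proof.
have half n k m l : dyadic_box (n, k) = dyadic_box (m, l) -> (n <= m)%N.
  move=> E; rewrite leqNgt; apply/negP => mn.
  pose q : R := (2 ^+ (n - m))%R.
  have q2 : (2 <= q)%R.
    rewrite /q -(subnSK mn) exprS ler_peMr//.
    by rewrite exprn_ege1// ler1n.
  have m0 : (0 < 2 ^+ m :> R)%R by rewrite exprn_gt0.
  have mem (t : R) : (0 <= t < 1)%R ->
      dyadic_box (n, k) ((l%:~R + t) / 2 ^+ m)%R.
    move=> /andP[t0 t1]; rewrite E /dyadic_box /= divfK ?gt_eqF// intrD1.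
    by rewrite lerDl t0 ltrD2l.
  have := mem 0%R; have := mem 2^-1%R; rewrite /dyadic_box /= -(subnKC (ltnW mn)) exprD !mulrA !divfK ?gt_eqF// intrD1 -/q.
  by move=> /(_ ltac:(lra)) /andP[h1 h2] /(_ ltac:(lra)) /andP[h3 h4]; clear E mem; nra.
move=> [n k] [m l] E.
have nm : n = m by apply/eqP; rewrite eqn_leq (half _ _ _ _ E) (half _ _ _ _ (esym E)).
rewrite {}nm in E *.
have lek a b : dyadic_box (m, a) = dyadic_box (m, b) -> (b <= a)%R.
  move=> F; have : dyadic_box (m, a) (a%:~R / 2 ^+ m)%R.
    by rewrite /dyadic_box /= divfK ?gt_eqF ?exprn_gt0// lexx ltr_int ltzD1 lexx.
  rewrite F /dyadic_box /= divfK ?gt_eqF ?exprn_gt0// => /andP[+ _].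
  by rewrite ler_int.
by congr (_, _); apply/eqP; rewrite eq_le !lek.
Qed.

Lemma dyadic_content_bigcup_le s (F : nat -> set R) (c : \bar R) :
  (forall n, F n `<=` F n.+1) -> (forall n, dyadic_content s (F n) <= c) ->
  dyadic_content s (\bigcup_n F n) <= c.
Proof.
apply: (net_content_bigcup_le (level := fst)).
- exact: dyadic_cost_ge0.
- exact: dyadic_box_inj.
- exact: dyadic_nested.
Qed.

Lemma dyadic_costS s (n q : nat) (k l : int) :
  dyadic_cost s ((n + q)%N, l) = ((2 ^- q) `^ s * dyadic_cost s (n, k))%R.
Proof.
rewrite /dyadic_cost /= -powRM ?invr_ge0 ?exprn_ge0//.
by rewrite exprD invfM mulrC.
Qed.

(** The half-open boxes are opened by adjoining, to the left of each one, a dyadic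
box that is 2^q times shorter; for large q this costs an arbitrarily small
fraction of the total. *)
Lemma dyadic_content_outer_regular s A (c : \bar R) : (0 < s)%R ->
  dyadic_content s A < c ->
  exists U : set R, [/\ open U, A `<=` U & dyadic_content s U < c].
Proof.
move=> s0 /net_content_lt[C AC Cc].
have C0 : 0 <= net_cost (dyadic_cost s) C by apply: net_cost_ge0; exact: dyadic_cost_ge0.
have [r C0r rc] : exists2 r : R, net_cost (dyadic_cost s) C = r%:E & (0 <= r)%R.
  move: C0 Cc; case: net_cost => [r|_|//]; last by rewrite ltNge leey.
  by rewrite lee_fin; exists r.
have [q qc] : exists q : nat, ((1 + (2 ^- q) `^ s) * r)%:E < c.
  case: c Cc => [c| |] Cc; [|by exists 0%N; rewrite ltry|by move: Cc; rewrite C0r].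
  rewrite C0r lte_fin in Cc.
  pose e := ((c - r) / (r + 1))%R.
  have e0 : (0 < e)%R by rewrite divr_gt0 ?subr_gt0// ltr_wpDl.
  have [q qe] : exists q : nat, (2 ^- q <= e `^ (s^-1) :> R)%R.
    by have [q /ltW qe] := exists_half_expn_lt (powR_gt0 (s^-1) e0); exists q.
  exists q; rewrite lte_fin.
  have : ((2 ^- q) `^ s <= e :> R)%R.
    have -> : e = ((e `^ s^-1) `^ s)%R.
      by rewrite -powRrM mulVf ?gt_eqF// powRr1// ltW.
    by apply: le_powRl => //; exact: ltW.
  move: (_ `^ _)%R => t te.
  have : (e * r < c - r)%R.
    by rewrite /e mulrAC ltr_pdivrMr ?ltr_wpDl// ltr_pM2l ?subr_gt0// ltrDl.
  by nra.
(* f i is the box of level i.1 + q immediately to the left of box i. *)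
pose f (i : nat * int) := ((i.1 + q)%N, (i.2 * 2 ^+ q - 1)%R).
have finj : injective f.
  move=> [n k] [m l] [/addIn -> /addIr kl]; congr (_, _).
  by apply: (mulIf _ kl); rewrite expf_neq0.
pose U := \bigcup_(i in C) [set x : R | (((i.2%:~R - 2 ^- q) < x * 2 ^+ i.1) /\
   (x * 2 ^+ i.1 < (i.2 + 1)%:~R))%R].
exists U; split.
- apply: bigcup_open => i _.
  rewrite (_ : mkset _ = `](i.2%:~R - 2 ^- q) / 2 ^+ i.1, (i.2 + 1)%:~R / 2 ^+ i.1[%classic%R); first exact: itv_open.
  apply/seteqP; split => x /=; rewrite in_itv/= ltr_pdivrMr ?ltr_pdivlMr ?exprn_gt0//.
    by move=> [-> ->].
  by move=> /andP.
- move=> x /AC[i Ci /= /andP[ix xi]]; exists i => //=; split=> //.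
  by apply: lt_le_trans ix; rewrite gtrBl invr_gt0 exprn_gt0.
- apply: (@le_lt_trans _ _ (net_cost (dyadic_cost s) (C `|` f @` C))).
    apply: net_content_le => x [i Ci /= [ix xi]].
    have [ki|ki] := leP i.2%:~R (x * 2 ^+ i.1)%R.
      by exists i; [left|rewrite /dyadic_box /= ki].
    exists (f i); first by right; exists i.
    rewrite /f /dyadic_box /= exprD mulrA subrK rmorphB !rmorphM /= !rmorphXn /=.
    rewrite -(ltr_pM2r (_ : 0 < 2 ^+ q)%R) ?exprn_gt0// in ki.
    rewrite -(ltr_pM2r (_ : 0 < 2 ^+ q)%R) ?exprn_gt0// mulrBl mulVf ?expf_neq0// in ix.
    by rewrite ki (ltW ix).
  apply: (le_lt_trans (net_costU _ _ _)); first exact: dyadic_cost_ge0.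
  apply: (@le_lt_trans _ _ (r%:E + (((2 ^- q) `^ s) * r)%:E)).
    rewrite C0r leeD2l// /net_cost esum_image; last by move=> i j _ _; exact: finj.
    apply: ge_ereal_sup => _ [F [finF FC] <-].
    rewrite (eq_fsbigr (fun i => ((2 ^- q) `^ s)%:E * (dyadic_cost s i)%:E)); last first.
      by move=> [n k] _; rewrite (dyadic_costS s n q k) EFinM.
    rewrite -ge0_mule_fsumr; last by move=> i; rewrite lee_fin dyadic_cost_ge0.
    rewrite EFinM lee_wpmul2l ?lee_fin ?powR_ge0// -C0r.
    by apply: ereal_sup_ubound; exists F.
  by rewrite -EFinD; move: qc; rewrite mulrDl mul1r.
Qed.

Lemma dyadic_content_ocitv s A (x y : R) : (0 <= s)%R -> (0 < y - x <= 1)%R ->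
  A `<=` `]x, y] -> dyadic_content s A <= (2 * 2 `^ s * (y - x) `^ s)%:E.
Proof.
move=> s0 /andP[d0 d1] Axy.
have [n [nd dn]] := exists_dyadic_scale (introT andP (conj d0 d1)).
pose k := Num.floor (x * 2 ^+ n)%R.
(* Two consecutive boxes of length 2^-n >= y - x cover ]x, y]. *)
apply: (@le_trans _ _ (net_cost (dyadic_cost s) ([set (n, k)] `|` [set (n, (k + 1)%R)]))).
  apply: net_content_le => z /Axy; rewrite /= in_itv/= => /andP[xz zy].
  have n0 : (0 < 2 ^+ n :> R)%R by rewrite exprn_gt0.
  have kx : (k%:~R <= x * 2 ^+ n)%R by exact: floor_le_tmp.
  have xk : (x * 2 ^+ n < (k + 1)%:~R)%R by exact: floorD1_gt.
  have yz : (z * 2 ^+ n < (k + 1 + 1)%:~R)%R.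
    rewrite rmorphD /= rmorph1 (_ : z = x + (z - x))%R; last by lra.
    have : ((z - x) * 2 ^+ n <= 1)%R.
      by rewrite -ler_pdivlMr// mul1r; apply: le_trans dn; lra.
    by rewrite mulrDl; lra.
  have [zk|kz] := ltP (z * 2 ^+ n)%R (k + 1)%:~R.
    exists (n, k); first by left.
    by rewrite /dyadic_box /= zk andbT (le_trans kx)// ler_pM2r// ltW.
  by exists (n, (k + 1)%R); [right|rewrite /dyadic_box /= kz].
apply: (le_trans (net_costU _ _ _)); first exact: dyadic_cost_ge0.
have cost1 l : net_cost (dyadic_cost s) [set (n, l)] = (dyadic_cost s (n, l))%:E.
  by rewrite /net_cost esum_set1// lee_fin dyadic_cost_ge0.
rewrite !cost1 -EFinD lee_fin.
rewrite /dyadic_cost /= -mulrA -powRM// ?(ltW d0)//.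
have : ((2 ^- n) `^ s <= (2 * (y - x)) `^ s :> R)%R.
  apply: le_powRl => //.
  by move: nd; rewrite exprS invfM ltr_pdivrMl// => /ltW.
by lra.
Qed.

(** A cover whose total cost is less than delta^s has no box longer than delta, so that
a content equal to zero already controls the covers by small sets. *)
Lemma hausdorff_measure_eq0 s A : (0 < s)%R -> dyadic_content s A = 0 ->
  hausdorff_measure s A = 0.
Proof.
move=> s0 A0.
have diam0 : forall B : set R, 0 <= diam B by move=> B; rewrite /diam le_max lexx.
suff pre0 (delta : R) : (0 < delta)%R -> hausdorff_premeasure delta s A = 0.
  rewrite /hausdorff_measure (_ : [set _ | _ in _] = [set 0]) ?ereal_sup1//.
  by apply/seteqP; split=> [_ [d /= /pre0 -> <-]//|_ ->]; exists 1%R => //=; exact: pre0.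
move=> d0; apply/eqP; rewrite eq_le; apply/andP; split; last first.
  by apply: le_ereal_inf_tmp => _ [U _ <-]; apply: nneseries_ge0 => *; exact: poweR_ge0.
apply/lee_addgt0Pr => e e0; rewrite add0e.
have : dyadic_content s A < (Num.min e (delta `^ s))%:E.
  by rewrite A0 lte_fin lt_min e0 powR_gt0.
move=> /net_content_lt[C AC Cc].
pose D (i : nat * int) : set R := if i \in C then dyadic_box i else set0.
have diamD i : diam (D i) <= (if i \in C then 2 ^- i.1 else 0)%:E.
  rewrite /D; case: ifPn => iC; rewrite /diam ge_max ?lexx; last first.
    by apply/andP; split=> //; apply: ge_ereal_sup => _ [x []].
  rewrite lee_fin invr_ge0 exprn_ge0//=.
  apply: ge_ereal_sup => _ [x /= /andP[ix xi] [y /= /andP[iy yi] <-]].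
  rewrite lee_fin -(ler_pM2r (_ : 0 < 2 ^+ i.1)%R) ?exprn_gt0//.
  rewrite mulVf ?expf_neq0// -[X in (_ * X)%R]ger0_norm ?exprn_ge0// -normrM mulrBl.
  rewrite rmorphD /= rmorph1 in xi yi.
  by rewrite ler_norml; apply/andP; split; lra.
have costD i : diam (D i) `^ s <= if i \in C then (dyadic_cost s i)%:E else 0.
  apply: (@le_trans _ _ ((if i \in C then 2 ^- i.1 else 0)%:E `^ s)).
    apply: gt0_ler_poweR; [exact: ltW| | |exact: diamD].
      by rewrite in_itv/= leey andbT.
    rewrite in_itv/= leey andbT lee_fin.
    by case: ifP => // _; rewrite invr_ge0 exprn_ge0.
  by case: ifP => _; rewrite poweR_EFin// powR0// gt_eqF.
pose U j := oapp D set0 (pickle_inv j).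
have diamU0 : diam (set0 : set R) = 0.
  by rewrite /diam (_ : [set _ | _ in _ & _ in _] = set0) ?ereal_sup0 ?maxeNy//; apply/seteqP; split=> [? []|].
apply: (@le_trans _ _ (\sum_(0 <= j <oo) diam (U j) `^ s)).
  apply: ereal_inf_lbound; exists U => //; split.
    move=> x /AC[i Ci ix]; exists (pickle i) => //.
    by rewrite /U pickleK_inv /= /D mem_set.
  move=> j; rewrite /U; case: (pickle_inv j) => [i|]/=; last first.
    by rewrite diamU0 lee_fin ltW.
  apply: (le_trans (diamD i)); case: ifPn => [/set_mem Ci|_]; rewrite lee_fin ?ltW//.
  rewrite ltNge; apply/negP => di.
  have : (delta `^ s <= dyadic_cost s i)%R.
    by apply: le_powRl => //; exact: ltW.
  apply/negP; rewrite -ltNge -lte_fin; apply: (@le_lt_trans _ _ (net_cost (dyadic_cost s) C)).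
    apply: (@le_trans _ _ (net_cost (dyadic_cost s) [set i])).
      by rewrite /net_cost esum_set1// lee_fin dyadic_cost_ge0.
    by apply: le_net_cost; [exact: dyadic_cost_ge0|move=> _ ->].
  by apply: (lt_le_trans Cc); rewrite lee_fin ge_min lexx orbT.
apply: (@le_trans _ _ (net_cost (dyadic_cost s) C)); last first.
  by apply: (le_trans (ltW Cc)); rewrite lee_fin ge_min lexx.
rewrite /net_cost esum_mkcond -nneseries_pickle_inv; last first.
  by move=> i; case: ifP => // _; rewrite lee_fin dyadic_cost_ge0.
apply: lee_nneseries => j _; first by move=> _; exact: poweR_ge0.
rewrite /U; case: (pickle_inv j) => [i|]/=; first exact: costD.
by rewrite diamU0 poweR0r// gt_eqF.
Qed.

End DyadicContent.

(** * Souslin sets and capacitability *)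

Section Souslin.
Context {R : realType}.
Implicit Types (C : R -> (nat -> nat) -> Prop) (A : set R).

(** The closed subsets of the product of the line with the Baire space, in terms
of approximating sequences. *)
Definition approx_closed C := forall x sigma,
  (forall n : nat, exists y tau, [/\ C y tau, (`|x - y| < 2 ^- n)%R &
     forall i, (i < n)%N -> tau i = sigma i]) -> C x sigma.

(** Projections of closed subsets of the product of the line with the Baire
space. *)
Definition souslin A :=
  exists2 C, approx_closed C & A = [set x | exists sigma, C x sigma].

Lemma souslin_closed A : closed A -> souslin A.
Proof.
move=> clA; exists (fun x _ => A x).
  move=> x sigma h; apply: clA => B /nbhs_ballP[e /= e0 eB].
  have [n ne] := exists_half_expn_lt e0; have [y [_ [Ay xy _]]] := h n.
  by exists y; split=> //; apply: eB; exact: lt_trans ne.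
by apply/seteqP; split=> x /= => [Ax|[]//]; exists (fun=> 0%N).
Qed.

Lemma souslin_bigcup (F : nat -> set R) :
  (forall n, souslin (F n)) -> souslin (\bigcup_n F n).
Proof.
move=> /(_ _)/cid2 h; pose C n := sval (h n).
have Ccl n : approx_closed (C n) by rewrite /C; case: (h n).
have FE n : F n = [set x | exists sigma, C n x sigma] by rewrite /C; case: (h n).
exists (fun x sigma => C (sigma 0%N) x (fun i => sigma i.+1)).
  move=> x sigma app; apply: Ccl => n.
  have [y [tau [Cy xy ts]]] := app n.+1.
  exists y, (fun i => tau i.+1); split.
  - by rewrite -ts.
  - apply: (lt_le_trans xy); rewrite lef_pV2 ?posrE ?exprn_gt0//.
    by rewrite ler_weXn2l// ler1n.
  - by move=> i ni; apply: ts.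
apply/seteqP; split=> x /=.
  move=> [n _]; rewrite FE => -[sigma Cx].
  by exists (fun i => if i is j.+1 then sigma j else n).
by move=> [sigma Cx]; exists (sigma 0%N) => //; rewrite FE; exists (fun i => sigma i.+1).
Qed.

(** A point of the intersection is witnessed by a sequence of sequences, stored
in a single one through the pairing of nat. *)
Lemma souslin_bigcap (F : nat -> set R) :
  (forall n, souslin (F n)) -> souslin (\bigcap_n F n).
Proof.
move=> /(_ _)/cid2 h; pose C n := sval (h n).
have Ccl n : approx_closed (C n) by rewrite /C; case: (h n).
have FE n : F n = [set x | exists sigma, C n x sigma] by rewrite /C; case: (h n).
(* row n recovers the n-th witness; its first N terms are read off the first
   M terms of sigma. *)
pose row (n : nat) (sigma : nat -> nat) (i : nat) := sigma (pickle (n, i)).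
exists (fun x sigma => forall n, C n x (row n sigma)).
  move=> x sigma app n; apply: Ccl => N.
  pose M := (N + \max_(i < N) (pickle (n, nat_of_ord i)).+1)%N.
  have [y [tau [Cy xy ts]]] := app M.
  exists y, (row n tau); split=> //.
    apply: (lt_le_trans xy); rewrite lef_pV2 ?posrE ?exprn_gt0//.
    by rewrite ler_weXn2l ?ler1n// leq_addr.
  move=> i iN; apply: ts; rewrite /M.
  apply: (@leq_trans (\max_(i < N) (pickle (n, nat_of_ord i)).+1)%N); last exact: leq_addl.
  exact: (leq_bigmax (F := fun j : 'I_N => (pickle (n, val j)).+1) (Ordinal iN)).
apply/seteqP; split=> x /=.
  move=> Fx.
  have /choice[s sP] : forall n, exists sigma, C n x sigma.
    by move=> n; have := Fx n I; rewrite FE.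
  exists (fun k => if unpickle k is Some (n, i) then s n i else 0%N) => n.
  rewrite (_ : row _ _ = s n)//; apply/funext => i.
  by rewrite /row pickleK.
by move=> [sigma Cx] n _; rewrite FE; exists (row n sigma).
Qed.

(** The sets that are Souslin together with their complement form a sigma-algebra
containing the open half-lines. *)
Lemma souslin_measurable A : measurable A -> souslin A.
Proof.
pose S := [set B : set R | souslin B /\ souslin (~` B)].
suff h : (@measurable _ (measurableTypeR R) : set (set R)) `<=` S.
  by move=> mA; have [] := h _ mA.
rewrite RGenOInfty.measurableE.
apply: smallest_sub; first split.
- split; first exact/souslin_closed/closed0.
  by rewrite setC0; exact/souslin_closed/closedT.
- by move=> B [sB sBc]; split; rewrite ?setTD ?setCK.
- move=> F FS; split; first by apply: souslin_bigcup => n; case: (FS n).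
  by rewrite setC_bigcup; apply: souslin_bigcap => n; case: (FS n).
- move=> _ [x ->]; split.
    rewrite itvoyEbigcup; apply: souslin_bigcup => n; apply: souslin_closed.
    by rewrite set_itvE; exact: closed_ge.
  rewrite setCitvr; by apply: souslin_closed; rewrite set_itvE; exact: closed_le.
Qed.

(** Compactness of [0, 1] times a product of finite sets, by an ultrafilter: each
coordinate of sigma takes finitely many values, hence one of them on a set of
the ultrafilter, and these values and a cluster point of x form a limit point. *)
Lemma souslin_cluster C (x : nat -> R) (sigma : nat -> nat -> nat) (m : nat -> nat) :
  approx_closed C -> (forall n, 0 <= x n <= 1)%R ->
  (forall n, C (x n) (sigma n)) ->
  (forall n i, (i < n)%N -> (sigma n i <= m i)%N) ->
  exists y tau, [/\ C y tau, forall i, (tau i <= m i)%N &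
    forall e : R, (0 < e)%R -> forall N, exists2 n, (N <= n)%N & (`|y - x n| < e)%R].
Proof.
move=> Ccl x01 Cx sm.
have [U [UU ooU]] := @ultraFilterLemma _ \oo _.
have FU : ProperFilter U by exact: ultra_proper.
have tail N : U [set n | (N <= n)%N] by apply: ooU; exists N.
have pick i M : U [set n | (sigma n i <= M)%N] ->
    exists2 v, (v <= M)%N & U [set n | sigma n i = v].
  elim: M => [UM|M IH UM].
    by exists 0%N => //; apply: filterS UM => n /=; rewrite leqn0 => /eqP.
  have [UE|UN] := in_ultra_setVsetC [set n | sigma n i = M.+1] UU.
    by exists M.+1.
  have [|v vM Uv] := IH; last by exists v => //; exact: leqW.
  by apply: filterS (filterI UM UN) => n /= [] ; rewrite leq_eqVlt => /orP[/eqP //|].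
have /choice[tau tauP] : forall i, exists v, (v <= m i)%N /\ U [set n | sigma n i = v].
  move=> i; have [|v] := pick i (m i); last by exists v.
  by apply: filterS (tail i.+1) => n /=; exact: sm.
have [|y [_ clu]] := @segment_compact _ 0%R 1%R (x @ U) _.
  suff : U (x @^-1` `[0%R, 1%R]) by [].
  by apply: filterS (@filterT _ U _) => n _; rewrite /= in_itv/=; exact: x01.
have near_y (S : set nat) (e : R) : U S -> (0 < e)%R -> exists2 n, S n & (`|y - x n| < e)%R.
  move=> US e0; have [||_ [[n Sn <-] yn]] := clu (x @` S) (ball y e).
  - suff : U (x @^-1` (x @` S)) by [].
    by apply: filterS US => n Sn; exists n.
  - exact: nbhsx_ballx.
  by exists n.
exists y, tau; split.
- apply: Ccl => n.
  have [|k Sk yk] := @near_y [set k | forall i, (i < n)%N -> sigma k i = tau i] (2 ^- n)%R _ (half_expn_gt0 _ _).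
    elim: n => [|n IH]; first by apply: filterS filterT.
    apply: filterS (filterI IH (tauP n).2) => k [/= ih kn] i.
    by rewrite ltnS leq_eqVlt => /orP[/eqP ->|/ih].
  by exists (x k), (sigma k).
- by move=> i; case: (tauP i).
- by move=> e e0 N; have [n] := near_y _ _ (tail N) e0; exists n.
Qed.

(** Choquet's capacitability theorem.  The coordinates of the witnesses are bounded
one after the other, keeping phi > c by continuity along increasing sequences;
the points with a fully bounded witness form a compact set K.  An open
neighbourhood of K contains one of the sets in which finitely many coordinates
are bounded, hence phi K >= c by outer regularity. *)
Lemma souslin_capacitable (phi : set R -> \bar R) A (c : \bar R) :
  {homo phi : X Y / X `<=` Y >-> X <= Y} ->
  (forall F b, (forall n, F n `<=` F n.+1) -> (forall n, phi (F n) <= b) ->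
     phi (\bigcup_n F n) <= b) ->
  (forall X b, phi X < b -> exists U, [/\ open U, X `<=` U & phi U < b]) ->
  souslin A -> A `<=` `[0%R, 1%R] -> c < phi A ->
  exists K, [/\ closed K, K `<=` A & c <= phi K].
Proof.
move=> phi_mono phi_cont phi_out [C Ccl AE] A01 cA.
(* S p bounds the first size p coordinates of the witness by those of p. *)
pose S (p : seq nat) := [set x | exists2 sigma, C x sigma &
  forall i, (i < size p)%N -> (sigma i <= nth 0%N p i)%N].
have step p : c < phi (S p) -> exists k, c < phi (S (rcons p k)).
  move=> cp; apply/not_existsP => ncp; move: cp; apply/negP; rewrite -leNgt.
  have -> : S p = \bigcup_k S (rcons p k).
    apply/seteqP; split=> x.
      move=> [sigma Cx sp]; exists (sigma (size p)) => //; exists sigma => // i.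
      rewrite size_rcons ltnS leq_eqVlt nth_rcons => /orP[/eqP ->|ip].
        by rewrite ltnn eqxx.
      by rewrite ip; exact: sp.
    move=> [k _ [sigma Cx sp]]; exists sigma => // i ip.
    by have := sp i; rewrite size_rcons nth_rcons ip ltnS (ltnW ip) => /(_ isT).
  apply: phi_cont => n; last by rewrite leNgt; apply/negP; exact: ncp.
  move=> x [sigma Cx sp]; exists sigma => // i; have := sp i.
  rewrite !size_rcons !nth_rcons => h ip; move: (h ip).
  by case: ltngtP => // _ le_n; exact: leqW.
have /choice[h hP] : forall p, exists k, c < phi (S p) -> c < phi (S (rcons p k)).
  move=> p; have [/step[k]|] := pselect (c < phi (S p)); first by exists k.
  by exists 0%N.
pose p n := iter n (fun q => rcons q (h q)) [::].
have pS n : p n.+1 = rcons (p n) (h (p n)) by [].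
have cp n : c < phi (S (p n)).
  elim: n => [|n IH]; last by rewrite pS; exact: hP.
  by rewrite (_ : S _ = A)// AE; apply/seteqP; split=> x [sigma]; exists sigma.
have szp n : size (p n) = n by elim: n => // n IH; rewrite pS size_rcons IH.
pose m i := h (p i).
have nthp n i : (i < n)%N -> nth 0%N (p n) i = m i.
  elim: n => // n IH; rewrite ltnS pS nth_rcons szp leq_eqVlt => /orP[/eqP ->|lin].
    by rewrite ltnn eqxx.
  by rewrite lin IH.
pose K := [set x | exists2 sigma, C x sigma & forall i, (sigma i <= m i)%N].
have KA : K `<=` A by move=> x [sigma Cx _]; rewrite AE; exists sigma.
exists K; split=> //.
- move=> y clKy.
  have /choice[x xP] : forall n, exists x, K x /\ (`|y - x| < 2 ^- n)%R.
    move=> n; have [x [Kx yx]] := clKy _ (nbhsx_ballx y _ (half_expn_gt0 R n)).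
    by exists x.
  have /choice[sigma sP] : forall n, exists sigma, C (x n) sigma /\
      forall i, (sigma i <= m i)%N.
    by move=> n; have [[sigma Cx sm] _] := xP n; exists sigma.
  have [|||z [tau [Cz tm zx]]] := @souslin_cluster C x sigma m Ccl.
  - by move=> n; have := A01 _ (KA _ (xP n).1); rewrite /= in_itv.
  - by move=> n; case: (sP n).
  - by move=> n i _; case: (sP n).
  suff -> : y = z by exists tau.
  apply/eqP; rewrite -subr_eq0 -normr_le0; apply/ler_addgt0Pl => e e0; rewrite addr0.
  have e20 : (0 < e / 2)%R by rewrite divr_gt0.
  have [N Ne] := exists_half_expn_lt e20.
  have [n Nn zn] := zx _ e20 N.
  have [_ yn] := xP n.
  rewrite (_ : y - z = (y - x n) - (z - x n))%R; last by lra.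
  apply: (le_trans (ler_normB _ _)).
  have : (2 ^- n <= 2 ^- N :> R)%R.
    by rewrite lef_pV2 ?posrE ?exprn_gt0// ler_weXn2l ?ler1n.
  by lra.
- rewrite leNgt; apply/negP => /phi_out[U [oU KU Uc]].
  have /choice[x xP] : forall n, exists x, S (p n) x /\ ~ U x.
    move=> n; apply/not_existsP => h'; have := lt_trans Uc (cp n).
    apply/negP; rewrite -leNgt; apply: phi_mono => x Sx.
    by apply: contrapT => nUx; apply: (h' x).
  have /choice[sigma sP] : forall n, exists sigma, C (x n) sigma /\
      forall i, (i < n)%N -> (sigma i <= m i)%N.
    move=> n; have [[sigma Cx sm] _] := xP n; exists sigma; split=> // i lin.
    by rewrite -(nthp n)//; apply: sm; rewrite szp.
  have [|||z [tau [Cz tm zx]]] := @souslin_cluster C x sigma m Ccl.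
  - move=> n; have : A (x n) by rewrite AE; case: (sP n) => Cx _; exists (sigma n).
    by move=> /A01; rewrite /= in_itv.
  - by move=> n; case: (sP n).
  - by move=> n; case: (sP n).
  have /KU/oU : K z by exists tau.
  move=> /nbhs_ballP[e /= e0 eU]; have [n _ zn] := zx e e0 0%N.
  by case: (xP n) => _; apply; exact: eU.
Qed.

End Souslin.

(** * Frostman measures *)

Lemma lebesgue_stieltjes_ocitv (R : realType) (f : cumulative R R) (x y : R) :
  (x <= y)%R -> lebesgue_stieltjes_measure f `]x, y] = (f y - f x)%:E.
Proof.
move=> xy; rewrite /lebesgue_stieltjes_measure /measure_extension.
by rewrite measurable_mu_extE/=; [rewrite wlength_itv_bnd|exact: is_ocitv].
Qed.

Section Frostman.
Context {R : realType}.
Variables (s : R) (K : set R).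
Hypotheses (s_gt0 : (0 < s)%R) (clK : closed K) (K01 : K `<=` `[0%R, 1%R]).

Let C : R := (2 * 2 `^ s)%R.

Let C_gt0 : (0 < C)%R. Proof. by rewrite mulr_gt0 ?powR_gt0. Qed.

Lemma dyadic_content_lty (A : set R) : A `<=` K -> dyadic_content s A < +oo.
Proof.
move=> AK; apply: (@le_lt_trans _ _ ((C * 1 `^ s)%:E + (C * 1 `^ s)%:E)); last by rewrite -EFinD ltry.
apply: (@le_trans _ _ (dyadic_content s (A `&` `](-1)%R, 0%R] `|` A `&` `]0%R, 1%R]))).
  apply: le_dyadic_content => x Ax; have := K01 (AK _ Ax).
  rewrite /= !in_itv/= => /andP[x0 x1].
  by have [xl|xl] := leP x 0%R; [left|right]; split=> //; rewrite ?xl ?x1 ?andbT//; lra.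
apply: (le_trans (dyadic_contentU _ _ _)); apply: leeD.
- have := @dyadic_content_ocitv R s (A `&` `](-1)%R, 0%R]) (-1)%R 0%R (ltW s_gt0).
  by rewrite sub0r opprK; apply; [rewrite lexx ltr01|exact: subIsetr].
- have := @dyadic_content_ocitv R s (A `&` `]0%R, 1%R]) 0%R 1%R (ltW s_gt0).
  by rewrite subr0; apply; [rewrite lexx ltr01|exact: subIsetr].
Qed.

Let g (x : R) : R := fine (dyadic_content s (K `&` `]-oo, x])).

Let gE x : dyadic_content s (K `&` `]-oo, x]) = (g x)%:E.
Proof.
by rewrite fineK// ge0_fin_numE ?dyadic_content_ge0//; apply: dyadic_content_lty; exact: subIsetl.
Qed.

Let g_nd : nondecreasing g.
Proof.
move=> x y xy; rewrite -lee_fin -!gE; apply: le_dyadic_content; apply: setIS.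
by move=> z /=; rewrite !in_itv/= => /le_trans; apply.
Qed.

Let g_lip x y : (0 < y - x <= 1)%R -> (g y <= g x + C * (y - x) `^ s)%R.
Proof.
move=> xy; rewrite -lee_fin EFinD -!gE.
have := @dyadic_content_ocitv R s (K `&` `]x, y]) x y (ltW s_gt0) xy (@subIsetr _ _ _).
rewrite -/C => h; apply: le_trans (leeD2l _ h).
rewrite (_ : K `&` `]-oo, y] = (K `&` `]-oo, x]) `|` (K `&` `]x, y])).
  exact: dyadic_contentU.
rewrite -setIUr; congr (_ `&` _); apply/seteqP; split=> z /=; rewrite !in_itv/=.
  by move=> zy; case: (leP z x); [left|right; rewrite zy].
by move=> [zx|/andP[]//]; move: xy => /andP[]; lra.
Qed.

Let g_rc : right_continuous g.
Proof.
move=> x; apply/cvgrPdist_le => e e0.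
have d0 : (0 < (e / C) `^ s^-1)%R by rewrite powR_gt0// divr_gt0.
near=> y.
have xy : (x < y)%R by near: y; exact: nbhs_right_gt.
have yx1 : (y - x <= 1)%R.
  by rewrite lerBlDl; near: y; apply: nbhs_right_le; rewrite ltrDl.
have yxd : (y - x <= (e / C) `^ s^-1)%R.
  by rewrite lerBlDl; near: y; apply: nbhs_right_le; rewrite ltrDl.
rewrite distrC ger0_norm ?subr_ge0 ?g_nd ?(ltW xy)// lerBlDl.
apply: (le_trans (@g_lip x y _)); first by rewrite subr_gt0 xy.
rewrite lerD2l -ler_pdivlMl// mulrC.
apply: (@le_trans _ _ (((e / C) `^ s^-1) `^ s)%R).
  by apply: le_powRl; rewrite ?subr_ge0 ?(ltW s_gt0) ?(ltW xy).
by rewrite -powRrM mulVf ?gt_eqF// powRr1// divr_ge0// ltW.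
Unshelve. all: by end_near. Qed.

Let f : cumulative R R := HB.pack g (isCumulative.Build R _ R g g_nd g_rc).

Let mu : {sigma_finite_measure set (measurableTypeR R) -> \bar R} :=
  lebesgue_stieltjes_measure f.

Let muE x y : (x <= y)%R -> mu `]x, y]%classic = (g y - g x)%:E.
Proof. exact: lebesgue_stieltjes_ocitv. Qed.

Let mu_gap x y : `]x, y] `<=` ~` K -> mu `]x, y]%classic = 0.
Proof.
move=> xyK; have [xy|yx] := leP x y; last by rewrite set_itv_ge ?measure0// bnd_simp -leNgt ltW.
rewrite muE//; congr (_%:E); apply/eqP; rewrite subr_eq0; apply/eqP.
congr (fine (dyadic_content s _)); apply/seteqP; split=> z [Kz]; rewrite /= in_itv/= => zy.
  split=> //; rewrite /= in_itv/= leNgt; apply/negP => xz.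
  by apply: (xyK z) => //; rewrite /= in_itv/= xz.
by split=> //; rewrite /= in_itv/=; exact: le_trans xy.
Qed.

Let mu_setC : mu (~` K) = 0.
Proof.
have mK : measurable (~` K : set (measurableTypeR R)).
  by apply: measurableC; exact: closed_measurable.
apply: measure_negligible => //.
pose F (j : nat) : set (measurableTypeR R) := if unpickle j is Some (p, q) then
  if `[< `](ratr p : R), ratr q] `<=` ~` K >] then `](ratr p : R), ratr q]%classic else set0 else set0.
apply: (@negligibleS _ (measurableTypeR R) _ mu (\bigcup_j F j)); last first.
  apply: negligible_bigcup => j; rewrite /F; case: unpickle => [[p q]|]; last exact: negligible_set0.
  case: asboolP => h; last exact: negligible_set0.
  by apply/negligibleP; [exact: measurable_itv|exact: mu_gap].
move=> x Kx; have oK : open (~` K) by exact: closed_openC.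
have /nbhs_ballP[e /= e0 eK] := oK _ Kx.
have xe : (x - e < x)%R by rewrite gtrBl.
have ex : (x < x + e)%R by rewrite ltrDl.
have [p /=] := rat_in_itvoo xe; rewrite in_itv/= => /andP[p1 p2].
have [q /=] := rat_in_itvoo ex; rewrite in_itv/= => /andP[q1 q2].
suff FE : F (pickle (p, q)) = `](ratr p : R), ratr q]%classic.
  by exists (pickle (p, q)); [exact: I|rewrite FE /= in_itv/= p2 ltW].
rewrite /F pickleK ifT//; apply/asboolP => z; rewrite /= in_itv/= => /andP[pz zq]; apply: eK.
by rewrite /ball/= ltr_distlC; apply/andP; split; lra.
Qed.

Let mu_setT : mu setT = dyadic_content s K.
Proof.
have mK : measurable (~` K : set (measurableTypeR R)).
  by apply: measurableC; exact: closed_measurable.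
have m11 : (-1 <= 1 :> R)%R by lra.
have KE : K `&` `]-oo, 1%R] = K.
  apply/seteqP; split=> [z []//|z Kz]; split=> //.
  by have := K01 Kz; rewrite /= !in_itv/= => /andP[].
have K0 : K `&` `]-oo, (-1)%R] = set0.
  apply/seteqP; split=> [z [/K01]|//]; rewrite /= !in_itv/= => /andP[? _] ?; clear KE; lra.
rewrite -[in RHS]KE gE (_ : setT = `](-1)%R, 1%R] `|` ~` K).
  rewrite measureU0 ?mu_setC//; transitivity ((g 1 - g (-1))%R%:E); first exact: muE.
  by rewrite [X in (_ - X)%R]/g K0 dyadic_content0 fine0 subr0.
apply/seteqP; split=> // x _; have [Kx|] := pselect (K x); last by right.
by left; have := K01 Kx; rewrite /= !in_itv/= => /andP[? ->]; rewrite andbT; lra.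
Qed.

(** The increment of x |-> content (K `&` ]-oo, x]) over ]x, y] is at most the
content of ]x, y], of order (y - x)^s.  Its Stieltjes measure vanishes on the
intervals with rational ends that miss K, whose union is the complement of K. *)
Lemma frostman_compact : exists mu : {sigma_finite_measure set (measurableTypeR R) -> \bar R},
  [/\ mu (~` K) = 0, mu setT = dyadic_content s K &
    forall x y, (0 < y - x <= 1)%R -> mu `]x, y]%classic <= (C * (y - x) `^ s)%:E].
Proof.
exists mu; split; [exact: mu_setC|exact: mu_setT|].
move=> x y xy; rewrite muE ?lee_fin ?lerBlDl; last by case/andP: xy; lra.
exact: g_lip.
Qed.

End Frostman.

Lemma frostman (R : realType) (s : R) (A : set R) : (0 < s)%R ->
  measurable A -> A `<=` `[0%R, 1%R] -> hausdorff_measure s A <> 0 ->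
  exists (K : set R) (C : R)
    (mu : {sigma_finite_measure set (measurableTypeR R) -> \bar R}),
  [/\ closed K, K `<=` A, mu (~` K) = 0, 0 < mu setT < +oo &
    forall x y, (0 < y - x <= 1)%R ->
      mu `]x, y]%classic <= (C * (y - x) `^ s)%:E].
Proof.
move=> s0 mA A01 HA.
have cA0 : 0 < dyadic_content s A.
  rewrite lt_neqAle dyadic_content_ge0 andbT eq_sym; apply/eqP.
  by move/(hausdorff_measure_eq0 s0).
have [c [c0 cA]] : exists c : R, (0 < c)%R /\ c%:E < dyadic_content s A.
  case: dyadic_content cA0 => [r| |]//; last by exists 1%R; rewrite ltry.
  by rewrite lte_fin => r0; exists (r / 2)%R; rewrite lte_fin; split; lra.
have [||||||K [clK KA cK]] := @souslin_capacitable R (dyadic_content s) A c%:E.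
- by move=> X Y; exact: le_dyadic_content.
- by move=> F b; exact: dyadic_content_bigcup_le.
- by move=> X b; exact: dyadic_content_outer_regular.
- exact: souslin_measurable.
- by [].
- exact: cA.
have K01 := subset_trans KA A01.
have [mu [muK muT mu_le]] := frostman_compact s0 clK K01.
exists K, (2 * 2 `^ s)%R, mu; split=> //; rewrite muT.
by rewrite (lt_le_trans _ cK) ?lte_fin//= (dyadic_content_lty s0 K01).
Qed.

(** * Gaussian small balls and tails *)

Lemma expR_decay (R : realType) (p : nat) (y : R) : (0 <= y)%R -> (expR (- y) * y ^+ p <= p%:R ^+ p)%R.
Proof.
move=> y0; rewrite expRN ler_pdivrMl ?expR_gt0//.
case: p => [|p]; first by rewrite !expr0 mulr1 -expR0 ler_expR.
have p0 : (0 < p.+1%:R :> R)%R by rewrite ltr0n.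
have -> : y = (p.+1%:R * (y / p.+1%:R))%R by rewrite mulrC divfK// gt_eqF.
have : (0 <= y / p.+1%:R)%R by rewrite divr_ge0.
move: (y / _)%R => z z0; rewrite expRM_natl exprMn mulrC ler_pM2r ?exprn_gt0//.
rewrite lerXn2r ?nnegrE ?expR_ge0//; apply: le_trans (expR_ge1Dx _).
by rewrite lerDr.
Qed.

Section NormalLaw.
Context {R : realType}.
Implicit Types m s r y : R.

(** Half of the Gaussian exponent is given up in exchange for a density of twice
the standard deviation, which still integrates to one: this gives Gaussian
tails without computing any integral. *)
Lemma normal_pdf_le_double m s x y : (0 < s)%R -> (y <= (x - m) ^+ 2 / (4 * s ^+ 2))%R ->
  (normal_pdf m s x <= 2 * expR (- y) * normal_pdf m (2 * s) x)%R.
Proof.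
move=> s0 yx; rewrite !normal_pdfE ?gt_eqF ?mulr_gt0//.
have -> : normal_peak s = (2 * normal_peak (2 * s))%R.
  rewrite /normal_peak (_ : (2 * s) ^+ 2 * pi *+ 2 = 2 ^+ 2 * (s ^+ 2 * pi *+ 2))%R; last by ring.
  by rewrite sqrtrM ?sqr_ge0// sqrtr_sqr ger0_norm// invfM mulrA divff// mul1r.
rewrite -2!mulrA ler_pM2l// mulrCA ler_wpM2l ?normal_peak_ge0//.
rewrite /normal_fun -expRD ler_expR.
set z := ((x - m) ^+ 2)%R in yx *.
have z0 : (0 <= z)%R by rewrite sqr_ge0.
apply: (@le_trans _ _ (- (z / (4 * s ^+ 2)) + - z / ((2 * s) ^+ 2 *+ 2))%R); last first.
  by rewrite lerD2r lerN2.
rewrite -subr_ge0 (_ : _ - _ = z / (8 * s ^+ 2))%R; last by field; lra.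
by rewrite divr_ge0// mulr_ge0// sqr_ge0.
Qed.

Lemma normal_prob_tail m s y (U : set R) : (0 < s)%R -> measurable U ->
  (forall x, U x -> y <= (x - m) ^+ 2 / (4 * s ^+ 2))%R ->
  normal_prob m s U <= (2 * expR (- y))%:E.
Proof.
move=> s0 mU Uy.
have c0 : (0 <= 2 * expR (- y) :> R)%R by rewrite mulr_ge0 ?expR_ge0.
apply: (@le_trans _ _ ((2 * expR (- y))%:E * normal_prob m (2 * s) U)); last first.
  rewrite -[leRHS]mule1 lee_wpmul2l ?lee_fin//.
  exact: (probability_le1 (normal_prob m (2 * s))).
rewrite /normal_prob -ge0_integralZl_EFin//=; last 2 first.
- by move=> x _; rewrite lee_fin normal_pdf_ge0.
- by apply/measurable_EFinP; apply: measurable_funTS; exact: measurable_normal_pdf.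
apply: ge0_le_integral => //=.
- by move=> x _; rewrite lee_fin normal_pdf_ge0.
- by apply/measurable_EFinP; apply: measurable_funTS; exact: measurable_normal_pdf.
- apply/measurable_EFinP; apply: measurable_funM => //.
  by apply: measurable_funTS; exact: measurable_normal_pdf.
- by move=> x Ux; rewrite -EFinM lee_fin normal_pdf_le_double ?Uy.
Qed.

(** The density is at most its peak 1 / (s sqrt(2 pi)) <= 1 / (2 s). *)
Lemma normal_prob_ball m s r : (0 < s)%R -> (0 <= r)%R ->
  normal_prob m s `[(- r)%R, r] <= (r / s)%:E.
Proof.
move=> s0 r0; have rr : (- r <= r)%R by lra.
have peak_le : (normal_peak s <= (2 * s)^-1)%R.
  rewrite /normal_peak lef_pV2 ?posrE ?mulr_gt0 ?sqrtr_gt0//; last first.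
    by rewrite mulrn_wgt0// mulr_gt0 ?exprn_gt0 ?pi_gt0.
  rewrite -(@ger0_norm _ (2 * s)%R) ?mulr_ge0 ?(ltW s0)// -sqrtr_sqr ler_wsqrtr//.
  have s2 : (0 < s ^+ 2)%R by rewrite exprn_gt0.
  by rewrite mulr2n exprMn; have := pi_ge2 R; nra.
apply: (@le_trans _ _ (\int[lebesgue_measure]_(x in `[(- r)%R, r]%classic) ((2 * s)^-1)%:E)).
  apply: ge0_le_integral => //=.
  - by move=> x _; rewrite lee_fin normal_pdf_ge0.
  - by apply/measurable_EFinP; apply: measurable_funTS; exact: measurable_normal_pdf.
  - by move=> x _; rewrite lee_fin (le_trans (normal_pdf_ub _ _ _)) ?gt_eqF.
rewrite integral_cst//= lebesgue_measure_itv/= lte_fin.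
case: ifP => _; last by rewrite mule0 lee_fin divr_ge0// ltW.
rewrite -EFinB -EFinM lee_fin opprK.
have -> : ((2 * s)^-1 * (r + r) = r / s)%R by field; rewrite gt_eqF.
exact: lexx.
Qed.

End NormalLaw.

Lemma nneseries_geometric (R : realType) (a q : R) : (0 <= q < 1)%R ->
  \sum_(0 <= k <oo) (a * q ^+ k)%:E = (a / (1 - q))%:E.
Proof.
move=> /andP[q0 q1]; apply: cvg_lim => //.
have -> : (fun n => \sum_(0 <= k < n) (a * q ^+ k)%:E) =
    EFin \o (series (geometric a q)).
  by apply/funext => n /=; rewrite sumEFin.
apply: cvg_EFin; first by near=> n.
by apply: cvg_geometric_series; rewrite ger0_norm.
Unshelve. all: by end_near. Qed.

(** A nonnegative Y is at most a times the number of k with k a <= Y. *)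
Lemma integral_le_layers d (T : measurableType d) (R : realType)
    (mu : {measure set T -> \bar R}) (Y : T -> R) (a : R) :
  measurable_fun setT Y -> (forall w, 0 <= Y w)%R -> (0 < a)%R ->
  \int[mu]_w (Y w)%:E <=
  \sum_(0 <= k <oo) a%:E * mu [set w | (k%:R * a <= Y w)%R].
Proof.
move=> mY Y0 a0; pose U k := [set w | (k%:R * a <= Y w)%R].
have mU k : measurable (U k).
  rewrite (_ : U k = Y @^-1` `[(k%:R * a)%R, +oo[); last first.
    by apply/seteqP; split=> w; rewrite /U /= in_itv/= andbT.
  by rewrite -[_ @^-1` _]setTI; exact: mY.
pose f k w := a%:E * (\1_(U k) w)%:E.
have f0 k w : 0 <= f k w by rewrite mule_ge0// lee_fin// ltW.
have mf k : measurable_fun setT (f k).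
  by apply: emeasurable_funM => //; apply/measurable_EFinP.
have -> : \sum_(0 <= k <oo) a%:E * mu (U k) = \int[mu]_w (\sum_(0 <= k <oo) f k w).
  rewrite integral_nneseries//; apply: eq_eseriesr => k _.
  by rewrite ge0_integralZl_EFin ?ltW// ?integral_indic ?setIT//; apply/measurable_EFinP.
apply: ge0_le_integral => //.
- by move=> w _; rewrite lee_fin.
- by apply/measurable_EFinP.
- by apply: ge0_emeasurable_sum.
- move=> w _; pose N := (Num.truncn (Y w / a)).+1.
  apply: le_trans (nneseries_lim_ge N _) => //.
  rewrite (eq_big_nat _ _ (F2 := fun=> a%:E)); last first.
    move=> k /andP[_ kN]; rewrite /f indicE mem_set ?mule1//.
    rewrite /U /= -ler_pdivlMr//.
    apply: (@le_trans _ _ (Num.truncn (Y w / a))%:R); first by rewrite ler_nat.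
    by rewrite truncn_le divr_ge0// ltW.
  rewrite sumEFin lee_fin sumr_const_nat subn0 -mulr_natl -ler_pdivrMr//.
  exact/ltW/truncnS_gt.
Qed.

Definition gaussian_tail_cst {R : realType} (p : nat) : R := (2 * (512 * p%:R) ^+ p)%R.

Lemma gaussian_tail_cst_ge0 {R : realType} p : (0 <= gaussian_tail_cst p :> R)%R.
Proof.
apply: mulr_ge0; first exact: ler0n.
by apply: exprn_ge0; apply: mulr_ge0; exact: ler0n.
Qed.

Section GaussianVariable.
Context {disp : measure_display} {T : measurableType disp} {R : realType}.
Variable P : probability T R.

(** The moments are stated separately from the law, whose parameters m and sigma
are existential; they are compared in [gaussian_scale]. *)
Definition centered_gaussian (v : R) (X : T -> R) : Prop :=
  [/\ measurable_fun setT X, is_gaussian P X, \int[P]_w (X w)%:E = 0 &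
      \int[P]_w ((X w) ^+ 2)%:E = v%:E].

Variables (X : T -> R) (v : R).
Hypotheses (v_gt0 : (0 < v)%R) (gX : centered_gaussian v X).

Let mX : measurable_fun setT X. Proof. by case: gX. Qed.

Let mX2 : measurable_fun setT (fun w => ((X w) ^+ 2)%:E).
Proof. by apply/measurable_EFinP; exact: measurable_funX. Qed.

Let integrable_sq : P.-integrable setT (fun w => ((X w) ^+ 2)%:E).
Proof.
apply/integrableP; split=> //.
by under eq_integral do rewrite gee0_abs ?lee_fin ?sqr_ge0//; case: gX => _ _ _ ->; rewrite ltry.
Qed.

Let integrable_id : P.-integrable setT (fun w => (X w)%:E).
Proof.
apply: (@le_integrable _ _ _ P setT measurableT _ (fun w => (1 + (X w) ^+ 2)%:E)).
- exact/measurable_EFinP.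
- move=> w _; rewrite !abse_EFin lee_fin [leRHS]ger0_norm ?addr_ge0 ?sqr_ge0//.
  by rewrite ler_norml; apply/andP; split; nra.
- under eq_fun do rewrite EFinD.
  apply: integrableD => //; exact: finite_measure_integrable_cst.
Qed.

Lemma centered_second_moment m :
  \int[P]_w ((X w - m) ^+ 2)%:E = (v + m ^+ 2)%:E.
Proof.
have [_ _ EX EX2] := gX.
transitivity (\int[P]_w (((X w) ^+ 2)%:E + ((- (2 * m))%:E * (X w)%:E + (m ^+ 2)%:E))).
  by apply: eq_integral => w _; rewrite -EFinM -!EFinD; congr (_%:E); ring.
have i1 : P.-integrable setT (fun w => (- (2 * m))%:E * (X w)%:E) by exact: integrableZl.
have i2 : P.-integrable setT (fun w => (m ^+ 2)%:E) by exact: finite_measure_integrable_cst.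
rewrite integralD//=; last exact: integrableD.
rewrite integralD//= integralZl// EX mule0 add0e EX2 integral_cst//=.
by rewrite probability_setT mule1 -EFinD.
Qed.

Lemma sq_deviation_markov m (a : R) : (0 <= a)%R ->
  a%:E * P [set w | (a <= (X w - m) ^+ 2)%R] <= \int[P]_w ((X w - m) ^+ 2)%:E.
Proof.
move=> a0; set U := [set w | _].
have mY : measurable_fun setT (fun w => (X w - m) ^+ 2)%R.
  by apply: measurable_funX; exact: measurable_funB.
have mU : measurable U.
  rewrite (_ : U = (fun w => (X w - m) ^+ 2)%R @^-1` `[a, +oo[).
    by rewrite -[_ @^-1` _]setTI; apply: mY.
  by apply/seteqP; split=> w; rewrite /U /= in_itv/= andbT.
rewrite -[P U]mul1e -[1%:E * _]integral_cst// -ge0_integralZl_EFin//.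
rewrite integral_mkcond/=; apply: ge0_le_integral => //.
- by move=> w _; rewrite patchE; case: ifP => // _; rewrite lee_fin mulr1.
- by apply/(measurable_restrictT _ _).1.
- exact/measurable_EFinP.
- move=> w _; rewrite patchE; case: ifPn => [|_]; last by rewrite lee_fin sqr_ge0.
  by rewrite inE /U /= mule1 lee_fin.
Qed.

Let mdev m : measurable_fun setT (fun w => (X w - m) ^+ 2)%R.
Proof. by apply: measurable_funX; exact: measurable_funB. Qed.

(** The standard deviation s of the law is comparable to the square root of v, and the mean
m is dominated by s, which is all that the estimates below use of the
variance.  The lower bound on s bounds E (X - m)^2 = v + m^2 by the layers of
(X - m)^2, whose probabilities decay geometrically; the upper bound is
Markov's inequality at a level where the small-ball bound leaves mass 1/2.
The case s = 0 is excluded by the first estimate, as v > 0. *)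
Lemma gaussian_scale : exists m s : R, [/\ (0 < s)%R,
  forall U : set R, measurable U -> P (X @^-1` U) = normal_prob m s U,
  (v + m ^+ 2 <= 16 * s ^+ 2)%R & (s ^+ 2 <= 8 * v)%R].
Proof.
have [_ [m [s [s_ge0 law]]] _ _] := gX.
have m20 : (0 <= m ^+ 2)%R by rewrite sqr_ge0.
have preim (b : R) : [set w | (b <= (X w - m) ^+ 2)%R] =
    X @^-1` [set x | (b <= (x - m) ^+ 2)%R] by [].
have mpre (b : R) : measurable [set x : R | (b <= (x - m) ^+ 2)%R].
  rewrite (_ : mkset _ = (fun x : R => (x - m) ^+ 2)%R @^-1` `[b, +oo[); last first.
    by apply/seteqP; split=> w; rewrite /= in_itv/= andbT.
  by rewrite -[_ @^-1` _]setTI; apply: (_ : measurable_fun _ _) => //; apply: measurable_funX; exact: measurable_funB.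
have layers (a : R) : (0 < a)%R ->
    (v + m ^+ 2)%:E <= \sum_(0 <= k <oo) a%:E * P [set w | (k%:R * a <= (X w - m) ^+ 2)%R].
  move=> a0; rewrite -centered_second_moment.
  by apply: integral_le_layers => // w; rewrite sqr_ge0.
have [s0|s_neq0] := eqVneq s 0%R.
  have v20 : (0 < v / 2)%R by rewrite divr_gt0.
  have := layers _ v20; rewrite nneseries_recl//; last by move=> k _; rewrite mule_ge0// lee_fin ltW.
  rewrite eseries0; last first.
    move=> k k0 _; rewrite preim law// s0 eqxx diracE memNset ?mule0//.
    apply/negP; rewrite /= subrr expr0n/= -ltNge mulr_gt0//.
    by rewrite ltr0n.
  rewrite adde0 => h; have : (v + m ^+ 2)%:E <= (v / 2)%:E.
    apply: (le_trans h); rewrite -[leRHS]mule1 lee_wpmul2l ?lee_fin ?(ltW v20)//.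
    by apply: probability_le1; rewrite preim -[_ @^-1` _]setTI; exact: mX.
  by rewrite lee_fin => vm; exfalso; lra.
have s_gt0 : (0 < s)%R by rewrite lt_neqAle eq_sym s_neq0.
have lawN U : measurable U -> P (X @^-1` U) = normal_prob m s U.
  by move=> mU; rewrite law// (negbTE s_neq0).
exists m, s; split=> //.
  have a0 : (0 < 4 * s ^+ 2)%R by rewrite mulr_gt0// exprn_gt0.
  rewrite -lee_fin; apply: (le_trans (layers _ a0)).
  apply: (@le_trans _ _ (\sum_(0 <= k <oo) ((4 * s ^+ 2 * 2) * 2^-1 ^+ k)%:E)).
    apply: lee_nneseries => [k _|k _]; first by rewrite mule_ge0// lee_fin ltW.
    rewrite preim lawN// -mulrA [leRHS]EFinM lee_wpmul2l ?lee_fin ?(ltW a0)//.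
    apply: (le_trans (normal_prob_tail (y := k%:R) s_gt0 _ _)) => //.
      by move=> x /=; rewrite ler_pdivlMr.
    rewrite lee_fin ler_pM2l// expRN exprVn lef_pV2 ?posrE ?exprn_gt0 ?expR_gt0//.
    rewrite -(mulr1 k%:R) expRM_natl lerXn2r ?nnegrE ?expR_ge0//.
    by apply: le_trans (expR_ge1Dx _); lra.
  rewrite nneseries_geometric; last by lra.
  by rewrite lee_fin (_ : _ / _ = 16 * s ^+ 2)%R//; field.
have s20 : (0 < s / 2)%R by rewrite divr_gt0.
have := sq_deviation_markov 0%R (ltW (exprn_gt0 2 s20)).
rewrite centered_second_moment expr0n addr0.
have h1 : P [set w | (`|X w| <= s / 2)%R] <= (2^-1)%:E.
  rewrite (_ : mkset _ = X @^-1` `[(- (s / 2))%R, (s / 2)%R]); last first.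
    by apply/seteqP; split=> w /=; rewrite in_itv/= ler_norml.
  rewrite lawN//; apply: (le_trans (normal_prob_ball _ s_gt0 (ltW s20))).
  by rewrite lee_fin mulrAC divff// mul1r.
set V := [set w | (_ <= (X w - 0) ^+ 2)%R] => hV.
have mV : measurable V.
  rewrite (_ : V = (fun w => (X w - 0) ^+ 2)%R @^-1` `[((s / 2) ^+ 2)%R, +oo[); last first.
    by apply/seteqP; split=> w; rewrite /V /= in_itv/= andbT.
  by rewrite -[_ @^-1` _]setTI; exact: mdev.
have mW : measurable [set w | (`|X w| <= s / 2)%R].
  rewrite (_ : mkset _ = X @^-1` `[(- (s / 2))%R, (s / 2)%R]); last first.
    by apply/seteqP; split=> w /=; rewrite in_itv/= ler_norml.
  by rewrite -[_ @^-1` _]setTI; exact: mX.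
have h2 : 1 <= (2^-1)%:E + P V.
  apply: le_trans (leeD2r _ h1); rewrite -(probability_setT P).
  apply: le_trans (measureU2 _ mW mV); apply: le_measure; rewrite ?inE//.
    exact: measurableU.
  move=> w _; have [xs|xs] := leP `|X w|%R (s / 2)%R; [by left|right].
  by rewrite /V /= subr0 -(real_normK (num_real (X w))) lerXn2r ?nnegrE// ltW.
have fV : P V \is a fin_num by exact: fin_num_measure.
move: hV h2; rewrite -(fineK fV) -EFinM -EFinD !lee_fin.
move: (fine _) => z; rewrite expr_div_n.
have : (0 < s ^+ 2)%R by rewrite exprn_gt0.
by move: (s ^+ 2)%R => ss; nra.
Qed.

Lemma gaussian_small_ball r : (0 <= r)%R ->
  P [set w | (`|X w| <= r)%R] <= (4 * r / Num.sqrt v)%:E.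
Proof.
move=> r0; have [m [s [s0 law vs _]]] := gaussian_scale.
rewrite (_ : mkset _ = X @^-1` `[(- r)%R, r]); last first.
  by apply/seteqP; split=> w /=; rewrite in_itv/= ler_norml.
rewrite law//; apply: (le_trans (normal_prob_ball _ s0 r0)).
rewrite lee_fin mulrC [leRHS]mulrAC ler_wpM2r//.
rewrite -(invrK 4%R) -invfM lef_pV2 ?posrE ?mulr_gt0 ?invr_gt0 ?sqrtr_gt0//.
rewrite ler_pdivrMl//; have -> : (4 * s = Num.sqrt ((4 * s) ^+ 2))%R.
  by rewrite sqrtr_sqr ger0_norm// mulr_ge0// ltW.
rewrite ler_wsqrtr// (_ : (4 * s) ^+ 2 = 16 * s ^+ 2)%R; last by ring.
by apply: le_trans vs; rewrite lerDl sqr_ge0.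
Qed.

(** Polynomial tails of every order suffice in Kolmogorov's criterion.  The law may
have a mean m, so levels l < 2 |m| are treated by the trivial bound 1, and
the constant is large enough for that. *)
Lemma gaussian_tail (p : nat) l : (0 < l)%R ->
  P [set w | (l < `|X w|)%R] <= (gaussian_tail_cst p * (v / l ^+ 2) ^+ p)%:E.
Proof.
rewrite /gaussian_tail_cst.
move=> l0; have [m [s [s0 law vs sv]]] := gaussian_scale.
have l20 : (0 < l ^+ 2)%R by rewrite exprn_gt0.
have s20 : (0 < s ^+ 2)%R by rewrite exprn_gt0.
pose U := [set x : R | (l < `|x|)%R].
have mU : measurable U.
  rewrite (_ : U = (fun x => `|x|%R) @^-1` `]l, +oo[); last first.
    by apply/seteqP; split=> w; rewrite /U /= in_itv/= andbT.
  by rewrite -[_ @^-1` _]setTI; apply: (_ : measurable_fun _ _) => //; exact: measurable_normr.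
have [ml|lm] := leP (4 * m ^+ 2)%R (l ^+ 2)%R; last first.
  apply: (@le_trans _ _ 1).
    by apply: probability_le1; rewrite -[[set w | _]]/(X @^-1` U) -[_ @^-1` _]setTI; exact: mX.
  rewrite lee_fin -mulrA -exprMn.
  suff h : (1 <= (512 * p%:R * (v / l ^+ 2)) ^+ p)%R.
    by move: (_ ^+ p)%R h => z h; lra.
  case: p => [|p]; first by rewrite expr0.
  apply: exprn_ege1.
  have h : (1 <= 512 * (v / l ^+ 2))%R.
    by rewrite mulrA ler_pdivlMr// mul1r; lra.
  rewrite mulrAC; apply: (le_trans h); apply: ler_peMr; last by rewrite ler1n.
  exact: le_trans h.
rewrite -[[set w | _]]/(X @^-1` U) law//.
have y0 : (0 <= l ^+ 2 / (128 * v))%R by rewrite divr_ge0 ?mulr_ge0 ?ltW.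
apply: (le_trans (normal_prob_tail (y := l ^+ 2 / (128 * v)) s0 mU _)).
  move=> x; rewrite /U /= => lx.
  have : (l ^+ 2 < x ^+ 2)%R by rewrite -(real_normK (num_real x)) ltrXn2r ?nnegrE ?(ltW l0)//.
  move=> lx2; rewrite ler_pdivlMr ?mulr_gt0// mulrAC ler_pdivrMr ?mulr_gt0//.
  have dev : (l ^+ 2 / 4 <= (x - m) ^+ 2)%R.
    rewrite -(@real_normK _ (x - m)%R) ?num_real//.
    rewrite (_ : l ^+ 2 / 4 = (l / 2) ^+ 2)%R; last by field.
    rewrite lerXn2r ?nnegrE ?divr_ge0 ?(ltW l0)//.
    have ml2 : (`|m| <= l / 2)%R.
      rewrite -(@ler_pXn2r _ 2%N) ?nnegrE ?divr_ge0 ?(ltW l0)// real_normK ?num_real//.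
      by rewrite expr_div_n; lra.
    have := lerB_dist x m; lra.
  apply: (@le_trans _ _ (l ^+ 2 * (32 * v))%R); last by nra.
  by rewrite ler_pM2l//; lra.
have := expR_decay p y0; set y := (l ^+ 2 / (128 * v))%R.
have yE : (v / l ^+ 2 = (128 * y)^-1)%R.
  by rewrite /y; field; rewrite !gt_eqF.
have {}y0 : (0 < y)%R by rewrite divr_gt0// mulr_gt0.
rewrite lee_fin -mulrA ler_pM2l// yE -exprMn.
move: y0 {yE}; move: y => y y0.
rewrite -ler_pdivlMr ?exprn_gt0// -expr_div_n => /le_trans; apply.
have py0 : (0 <= p%:R / y)%R by rewrite divr_ge0// ltW.
have -> : (512 * p%:R / (128 * y) = 4 * (p%:R / y))%R by field; rewrite gt_eqF.
move: (p%:R / y)%R py0 => z z0.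
by apply: lerXn2r; rewrite ?nnegrE ?mulr_ge0//; lra.
Qed.

End GaussianVariable.

(** * Hölder regularity of fractional Brownian paths *)

Section Increments.
Context {disp : measure_display} {T : measurableType disp} {R : realType}.
Variables (P : probability T R) (alpha : R) (X : R -> {RV P >-> R}).
Hypotheses (alpha_gt0 : (0 < alpha)%R) (fX : is_fbm1 alpha `[0%R, 1%R] X).

Let unit := `[0%R, 1%R] : set R.

Let cov (s t : R) : R :=
  (2^-1 * (`|t| `^ (2 * alpha) + `|s| `^ (2 * alpha) - `|t - s| `^ (2 * alpha)))%R.

Let covE s t : unit s -> unit t -> \int[P]_w (X s w * X t w)%:E = (cov s t)%:E.
Proof. by move=> us ut; rewrite -(fbm1_cov fX us ut) unlock. Qed.

Let mXX s t : measurable_fun setT (fun w => X s w * X t w)%R.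
Proof. exact: measurable_funM. Qed.

Let integrable_sq t : unit t -> P.-integrable setT (fun w => (X t w * X t w)%:E).
Proof.
move=> ut; apply/integrableP; split; first exact/measurable_EFinP.
under eq_integral do rewrite gee0_abs ?lee_fin -?expr2 ?sqr_ge0//.
by under eq_integral do rewrite expr2; rewrite covE// ltry.
Qed.

Let integrable_prod s t : unit s -> unit t -> P.-integrable setT (fun w => (X s w * X t w)%:E).
Proof.
move=> us ut.
apply: (@le_integrable _ _ _ P setT measurableT _ (fun w => (X s w * X s w + X t w * X t w)%:E)).
- exact/measurable_EFinP.
- move=> w _; rewrite !abse_EFin lee_fin [leRHS]ger0_norm -?expr2 ?addr_ge0 ?sqr_ge0//.
  by rewrite !expr2 ler_norml; apply/andP; split; nra.
- by under eq_fun do rewrite EFinD; apply: integrableD => //; exact: integrable_sq.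
Qed.

Let integrable_path t : unit t -> P.-integrable setT (fun w => (X t w)%:E).
Proof.
move=> ut.
apply: (@le_integrable _ _ _ P setT measurableT _ (fun w => (1 + X t w * X t w)%:E)).
- exact/measurable_EFinP.
- move=> w _; rewrite !abse_EFin lee_fin [leRHS]ger0_norm -?expr2 ?addr_ge0 ?sqr_ge0//.
  by rewrite expr2 ler_norml; apply/andP; split; nra.
- under eq_fun do rewrite EFinD.
  by apply: integrableD => //; [exact: finite_measure_integrable_cst|exact: integrable_sq].
Qed.

(** Expanding the square, the covariance gives the variance |t - s|^(2 alpha). *)
Lemma fbm_increment s t : unit s -> unit t ->
  centered_gaussian P (`|t - s| `^ (2 * alpha))%R (fun w => X t w - X s w)%R.
Proof.
move=> us ut; split.
- exact: measurable_funB.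
- have := fbm1_gaussian fX (n := 2%N) (t := fun k => if k == ord0 then t else s)
    (fun k => if k == ord0 then 1 else -1)%R.
  rewrite (_ : (fun w => _) = (fun w => X t w - X s w)%R); last first.
    apply/funext => w; rewrite !big_ord_recl big_ord0 addr0/=.
    by rewrite mul1r mulN1r.
  by apply=> k; case: ifP.
- under eq_integral do rewrite EFinB.
  rewrite integralB//=; try exact: integrable_path.
  by have := fbm1_centered fX ut; have := fbm1_centered fX us; rewrite !unlock => -> ->; rewrite sube0.
- transitivity (\int[P]_w ((X t w * X t w)%:E + ((- 2)%:E * (X s w * X t w)%:E + (X s w * X s w)%:E))).
    by apply: eq_integral => w _; rewrite -EFinM -!EFinD; congr (_%:E); ring.
  have i1 : P.-integrable setT (fun w => (- 2)%:E * (X s w * X t w)%:E).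
    by apply: integrableZl => //; exact: integrable_prod.
  rewrite integralD//=; last 2 first.
  - exact: integrable_sq.
  - by apply: integrableD => //; exact: integrable_sq.
  rewrite integralD//=; last exact: integrable_sq.
  rewrite integralZl//; last exact: integrable_prod.
  rewrite !covE// -EFinM -!EFinD; congr (_%:E); rewrite /cov !subrr normr0.
  rewrite powR0; last by rewrite mulf_neq0// gt_eqF.
  by field.
Qed.

End Increments.

Lemma within_continuous_dist (R : realType) (A : set R) (f : R -> R) (x e : R) :
  {within A, continuous f} -> A x -> (0 < e)%R ->
  exists2 d : R, (0 < d)%R & forall y, A y -> (`|x - y| < d)%R ->
    (`|f x - f y| < e)%R.
Proof.
move=> /subspace_continuousP cf Ax e0; have /cvgrPdist_lt /(_ _ e0) := cf _ Ax.
by move=> [d /= d0 dP]; exists d => // y Ay xy; apply: dP.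
Qed.

Definition locally_holder (R : realType) (gamma : R) (A : set R) (f : R -> R) : Prop :=
  exists N : nat, exists C : R, forall x y, A x -> A y -> (`|x - y| <= 2 ^- N)%R ->
    (`|f x - f y| <= C * `|x - y| `^ gamma)%R.

Section Chaining.
Context {R : realType}.
Variables (f : R -> R) (gamma : R) (N : nat).
Hypotheses (gamma_gt0 : (0 < gamma)%R)
  (f_cont : {within `[0%R, 1%R], continuous f})
  (f_incr : forall n k, (N <= n)%N -> (k < 2 ^ n)%N ->
    (`|f (k.+1%:R * 2 ^- n) - f (k%:R * 2 ^- n)| <= (2 ^- n) `^ gamma)%R).

Let q : R := (2^-1 `^ gamma)%R.

Let q_gt0 : (0 < q)%R. Proof. by rewrite powR_gt0. Qed.

Let q_lt1 : (q < 1)%R.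
Proof. exact: half_powR_lt1. Qed.

Let qE n : ((2 ^- n) `^ gamma = q ^+ n)%R.
Proof. exact: half_expn_powR. Qed.

Let D : R := (q / (1 - q))%R.

Let appr n (x : R) : R := ((Num.truncn (x * 2 ^+ n))%:R * 2 ^- n)%R.

Let pow2 n : (0 < 2 ^+ n :> R)%R. Proof. by rewrite exprn_gt0. Qed.

Let appr_bounds n (x : R) : (0 <= x)%R -> (appr n x <= x < appr n x + 2 ^- n)%R.
Proof.
move=> x0; have x20 : (0 <= x * 2 ^+ n)%R by rewrite mulr_ge0// ltW.
rewrite /appr ler_pdivrMr// truncn_le x20 /=.
by rewrite -[X in (_ < _ + X)%R]mul1r -mulrDl ltr_pdivlMr// -[1%R]/(1%:R) -natrD addn1 truncnS_gt.
Qed.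

Let appr_le n (x : R) k : (0 <= x <= 1)%R -> (k.+1%:R <= x * 2 ^+ n)%R -> (k < 2 ^ n)%N.
Proof.
move=> /andP[x0 x1] kx; rewrite -(ltr_nat R) natrX.
apply: (@lt_le_trans _ _ k.+1%:R%R); first by rewrite ltr_nat.
by apply: (le_trans kx); rewrite ler_piMl// ltW.
Qed.

Let step n (x : R) : (0 <= x <= 1)%R -> (N <= n)%N ->
  (`|f (appr n.+1 x) - f (appr n x)| <= q ^+ n.+1)%R.
Proof.
move=> x01 Nn; have /andP[x0 x1] := x01.
set k := Num.truncn (x * 2 ^+ n)%R.
have x20 m : (0 <= x * 2 ^+ m)%R by rewrite mulr_ge0// ltW.
have /andP[kx xk] := truncn_itv (x20 n).
have /andP[lx xl] := truncn_itv (x20 n.+1).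
rewrite -/k in kx xk.
have apprk : appr n x = ((k.*2)%:R * 2 ^- n.+1)%R.
  by rewrite /appr -/k -muln2 natrM exprS; field; rewrite gt_eqF.
set l := Num.truncn (x * 2 ^+ n.+1)%R in lx xl.
have klE : l = k.*2 \/ l = (k.*2).+1.
  have h1 : (k.*2 <= l)%N.
    rewrite -ltnS -(ltr_nat R); apply: le_lt_trans xl.
    by rewrite -muln2 natrM exprSr mulrA ler_pM2r.
  have h2 : (l < (k.*2).+2)%N.
    rewrite -(ltr_nat R) -doubleS -muln2 natrM; apply: (le_lt_trans lx).
    by rewrite exprSr mulrA ltr_pM2r.
  move: h1; rewrite leq_eqVlt => /orP[/eqP ->|kl]; first by left.
  by right; apply/eqP; rewrite eqn_leq kl andbT -ltnS.
rewrite [appr n.+1 x]/appr -/l apprk -qE.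
have [->|lE] := klE; first by rewrite subrr normr0 powR_ge0.
rewrite lE; apply: f_incr; first exact: leqW.
by apply: appr_le x01 _; rewrite -lE.
Qed.

Let telescope n j (x : R) : (0 <= x <= 1)%R -> (N <= n)%N ->
  (`|f (appr (n + j)%N x) - f (appr n x)| <= D * (q ^+ n - q ^+ (n + j)))%R.
Proof.
move=> x01 Nn; have Dq : (D * (1 - q) = q)%R by rewrite divfK// subr_eq0 gt_eqF.
elim: j => [|j IH]; first by rewrite addn0 !subrr normr0 mulr0.
have := step x01 (leq_trans Nn (leq_addr j n)); rewrite addnS exprS.
have := ler_distD (f (appr (n + j) x)) (f (appr (n + j).+1 x)) (f (appr n x)).
move: Dq IH; set d := D; set u := (q ^+ (n + j))%R; set w := (q ^+ n)%R.
move: (`|f (appr (n + j) x) - _|)%R (`|f (appr (n + j).+1 x) - f (appr (n + j) x)|)%R => a b.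
move: (`| _ |)%R => c Dq IH tri bq; apply: (le_trans tri).
by rewrite (_ : d * (w - q * u) = d * (1 - q) * u + d * (w - u))%R; [rewrite Dq lerD|ring].
Qed.

Let appr_limit n (x : R) : (0 <= x <= 1)%R -> (N <= n)%N ->
  (`|f x - f (appr n x)| <= D * q ^+ n)%R.
Proof.
move=> x01 Nn; apply/ler_addgt0Pr => e e0; have /andP[x0 x1] := x01.
have ux : `[0%R, 1%R]%classic x by rewrite /= in_itv.
have [d d0 dP] := within_continuous_dist f_cont ux e0.
have [m md] := exists_half_expn_lt d0.
have /andP[ax xa] := appr_bounds (n + m) x0.
have le_m : (2 ^- (n + m) <= 2 ^- m :> R)%R.
  by rewrite lef_pV2 ?posrE// ler_weXn2l ?ler1n// leq_addl.
have a0 : (0 <= appr (n + m) x)%R by rewrite mulr_ge0// invr_ge0 ltW.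
have xm : (`|f x - f (appr (n + m) x)| < e)%R.
  apply: dP; first by rewrite /= in_itv/= a0 (le_trans ax).
  by rewrite ger0_norm ?subr_ge0//; lra.
have := telescope m x01 Nn.
have := ler_distD (f (appr (n + m) x)) (f x) (f (appr n x)).
have : (0 <= D * q ^+ (n + m))%R by rewrite mulr_ge0 ?exprn_ge0 ?divr_ge0 ?subr_ge0// ltW.
rewrite mulrBr; move: xm; lra.
Qed.

(** The path from x to y through their dyadic approximations at the scale of
|x - y| and all finer ones has increments dominated by a geometric series of
ratio 2^-gamma. *)
Lemma dyadic_chaining : locally_holder gamma `[0%R, 1%R] f.
Proof.
exists N, ((2 * D + 1) * 2 `^ gamma)%R => x y /= /[!in_itv]/=.
have D0 : (0 <= D)%R by rewrite divr_ge0 ?subr_ge0// ltW.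
wlog xy : x y / (x < y)%R => [wlg|].
  move=> x01 y01 xyN; have [xy|yx|->] := ltgtP x y; first exact: wlg.
    by rewrite (distrC (f x)) (distrC x); apply: wlg; rewrite // distrC.
  rewrite subrr normr0 mulr_ge0 ?powR_ge0// mulr_ge0 ?powR_ge0//.
  by rewrite addr_ge0// mulr_ge0.
move=> x01 y01; have /andP[x0 x1] := x01; have /andP[y0 y1] := y01.
rewrite (distrC (f x)) (distrC x).
have -> : (`|y - x| = y - x)%R by rewrite ger0_norm// subr_ge0 ltW.
move=> yxN.
have [n [nd dn]] : exists n : nat, (2 ^- n.+1 < y - x)%R /\ (y - x <= 2 ^- n)%R.
  by apply: exists_dyadic_scale; apply/andP; split; lra.
have Nn : (N <= n)%N.
  rewrite leqNgt; apply/negP => nN; move: (lt_le_trans nd yxN).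
  by apply/negP; rewrite -leNgt lef_pV2 ?posrE ?exprn_gt0// ler_weXn2l// ler1n.
have hx := appr_limit x01 Nn; have hy := appr_limit y01 Nn.
have hxy : (`|f (appr n y) - f (appr n x)| <= q ^+ n)%R.
  have x20 : (0 <= x * 2 ^+ n)%R by rewrite mulr_ge0// ltW.
  have y20 : (0 <= y * 2 ^+ n)%R by rewrite mulr_ge0// ltW.
  have /andP[kx xk] := truncn_itv x20.
  have /andP[ly yl] := truncn_itv y20.
  rewrite /appr; set k := Num.truncn _ in kx xk *; set l := Num.truncn _ in ly yl *.
  have kl : (k <= l)%N.
    rewrite -ltnS -(ltr_nat R); apply: (le_lt_trans kx); apply: le_lt_trans yl.
    by rewrite ler_pM2r// ltW.
  have lk : (l <= k.+1)%N.
    rewrite -ltnS -(ltr_nat R); apply: (le_lt_trans ly).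
    have : ((y - x) * 2 ^+ n <= 1)%R by rewrite -ler_pdivlMr// mul1r.
    by move: xk; rewrite mulrBl -!natr1; lra.
  have [lE|lE] : l = k \/ l = k.+1.
    by move: kl lk; case: ltngtP => // [kl _ lk|-> _ _]; [right|left]; last by []; apply/eqP; rewrite eqn_leq lk.
  - by rewrite lE subrr normr0 exprn_ge0// ltW.
  rewrite lE -qE; apply: f_incr => //.
  by apply: appr_le y01 _; rewrite -lE.
have qn : (q ^+ n <= 2 `^ gamma * (y - x) `^ gamma)%R.
  rewrite -qE -powRM ?subr_ge0 ?(ltW xy)//; apply: le_powRl => //; first exact: ltW.
  by move: nd; rewrite exprS invfM ltr_pdivrMl// => /ltW.
apply: (@le_trans _ _ ((2 * D + 1) * q ^+ n)%R); last first.
  by rewrite -mulrA ler_wpM2l// addr_ge0// mulr_ge0.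
have t1 := ler_distD (f (appr n y)) (f y) (f x).
have t2 := ler_distD (f (appr n x)) (f (appr n y)) (f x).
rewrite (distrC (f (appr n x)) (f x)) in t2.
by move: t1 t2 hx hy hxy; lra.
Qed.

End Chaining.

(** Kolmogorov's criterion by the Borel-Cantelli lemma: the tail bound of order p gives
each dyadic increment of level n exceeding 2^(-n gamma) a probability at most
a constant times 2^(-2 n (alpha - gamma) p) <= a constant times 4^-n, and there
are 2^n increments of level n. *)
Lemma fbm_locally_holder disp (T : measurableType disp) (R : realType)
    (P : probability T R) (alpha gamma : R) (X : R -> {RV P >-> R}) :
  is_fbm1 alpha `[0%R, 1%R] X -> (0 < gamma < alpha)%R ->
  {ae P, forall w, locally_holder gamma `[0%R, 1%R] (fun t => X t w)}.
Proof.
move=> fX /andP[g0 ga]; have a0 : (0 < alpha)%R := lt_trans g0 ga.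
pose U n k := [set w : T | ((2 ^- n) `^ gamma < `|X (k.+1%:R * 2 ^- n) w - X (k%:R * 2 ^- n) w|)%R].
pose Bad n := \big[setU/set0]_(k < 2 ^ n) U n k.
have mU n k : measurable (U n k).
  rewrite (_ : U n k = (fun w => `|X (k.+1%:R * 2 ^- n) w - X (k%:R * 2 ^- n) w|)%R @^-1` `]((2 ^- n) `^ gamma)%R, +oo[); last first.
    by apply/seteqP; split=> w; rewrite /U /= in_itv/= andbT.
  rewrite -[_ @^-1` _]setTI; apply: (_ : measurable_fun _ _) => //.
  by apply: measurableT_comp => //; exact: measurable_funB.
have mBad n : measurable (Bad n) by exact: bigsetU_measurable.
(* The order p of the tail bound that beats the 2^n increments of level n. *)
have [p ph] : exists p : nat, (2 <= 2 * (alpha - gamma) * p%:R)%R.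
  exists (Num.truncn (alpha - gamma)^-1).+1.
  have : ((alpha - gamma)^-1 < (Num.truncn (alpha - gamma)^-1).+1%:R)%R by exact: truncnS_gt.
  have ag : (0 < alpha - gamma)%R by rewrite subr_gt0.
  move: (_.+1%:R)%R => z h; have : (1 < (alpha - gamma) * z)%R.
    by rewrite -[ltLHS](divff (lt0r_neq0 ag)) ltr_pM2l.
  lra.
pose Cp : R := gaussian_tail_cst p.
have Cp0 : (0 <= Cp)%R := gaussian_tail_cst_ge0 p.
have dyad (n k : nat) : (k <= 2 ^ n)%N -> `[0%R, 1%R]%classic (k%:R * 2 ^- n : R)%R.
  move=> kn; rewrite /= in_itv/= mulr_ge0//= ler_pdivrMr ?exprn_gt0// mul1r.
  by rewrite -natrX ler_nat.
have PU n k : (k < 2 ^ n)%N -> P (U n k) <= (Cp * (2 ^- n) ^+ 2)%:E.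
  move=> kn; have inc := fbm_increment a0 fX (dyad n k (ltnW kn)) (dyad n k.+1 kn).
  have n0 : (0 < 2 ^- n :> R)%R by exact: half_expn_gt0.
  have stepE : (k.+1%:R * 2 ^- n - k%:R * 2 ^- n = 2 ^- n :> R)%R.
    by rewrite -mulrBl -natrB// subSnn mul1r.
  rewrite stepE ger0_norm in inc; last exact: ltW.
  apply: (le_trans (gaussian_tail (powR_gt0 _ n0) inc p (powR_gt0 gamma n0))).
  rewrite lee_fin ler_wpM2l//.
  have -> : ((2 ^- n) `^ gamma ^+ 2 = (2 ^- n) `^ (2 * gamma) :> R)%R.
    by rewrite -powR_mulrn ?powR_ge0// -powRrM mulrC.
  rewrite -powRB; last by rewrite (gt_eqF n0) implybT.
  rewrite -[leLHS]powR_mulrn ?powR_ge0// -powRrM -[leRHS]powR_mulrn ?(ltW n0)//.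
  apply: ger_powR; last by rewrite -mulrBr.
  by rewrite n0/= invf_le1 ?exprn_gt0// exprn_ege1// ler1n.
have PBad n : P (Bad n) <= (Cp * 2^-1 ^+ n)%:E.
  apply: (@le_trans _ _ (\sum_(k < 2 ^ n) P (U n k))).
    exact: Boole_inequality.
  apply: (@le_trans _ _ (\sum_(k < 2 ^ n) (Cp * (2 ^- n) ^+ 2)%:E)).
    by apply: lee_sum => k _; exact: PU.
  rewrite sumEFin lee_fin sumr_const card_ord -[leLHS]mulr_natl natrX.
  rewrite mulrCA ler_wpM2l// -exprVn expr2 mulrA -exprMn divff// expr1n mul1r.
  exact: lexx.
have null : P (lim_sup_set Bad) = 0.
  apply: lim_sup_set_cvg0 => //.
  apply: (@le_lt_trans _ _ (\sum_(0 <= n <oo) (Cp * 2^-1 ^+ n)%:E)).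
    by apply: lee_nneseries => n _; [move=> _; exact: measure_ge0|exact: PBad].
  by rewrite nneseries_geometric ?ltry//; apply/andP; split; lra.
exists (lim_sup_set Bad); split=> //.
  apply: bigcapT_measurable => n; apply: bigcup_measurable => k _; exact: mBad.
move=> w /= nH n _; apply: contrapT => nB; apply: nH.
have cw : {within `[0%R, 1%R], continuous (fun t => X t w)} by exact: (@fbm1_continuous _ _ _ _ _ _ _ fX w).
apply: (@dyadic_chaining R (fun t => X t w) gamma n g0 cw).
move=> m k nm km; rewrite leNgt; apply/negP => Umk; apply: nB.
exists m => //; rewrite /Bad -bigcup_mkord.
by exists k.
Qed.

(** * Parabolic covers of the graph of a Hölder path *)

Section ParabolicContent.
Context {R : realType} {d : nat}.
Variables (H beta : R).
Hypothesis (beta_gt0 : (0 < beta)%R).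
Implicit Types (F : set (R * 'rV[R]_d)).

Lemma parabolic_content_ge0 F : 0 <= parabolic_content H beta F.
Proof.
apply: le_ereal_inf_tmp => _ [delta [a [b [_ _ ->]]]].
by apply: nneseries_ge0 => j _ _; rewrite lee_fin powR_ge0.
Qed.

Lemma parabolic_content_le_esum (I : countType) F (delta a : I -> R)
    (b : I -> 'rV[R]_d) : (forall i, 0 <= delta i)%R ->
  F `<=` \bigcup_i parabolic_box H (delta i) (a i) (b i) ->
  parabolic_content H beta F <= \esum_(i in [set: I]) (delta i `^ beta)%:E.
Proof.
move=> d0 Fcov; rewrite -nneseries_pickle_inv; last by move=> i; rewrite lee_fin powR_ge0.
apply: ereal_inf_lbound.
exists (fun j => oapp delta 0%R (pickle_inv j)), (fun j => oapp a 0%R (pickle_inv j)),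
  (fun j => oapp b 0%R (pickle_inv j)); split.
- by move=> j; case: pickle_inv.
- by move=> z /Fcov[i _ zi]; exists (pickle i) => //; rewrite pickleK_inv.
- apply: eq_eseriesr => j _; case: pickle_inv => //=.
  by rewrite powR0// gt_eqF.
Qed.

Lemma parabolic_content_sigma_subadditive F (G : nat -> set (R * 'rV[R]_d)) :
  F `<=` \bigcup_j G j ->
  parabolic_content H beta F <= \sum_(0 <= j <oo) parabolic_content H beta (G j).
Proof.
move=> FG; apply/lee_addgt0Pr => e e0.
apply: le_trans (epsilon_trick _ _ (ltW e0)); last by move=> j; exact: parabolic_content_ge0.
have [[j Gj]|nG] := pselect (exists j, parabolic_content H beta (G j) = +oo).
  suff -> : \sum_(0 <= j <oo) (parabolic_content H beta (G j) + (e / (2 ^ j.+1)%:R)%:E) = +oo by rewrite leey.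
  apply: (nneseries_pinfty (k := j)) => //; last by rewrite Gj addye.
  by move=> n _; rewrite adde_ge0 ?parabolic_content_ge0// lee_fin divr_ge0// ltW.
have /choice[W WP] : forall j, exists W : (nat -> R) * (nat -> R) * (nat -> 'rV[R]_d),
    [/\ forall k, (0 <= W.1.1 k)%R,
      G j `<=` \bigcup_k parabolic_box H (W.1.1 k) (W.1.2 k) (W.2 k) &
      \sum_(0 <= k <oo) (W.1.1 k `^ beta)%:E <= parabolic_content H beta (G j) + (e / (2 ^ j.+1)%:R)%:E].
  move=> j; have : parabolic_content H beta (G j) < parabolic_content H beta (G j) + (e / (2 ^ j.+1)%:R)%:E.
    rewrite lteDl ?lte_fin ?divr_gt0// ?ltr0n ?expn_gt0//.
    rewrite ge0_fin_numE ?parabolic_content_ge0// ltey.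
    by apply/eqP => Gj; apply: nG; exists j.
  move=> /ereal_inf_lt[_ [delta [a [b [h1 h2 ->]]]] h3].
  by exists ((delta, a), b); split=> //; exact: ltW.
apply: (@le_trans _ _ (\esum_(k in [set: nat * nat]) ((W k.1).1.1 k.2 `^ beta)%:E)).
  apply: (@parabolic_content_le_esum _ F (fun k => (W k.1).1.1 k.2)
    (fun k => (W k.1).1.2 k.2) (fun k => (W k.1).2 k.2)).
    by move=> k; case: (WP k.1).
  move=> z /FG[j _]; have [_ cov _] := WP j.
  by move=> /cov[k _ zk]; exists (j, k).
rewrite (_ : [set: nat * nat] = [set: nat] `*`` (fun=> [set: nat])); last by apply/seteqP; split=> -[].
rewrite -(esum_esum (a := fun j k => ((W j).1.1 k `^ beta)%:E)); last by move=> *; rewrite lee_fin powR_ge0.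
rewrite nneseries_esumT; last first.
  by move=> n; rewrite adde_ge0 ?parabolic_content_ge0// lee_fin divr_ge0// ltW.
apply: le_esum => j _; rewrite -nneseries_esumT; last by move=> n; rewrite lee_fin powR_ge0.
by case: (WP j).
Qed.

Lemma parabolic_content_finite F (n : nat) (delta a : R) (b : nat -> 'rV[R]_d) :
  (0 <= delta)%R ->
  (forall z, F z -> exists2 k, (k < n)%N & parabolic_box H delta a (b k) z) ->
  parabolic_content H beta F <= (n%:R * delta `^ beta)%:E.
Proof.
move=> d0 Fcov.
have -> : (n%:R * delta `^ beta)%:E =
    \sum_(0 <= k <oo) ((if (k < n)%N then delta else 0%R) `^ beta)%:E :> \bar R.
  rewrite (nneseries_split 0 n); last by move=> k _; rewrite lee_fin powR_ge0.
  rewrite add0n eseries0; last by move=> k nk _; rewrite ltnNge nk powR0 ?gt_eqF.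
  rewrite adde0 (eq_big_nat _ _ (F2 := fun=> (delta `^ beta)%:E)); last by move=> k /andP[_ ->].
  by rewrite sumEFin sumr_const_nat subn0 mulr_natl.
apply: ereal_inf_lbound.
exists (fun k => if (k < n)%N then delta else 0%R), (fun=> a), b; split=> //.
- by move=> k; case: ifP.
- by move=> z /Fcov[k kn zk]; exists k => //; rewrite kn.
Qed.

Lemma parabolic_content0 : parabolic_content H beta (@set0 (R * 'rV[R]_d)) = 0.
Proof.
apply/eqP; rewrite eq_le parabolic_content_ge0 andbT.
have /= := @parabolic_content_finite set0 0 0%R 0%R (fun=> 0%R) (lexx _).
by rewrite mul0r; apply.
Qed.

End ParabolicContent.

Lemma parabolic_content_fintype (R : realType) (d : nat) (H beta : R)
    (I : finType) (F : set (R * 'rV[R]_d)) (delta a : R) (b : I -> 'rV[R]_d) :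
  (0 < beta)%R -> (0 <= delta)%R ->
  (forall z, F z -> exists i, parabolic_box H delta a (b i) z) ->
  parabolic_content H beta F <= (#|I|%:R * delta `^ beta)%:E.
Proof.
move=> beta0 d0 Fcov.
apply: (@parabolic_content_finite _ _ _ _ beta0 _ _ _ a
  (fun k => oapp (b \o enum_val) 0%R (insub k : option 'I_#|I|))) => //.
by move=> z /Fcov[i zi]; exists (enum_rank i) => //; rewrite valK /= enum_rankK.
Qed.

(** A Hausdorff cover of A of small cost is turned into a cover of the graph, each
set U of diameter r contributing at most K r^s. *)
Lemma parabolic_content_graph_eq0 (R : realType) (d : nat) (f : R -> 'rV[R]_d)
    (A : set R) (H s beta K : R) (N : nat) : (0 < beta)%R ->
  (forall (U : set R) (r : R), (0 <= r)%R -> (r <= 2 ^- N)%R -> diam U <= r%:E ->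
    parabolic_content H beta (graph_over (A `&` U) f) <= (K * r `^ s)%:E) ->
  hausdorff_measure s A = 0 -> parabolic_content H beta (graph_over A f) = 0.
Proof.
move=> beta0 local_bound As0; apply/eqP; rewrite eq_le parabolic_content_ge0 andbT.
pose K' : R := (`|K| + 1)%R.
have K'0 : (0 < K')%R by rewrite ltr_wpDl.
apply/lee_addgt0Pr => e e0; rewrite add0e.
have : hausdorff_premeasure (2 ^- N) s A < (e / K')%:E.
  apply: (@le_lt_trans _ _ (hausdorff_measure s A)); last by rewrite As0 lte_fin divr_gt0.
  by apply: ereal_sup_ubound; exists (2 ^- N)%R => //; exact: half_expn_gt0.
move=> /ereal_inf_lt[_ [U [AU dU] <-]] sumU.
have dU0 j : 0 <= diam (U j) by rewrite le_max lexx.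
have dUfin j : diam (U j) = (fine (diam (U j)))%:E.
  rewrite fineK// ge0_fin_numE//; apply: le_lt_trans (dU j) _; exact: ltry.
have GU : graph_over A f `<=` \bigcup_j graph_over (A `&` U j) f.
  by move=> _ [t At <-]; have [j _ Ujt] := AU _ At; exists j => //; exists t.
apply: (le_trans (parabolic_content_sigma_subadditive H beta0 GU)).
apply: (@le_trans _ _ (\sum_(0 <= j <oo) (K'%:E * diam (U j) `^ s))).
  apply: lee_nneseries => [j _ _|j _]; first exact: parabolic_content_ge0.
  rewrite dUfin poweR_EFin -EFinM.
  apply: (@le_trans _ _ (K * fine (diam (U j)) `^ s)%:E).
    apply: local_bound; rewrite -?lee_fin -?dUfin//; exact: dU.
  by rewrite lee_fin ler_wpM2r ?powR_ge0// (le_trans (ler_norm K))// lerDl.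
rewrite nneseriesZl; last by move=> j _; exact: poweR_ge0.
rewrite -[e](divfK (lt0r_neq0 K'0)) mulrC EFinM lee_wpmul2l ?lee_fin ?ltW//.
Qed.

Lemma dist_le_diam (R : realType) (U : set R) (r x y : R) :
  diam U <= r%:E -> U x -> U y -> (`|x - y| <= r)%R.
Proof.
move=> Ur Ux Uy; rewrite -lee_fin; apply: le_trans Ur.
by rewrite /diam le_max; apply/orP; right; apply: ereal_sup_ubound; exists x => //; exists y.
Qed.

Section HolderGraph.
Context {R : realType} {d : nat}.
Variables (f : R -> 'rV[R]_d) (A : set R) (H gamma s C : R) (N : nat).
Hypotheses (gamma_gt0 : (0 < gamma)%R) (gamma_le_H : (gamma <= H)%R)
  (s_gt0 : (0 < s)%R) (C_ge0 : (0 <= C)%R)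
  (f_holder : forall i x y, A x -> A y -> (`|x - y| <= 2 ^- N)%R ->
    (`|f x ord0 i - f y ord0 i| <= C * `|x - y| `^ gamma)%R).

Let H_gt0 : (0 < H)%R. Proof. exact: lt_le_trans gamma_le_H. Qed.

Let expN_le1 : (2 ^- N <= 1 :> R)%R.
Proof. by rewrite invf_le1 ?exprn_gt0// exprn_ege1// ler1n. Qed.

(** One box over the whole of U: with side delta = K r^(gamma/H) its space width
is K^H r^gamma, at least twice the oscillation of f over U. *)
Lemma parabolic_content_holder_piece_box (U : set R) (r : R) :
  (0 <= r)%R -> (r <= 2 ^- N)%R -> diam U <= r%:E ->
  parabolic_content H (s * H / gamma) (graph_over (A `&` U) f) <=
  ((2 + (2 * C) `^ H^-1) `^ (s * H / gamma) * r `^ s)%:E.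
Proof.
move=> r0 rN Ur; set K : R := (2 + _)%R; set beta : R := (s * H / gamma)%R.
have beta0 : (0 < beta)%R by rewrite divr_gt0// mulr_gt0.
have K2 : (2 <= K)%R by rewrite lerDl powR_ge0.
have K0 : (0 <= K)%R by lra.
have KH : (2 * C <= K `^ H)%R.
  have -> : (2 * C = ((2 * C) `^ H^-1) `^ H)%R.
    by rewrite -powRrM mulVf ?gt_eqF// powRr1// mulr_ge0.
  by apply: le_powRl; rewrite ?(ltW H_gt0) ?powR_ge0// lerDr.
have KE : ((K * r `^ (gamma / H)) `^ beta = K `^ beta * r `^ s)%R.
  rewrite powRM ?powR_ge0// -powRrM; congr (_ * _ `^ _)%R.
  by rewrite /beta; field; rewrite !gt_eqF.
have [[t0 [At0 Ut0]]|n0] := pselect (A `&` U !=set0); last first.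
  have -> : graph_over (A `&` U) f = set0.
    by apply/seteqP; split=> // z [t tU _]; apply: n0; exists t.
  by rewrite parabolic_content0// lee_fin mulr_ge0// powR_ge0.
rewrite -KE {KE} -[leRHS]mul1e -EFinM -[1%R]/(1%:R)%R -(card_unit).
apply: (@parabolic_content_fintype _ _ _ _ unit _ _ (t0 - r)%R
  (fun=> \row_i (f t0 ord0 i - C * r `^ gamma))%R) => //.
  by rewrite mulr_ge0// powR_ge0.
move=> _ [t [At Ut] <-]; exists tt.
have tt0 := dist_le_diam Ur Ut Ut0.
have rr : (r <= r `^ (gamma / H))%R.
  have [->|rn0] := eqVneq r 0%R; first exact: powR_ge0.
  rewrite -[leLHS]powRr1//; apply: ger_powR; last by rewrite ler_pdivrMr// mul1r.
  by rewrite lt0r rn0 r0/= (le_trans rN).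
split=> /=.
  move: tt0; rewrite ler_norml => /andP[h1 h2].
  have h3 : (2 * r <= K * r `^ (gamma / H))%R by apply: ler_pM => //; lra.
  by apply/andP; split; lra.
move=> i; rewrite !mxE.
have := f_holder i At At0 (le_trans tt0 rN).
have h4 : (C * `|t - t0| `^ gamma <= C * r `^ gamma)%R.
  by rewrite ler_wpM2l// le_powRl// ltW.
move=> /le_trans /(_ h4); rewrite ler_norml => /andP[h5 h6].
have h7 : ((K * r `^ (gamma / H)) `^ H = K `^ H * r `^ gamma)%R.
  by rewrite powRM ?powR_ge0// -powRrM divfK// gt_eqF.
have h8 : (2 * C * r `^ gamma <= K `^ H * r `^ gamma)%R by rewrite ler_wpM2r// powR_ge0.
rewrite h7; clear h4 h7 KH rr; move: h5 h6 h8; rewrite -mulrA.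
move: (C * _)%R (K `^ H * _)%R => u v h5 h6 h8.
by apply/andP; split; lra.
Qed.

(** Boxes of side 2 r over U, whose space positions run over a grid of mesh r^H;
in each coordinate the oscillation 2 C r^gamma is exhausted by about
2 C r^(gamma - H) steps. *)
Lemma parabolic_content_holder_piece_grid (U : set R) (r : R) :
  (0 <= r)%R -> (r <= 2 ^- N)%R -> diam U <= r%:E ->
  parabolic_content H (s + d%:R * (H - gamma)) (graph_over (A `&` U) f) <=
  ((2 * C + 1) ^+ d * 2 `^ (s + d%:R * (H - gamma)) * r `^ s)%:E.
Proof.
move=> r0 rN Ur; set beta : R := (s + _)%R.
have g0 : (0 <= d%:R * (H - gamma))%R by rewrite mulr_ge0// subr_ge0.
have beta0 : (0 < beta)%R by rewrite ltr_wpDr.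
have [[t0 [At0 Ut0]]|n0] := pselect (A `&` U !=set0); last first.
  have -> : graph_over (A `&` U) f = set0.
    by apply/seteqP; split=> // z [t tU _]; apply: n0; exists t.
  by rewrite parabolic_content0// lee_fin !mulr_ge0 ?powR_ge0// exprn_ge0// addr_ge0// mulr_ge0.
have [rE|rn0] := eqVneq r 0%R.
  rewrite rE powR0 ?gt_eqF// mulr0.
  rewrite (_ : 0%R = (#|{: unit}|%:R * 0 `^ beta)%R); last by rewrite powR0 ?gt_eqF// mulr0.
  apply: (@parabolic_content_fintype _ _ _ _ unit _ 0%R t0 (fun=> f t0)) => //.
  move=> _ [t [At Ut] <-]; exists tt; have := dist_le_diam Ur Ut Ut0.
  rewrite rE normr_le0 subr_eq0 => /eqP ->; split=> /= [|i]; rewrite ?addr0 ?lexx//.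
  by rewrite lerDl powR_ge0.
have rp : (0 < r)%R by rewrite lt0r rn0.
have rH0 : (0 < r `^ H)%R by exact: powR_gt0.
pose x : R := (2 * C * r `^ (gamma - H))%R.
have x0 : (0 <= x)%R by rewrite !mulr_ge0// powR_ge0.
have xE : (x * r `^ H = 2 * C * r `^ gamma)%R.
  by rewrite /x -mulrA -powRD ?subrK// (gt_eqF rp) implybT.
pose M := (Num.truncn x).+1.
apply: (@le_trans _ _ (#|{ffun 'I_d -> 'I_M}|%:R * (2 * r) `^ beta)%:E); last first.
  rewrite lee_fin card_ffun !card_ord powRM// natrX.
  have r1 : (1 <= r `^ (gamma - H))%R.
    rewrite -(powRr0 r); apply: ger_powR; last by rewrite subr_le0.
    by rewrite rp (le_trans rN).
  have Mx : (M%:R <= (2 * C + 1) * r `^ (gamma - H))%R.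
    rewrite -[M%:R]natr1 mulrDl mul1r lerD//; by rewrite truncn_le.
  apply: (@le_trans _ _ (((2 * C + 1) * r `^ (gamma - H)) ^+ d * (2 `^ beta * r `^ beta)))%R.
    rewrite ler_wpM2r ?mulr_ge0 ?powR_ge0//; apply: lerXn2r => //.
      by rewrite nnegrE.
    by rewrite nnegrE; apply: le_trans Mx; exact: ler0n.
  rewrite exprMn -[((r `^ (gamma - H)) ^+ d)%R]powR_mulrn ?powR_ge0// -powRrM.
  rewrite mulrACA -powRD ?(gt_eqF rp) ?implybT//.
  rewrite (_ : (gamma - H) * d%:R + beta = s)%R//.
  by rewrite /beta; ring.
apply: (@parabolic_content_fintype _ _ _ _ {ffun 'I_d -> 'I_M} _ _ (t0 - r)%R
  (fun k => \row_i (f t0 ord0 i - C * r `^ gamma + (k i)%:R * r `^ H))%R) => //.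
  by rewrite mulr_ge0.
move=> _ [t [At Ut] <-].
have tt0 := dist_le_diam Ur Ut Ut0.
pose u i : R := (f t ord0 i - f t0 ord0 i + C * r `^ gamma)%R.
have uP i : (0 <= u i <= x * r `^ H)%R.
  have := f_holder i At At0 (le_trans tt0 rN).
  have h4 : (C * `|t - t0| `^ gamma <= C * r `^ gamma)%R.
    by rewrite ler_wpM2l// le_powRl// ltW.
  move=> /le_trans /(_ h4); rewrite ler_norml => /andP[h5 h6].
  by rewrite xE /u; apply/andP; split; lra.
have uM i : (Num.truncn (u i / r `^ H) < M)%N.
  have /andP[u0 ux] := uP i.
  rewrite ltnS; apply: le_truncn; by rewrite ler_pdivrMr.
exists [ffun i => Ordinal (uM i)]; split=> /=.
  move: tt0; rewrite ler_norml => /andP[h1 h2].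
  by apply/andP; split; lra.
move=> i; rewrite !mxE ffunE/=.
have /andP[u0 ux] := uP i.
have u'0 : (0 <= u i / r `^ H)%R by rewrite divr_ge0// ltW.
have h1 : ((Num.truncn (u i / r `^ H))%:R * r `^ H <= u i)%R.
  by rewrite -ler_pdivlMr// truncn_le.
have h2 : (u i <= (Num.truncn (u i / r `^ H))%:R * r `^ H + r `^ H)%R.
  rewrite -[X in (_ + X)%R]mul1r -mulrDl natr1 -ler_pdivrMr// ltW//; exact: truncnS_gt.
have h3 : (r `^ H <= (2 * r) `^ H)%R by apply: le_powRl => //; [exact: ltW|lra].
by rewrite /u in h1 h2 *; apply/andP; split; lra.
Qed.

End HolderGraph.

Lemma locally_holder_common (R : realType) (d : nat) (f : R -> 'rV[R]_d)
    (A : set R) (gamma : R) :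
  (forall i, locally_holder gamma A (fun t => f t ord0 i)) ->
  exists N C, (0 <= C)%R /\ forall i x y, A x -> A y -> (`|x - y| <= 2 ^- N)%R ->
    (`|f x ord0 i - f y ord0 i| <= C * `|x - y| `^ gamma)%R.
Proof.
move=> /choice[N /choice[C NC]].
exists (\max_i N i), (\sum_i `|C i|)%R; split; first exact: sumr_ge0.
move=> i x y Ax Ay xy; apply: (le_trans (NC i x y Ax Ay _)).
  apply: (le_trans xy); rewrite lef_pV2 ?posrE// ler_weXn2l ?ler1n//.
  exact: leq_bigmax.
rewrite ler_wpM2r ?powR_ge0// (bigD1 i)//= (le_trans (ler_norm _))// lerDl.
exact: sumr_ge0.
Qed.

Section HolderGraphDimension.
Context {R : realType} {d : nat}.
Variables (f : R -> 'rV[R]_d) (A : set R) (H gamma s : R).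
Hypotheses (gamma_gt0 : (0 < gamma)%R) (gamma_le_H : (gamma <= H)%R)
  (s_gt0 : (0 < s)%R) (As_eq0 : hausdorff_measure s A = 0)
  (f_holder : forall i, locally_holder gamma A (fun t => f t ord0 i)).

Lemma parabolic_content_holder_box :
  parabolic_content H (s * H / gamma) (graph_over A f) = 0.
Proof.
have [N [C [C0 fC]]] := locally_holder_common f_holder.
apply: (parabolic_content_graph_eq0 (N := N) _ _ As_eq0).
  by rewrite divr_gt0// mulr_gt0// (lt_le_trans gamma_gt0).
move=> U r r0 rN Ur; exact: (parabolic_content_holder_piece_box gamma_gt0 gamma_le_H s_gt0 C0 fC r0 rN Ur).
Qed.

Lemma parabolic_content_holder_grid :
  parabolic_content H (s + d%:R * (H - gamma)) (graph_over A f) = 0.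
Proof.
have [N [C [C0 fC]]] := locally_holder_common f_holder.
apply: (parabolic_content_graph_eq0 (N := N) _ _ As_eq0).
  by rewrite ltr_wpDr// mulr_ge0// subr_ge0.
move=> U r r0 rN Ur; exact: (parabolic_content_holder_piece_grid gamma_gt0 gamma_le_H s_gt0 C0 fC r0 rN Ur).
Qed.

End HolderGraphDimension.

(** * The mass distribution principle for graphs *)

Lemma measurable_pair_dist (R : realType) : measurable_fun setT
  (fun p : measurableTypeR R * measurableTypeR R => `|p.2 - p.1|%R).
Proof. by apply: measurableT_comp => //; exact: measurable_funB. Qed.

Section ClosePairs.
Context {R : realType} {d : nat}.
Variables (f : R -> 'rV[R]_d) (H : R).

Definition close_pairs (n : nat) : set (R * R) :=
  [set p | (0 < `|p.2 - p.1| <= 2 ^- n)%R /\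
    forall i, (`|f p.2 ord0 i - f p.1 ord0 i| <= (2 ^- n) `^ H)%R].

Hypothesis mf : forall i, measurable_fun [set: measurableTypeR R]
  (fun t : measurableTypeR R => f t ord0 i : measurableTypeR R).

Lemma measurable_close_pairs n :
  measurable (close_pairs n : set (measurableTypeR R * measurableTypeR R)).
Proof.
have m1 := @measurable_pair_dist R.
rewrite (_ : close_pairs n = [set p | (`|p.2 - p.1| \in `]0%R, (2 ^- n)%R])%R] `&`
   \bigcap_(i in [set: 'I_d]) [set p | (`|f p.2 ord0 i - f p.1 ord0 i| \in `]-oo, ((2 ^- n) `^ H)%R])%R]).
  apply: measurableI.
    by rewrite -[X in measurable X]setTI; exact: (m1 measurableT _ (measurable_itv `]0%R, (2 ^- n)%R])).
  apply: fin_bigcap_measurable => [|i _]; first exact: finite_finset.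
  rewrite -[X in measurable X]setTI.
  have m2 : measurable_fun setT (fun p : measurableTypeR R * measurableTypeR R =>
      `|f p.2 ord0 i - f p.1 ord0 i|%R).
    apply: measurableT_comp => //; apply: measurable_funB.
      by apply: (measurableT_comp (mf i)).
    by apply: (measurableT_comp (mf i)).
  exact: (m2 measurableT _ (measurable_itv `]-oo, ((2 ^- n) `^ H)%R])).
apply/seteqP; split=> p /=.
  by move=> [p1 p2]; split=> [|i _]; rewrite /= in_itv//=; exact: p2.
move=> [p1 p2]; split=> [|i]; first by rewrite in_itv in p1.
by have := p2 i I; rewrite /= in_itv.
Qed.

End ClosePairs.

Section MassDistribution.
Context {R : realType} {d : nat}.
Variables (f : R -> 'rV[R]_d) (H beta : R) (K : set R)
  (mu : {sigma_finite_measure set (measurableTypeR R) -> \bar R}).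
Hypotheses (H_gt0 : (0 < H)%R) (beta_gt0 : (0 < beta)%R)
  (mf : forall i, measurable_fun [set: measurableTypeR R]
    (fun t : measurableTypeR R => f t ord0 i : measurableTypeR R))
  (mu_fin : mu setT < +oo) (mu_atom : forall t, mu [set t] = 0).

Let near_t n (t : R) : set (measurableTypeR R) :=
  xsection (close_pairs f H n : set (measurableTypeR R * measurableTypeR R)) t.

Let measurable_near n t : measurable (near_t n t).
Proof. by apply: measurable_xsection; exact: measurable_close_pairs. Qed.

(** A box of the cover that meets the graph over G at time t captures in G only t and
the times close to t, a set of mu-mass at most a constant times delta^beta;
boxes with delta > 1 are compared with the total mass. *)
Lemma mass_distribution (G : set R) (M : R) : measurable (G : set (measurableTypeR R)) ->
  (0 <= M)%R -> G `<=` K -> 0 < mu G ->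
  (forall t n, G t -> mu (near_t n t) <= (M * (2 ^- n) `^ beta)%:E) ->
  0 < parabolic_content H beta (graph_over K f).
Proof.
move=> mG M0 GK mG0 GM.
have muTfin : mu setT \is a fin_num by rewrite ge0_fin_numE.
pose m0 : R := fine (mu setT).
have m0_ge0 : (0 <= m0)%R by exact: fine_ge0.
have m0E : mu setT = m0%:E by rewrite fineK.
pose c : R := (m0 + M * 2 `^ beta + 1)%R.
have c0 : (0 < c)%R by rewrite ltr_wpDl// addr_ge0// mulr_ge0// powR_ge0.
have mc : (m0 <= c)%R by rewrite /c -addrA lerDl addr_ge0// mulr_ge0// powR_ge0.
have Mc : (M * 2 `^ beta <= c)%R by rewrite /c addrAC lerDr addr_ge0.
have muG : mu G = (fine (mu G))%:E.
  rewrite fineK// ge0_fin_numE//; apply: le_lt_trans mu_fin.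
  by apply: le_measure; rewrite ?inE.
apply: (@lt_le_trans _ _ (c^-1 * fine (mu G))%:E).
  by rewrite EFinM -muG mule_gt0// lte_fin invr_gt0.
apply: le_ereal_inf_tmp => _ [delta [a [b [d0 cov ->]]]].
rewrite EFinM -muG muleC lee_pdivrMr//.
pose E j := G `&` [set t | parabolic_box H (delta j) (a j) (b j) (t, f t)].
have GE : G `<=` \bigcup_j E j.
  move=> t Gt; have [|j _ tj] := cov (t, f t); first by exists t => //; exact: GK.
  by exists j.
have piece j : exists S : set (measurableTypeR R), [/\ measurable S, E j `<=` S &
    mu S <= (c * delta j `^ beta)%:E].
  have [[t0 [Gt0 Et0]]|E0] := pselect (E j !=set0); last first.
    exists set0; split=> //; last by rewrite measure0 lee_fin mulr_ge0 ?powR_ge0// ltW.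
    by move=> t Et; exfalso; apply: E0; exists t.
  have dist t : E j t -> (`|t - t0| <= delta j)%R /\
      forall i, (`|f t ord0 i - f t0 ord0 i| <= delta j `^ H)%R.
    move=> [_ [/andP[/= t1 t2] t3]]; case: Et0 => /andP[/= u1 u2] u3.
    split=> [|i]; first by rewrite ler_norml; apply/andP; split; lra.
    have /= /andP[t4 t5] := t3 i; have /= /andP[u4 u5] := u3 i.
    move: (delta j `^ H)%R t5 u5 => D t5 u5.
    by rewrite ler_norml; apply/andP; split; lra.
  have [d1|d1] := ltP 1%R (delta j).
    exists setT; split=> //; rewrite m0E lee_fin -[leLHS]mulr1.
    apply: ler_pM => //; have : (1 `^ beta <= delta j `^ beta)%R.
      by apply: le_powRl => //; exact: ltW.
    by rewrite powR1.
  have [dj0|dj0] := eqVneq (delta j) 0%R.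
    exists [set t0]; split=> //; last by rewrite mu_atom lee_fin mulr_ge0 ?powR_ge0// ltW.
    by move=> t /dist[+ _]; rewrite dj0 normr_le0 subr_eq0 => /eqP ->.
  have dp : (0 < delta j <= 1)%R by rewrite lt0r dj0 d0.
  have [n [n1 n2]] := exists_dyadic_scale dp.
  exists ([set t0] `|` near_t n t0); split.
  - by apply: measurableU.
  - move=> t /dist[t1 t2]; have [->|tt0] := eqVneq t t0; [by left|right].
    rewrite /near_t /xsection /= inE; split=> /= [|i].
      by rewrite normr_gt0 subr_eq0 tt0 (le_trans t1).
    apply: le_trans (t2 i) _; apply: le_powRl => //; exact: ltW.
  - apply: (@le_trans _ _ (mu [set t0] + mu (near_t n t0))).
      by apply: measureU2.
    rewrite mu_atom add0e; apply: (le_trans (GM _ n Gt0)).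
    rewrite lee_fin; apply: (@le_trans _ _ (M * 2 `^ beta * delta j `^ beta)%R).
      rewrite -mulrA ler_wpM2l// -powRM// le_powRl// ?ltW ?half_expn_gt0//.
      move: n1; rewrite exprS invfM; set e := (2 ^- n)%R => n1; lra.
    by rewrite ler_wpM2r// powR_ge0.
have [S SP] := choice piece.
have mS j : measurable (S j) by case: (SP j).
apply: (@le_trans _ _ (\sum_(0 <= j <oo) mu (S j))).
  apply: measure_sigma_subadditive => // t /GE[j _ Et].
  by exists j => //; case: (SP j) => _ + _; apply.
rewrite muleC -nneseriesZl; last by move=> j _; rewrite lee_fin powR_ge0.
apply: lee_nneseries => [j _ _|j _]; first exact: measure_ge0.
by rewrite -EFinM; case: (SP j).
Qed.

(** By Fubini the sum of 2^(n beta) mu(near t) is integrable in t, so that it is bounded by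
some M on a part of K of positive measure. *)
Lemma parabolic_content_gt0 : mu (~` K) = 0 -> 0 < mu setT ->
  measurable (K : set (measurableTypeR R)) ->
  \sum_(0 <= n <oo) (((2 ^+ n) `^ beta)%:E *
    (mu \x mu) (close_pairs f H n : set (measurableTypeR R * measurableTypeR R))) < +oo ->
  0 < parabolic_content H beta (graph_over K f).
Proof.
move=> muKC mu_gt0 mK energy_fin.
pose e (t : measurableTypeR R) : \bar R :=
  \sum_(0 <= n <oo) (((2 ^+ n) `^ beta)%:E * mu (near_t n t)).
have mnear n : measurable_fun [set: measurableTypeR R] (fun t => mu (near_t n t)).
  by apply: measurable_fun_xsection; exact: measurable_close_pairs.
have term_ge0 n t : 0 <= ((2 ^+ n) `^ beta)%:E * mu (near_t n t).
  by rewrite mule_ge0// lee_fin powR_ge0.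
have mterm n : measurable_fun [set: measurableTypeR R]
    (fun t => ((2 ^+ n) `^ beta)%:E * mu (near_t n t)).
  exact: measurable_funeM.
have me : measurable_fun [set: measurableTypeR R] e.
  by apply: ge0_emeasurable_sum.
have e0 t : 0 <= e t by exact: nneseries_ge0.
have inte : \int[mu]_t e t < +oo.
  rewrite integral_nneseries//.
  apply: le_lt_trans energy_fin; apply: lee_nneseries => [n _ _|n _].
    by apply: integral_ge0.
  by rewrite ge0_integralZl// lee_fin powR_ge0.
have ie : mu.-integrable setT e.
  apply/integrableP; split=> //.
  by under eq_integral do rewrite gee0_abs//.
have [N [mN N0 eN]] := integrable_ae measurableT ie.
pose G (M : nat) : set R := K `&` [set t | e t <= M%:R%:E].
have mG M : measurable (G M : set (measurableTypeR R)).
  apply: measurableI => //.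
  rewrite -[X in measurable X]setTI; exact: emeasurable_fun_infty_c.
have [[M muGM]|nG] := pselect (exists M, 0 < mu (G M)).
  apply: (mass_distribution (mG M) (ler0n _ M) _ muGM); first by move=> t [].
  move=> t n [_ /= et].
  have tn : ((2 ^+ n) `^ beta)%:E * mu (near_t n t) <= M%:R%:E.
    apply: le_trans et; rewrite /e (@nneseriesD1 _ _ n)//.
    by rewrite leeDl// nneseries_ge0.
  have p0 : (0 < (2 ^+ n) `^ beta :> R)%R by apply: powR_gt0; exact: exprn_gt0.
  have -> : (M%:R * (2 ^- n) `^ beta = M%:R / ((2 ^+ n) `^ beta) :> R)%R.
    congr (_ * _)%R; apply: (mulIf (lt0r_neq0 p0)); rewrite mulVf ?gt_eqF//.
    by rewrite -powRM// mulVf ?powR1// expf_neq0.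
  by rewrite EFinM lee_pdivlMr// muleC.
exfalso; move: mu_gt0; apply/negP; rewrite -leNgt.
have G0 M : mu (G M) = 0.
  by apply/eqP; rewrite eq_le measure_ge0 andbT leNgt; apply/negP => GM; apply: nG; exists M.
have cov : [set: R] `<=` ~` K `|` (N `|` \bigcup_M G M).
  move=> t _; have [Kt|] := pselect (K t); last by left.
  right; have [et|et] := pselect (e t \is a fin_num); last by left; apply: eN => /= /(_ I).
  right; exists (Num.truncn (fine (e t))).+1 => //; split=> //=.
  by rewrite -[e t]fineK// lee_fin ltW// truncnS_gt.
have mUG : measurable (\bigcup_M G M : set (measurableTypeR R)).
  exact: bigcupT_measurable.
have mKC : measurable (~` K : set (measurableTypeR R)) by exact: measurableC.
have UG0 : mu (\bigcup_M G M) = 0.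
  apply/eqP; rewrite eq_le measure_ge0 andbT.
  apply: (@le_trans _ _ (\sum_(0 <= M <oo) mu (G M))); last by rewrite eseries0.
  exact: measure_sigma_subadditive.
apply: (@le_trans _ _ (mu (~` K `|` (N `|` \bigcup_M G M)))).
  by apply: le_measure; rewrite ?inE//; apply: measurableU => //; exact: measurableU.
apply: (@le_trans _ _ (mu (~` K) + mu (N `|` \bigcup_M G M))).
  by apply: measureU2 => //; exact: measurableU.
rewrite muKC add0e; apply: (@le_trans _ _ (mu N + mu (\bigcup_M G M))); last by rewrite [X in X + _]N0 UG0 adde0.
exact: measureU2.
Qed.

End MassDistribution.

(** * The expected energy of the graph *)

Section Clip.
Context {R : realType}.

(** Paths are extended to the whole line by their values at 0 and 1, so that they
are measurable functions of time. *)
Definition clip (t : R) : R := Num.max 0%R (Num.min 1%R t).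

Lemma clip_itv t : `[0%R, 1%R]%classic (clip t).
Proof.
rewrite /= in_itv /= /clip le_max lexx /=.
by rewrite ge_max ler01 ge_min lexx.
Qed.

Lemma clip_id t : `[0%R, 1%R]%classic t -> clip t = t.
Proof.
rewrite /= in_itv /= /clip => /andP[t0 t1].
by rewrite (min_idPr t1) (max_idPr t0).
Qed.

Lemma measurable_clip :
  measurable_fun setT (fun t : measurableTypeR R => clip t : measurableTypeR R).
Proof. by apply: measurable_maxr => //; exact: measurable_minr. Qed.

End Clip.

(** The process is the limit of processes that are constant on the dyadic
intervals, for which joint measurability is clear. *)
Lemma measurable_continuous_process disp (T : measurableType disp)
    (R : realType) (X : R -> T -> R) :
  (forall t, measurable_fun setT (X t : T -> measurableTypeR R)) ->
  (forall w, {within `[0%R, 1%R], continuous (X^~ w)}) ->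
  measurable_fun setT
    (fun p : T * measurableTypeR R => X (clip p.2) p.1 : measurableTypeR R).
Proof.
move=> mX cX.
pose idx n (t : R) : nat := Num.truncn (2 ^+ n * clip t)%R.
pose Xn n (p : T * measurableTypeR R) : R := X ((idx n p.2)%:R * 2 ^- n)%R p.1.
have midx n k : measurable [set t : measurableTypeR R | idx n t = k].
  have m2 : measurable_fun setT (fun t : measurableTypeR R => (2 ^+ n * clip t)%R).
    by apply: measurable_funM => //; exact: measurable_clip.
  rewrite (_ : mkset _ = (fun t : measurableTypeR R => (2 ^+ n * clip t)%R) @^-1` `[k%:R, k.+1%:R[).
    by rewrite -[X in measurable X]setTI; apply: m2.
  apply/seteqP; split=> t /=; rewrite in_itv/=.
    move=> <-; rewrite truncn_le ?truncnS_gt//.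
    have := clip_itv t; rewrite /= in_itv/= => /andP[? _].
    by rewrite mulr_ge0// exprn_ge0.
  by move=> /andP[h1 h2]; apply/eqP; rewrite truncn_eq ?h1//; apply: le_trans h1.
apply: (@measurable_fun_cvg _ _ _ _ Xn) => [n|p _].
  move=> _ U mU; rewrite setTI.
  rewrite (_ : Xn n @^-1` U = \bigcup_k ((X (k%:R * 2 ^- n)%R @^-1` U) `*` [set t | idx n t = k])).
    apply: bigcupT_measurable => k; apply: measurableX => //.
    by rewrite -[X in measurable X]setTI; exact: mX.
  apply/seteqP; split=> -[w t] /=; first by move=> Uw; exists (idx n t).
  by move=> [k _ [/= + tk]]; rewrite /Xn/= tk.
apply/cvgrPdist_lt => e e0.
have up := clip_itv p.2.
have [dlt d0 dP] := within_continuous_dist (cX p.1) up e0.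
have [m md] := exists_half_expn_lt d0.
near=> n.
apply: dP.
  have /= := up; rewrite !in_itv/= => /andP[c0 c1].
  have n0 : (0 < 2 ^+ n :> R)%R by exact: exprn_gt0.
  rewrite mulr_ge0 ?invr_ge0 ?(ltW n0)//= ler_pdivrMr// mul1r.
  apply: (@le_trans _ _ (2 ^+ n * clip p.2)%R).
    by rewrite truncn_le// mulr_ge0// ltW.
  by rewrite -[leRHS]mulr1 ler_wpM2l// ltW.
have /= := up; rewrite !in_itv/= => /andP[c0 c1].
have n0 : (0 < 2 ^+ n :> R)%R by exact: exprn_gt0.
have h1 : ((idx n p.2)%:R * 2 ^- n <= clip p.2)%R.
  by rewrite ler_pdivrMr// mulrC truncn_le// mulr_ge0// ltW.
have h2 : (clip p.2 < (idx n p.2)%:R * 2 ^- n + 2 ^- n)%R.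
  rewrite -[X in (_ + X)%R]mul1r -mulrDl natr1 ltr_pdivlMr// mulrC.
  exact: truncnS_gt.
have h3 : (2 ^- n <= 2 ^- m :> R)%R.
  rewrite lef_pV2 ?posrE// ler_weXn2l ?ler1n//.
  by near: n; exists m.
move: h1 h2 h3 md; set u := (_ * 2 ^- n)%R; set e2 := (2 ^- n)%R; set e3 := (2 ^- m)%R.
move: (clip p.2) => c h1 h2 h3 md; clear -h1 h2 h3 md.
by rewrite ger0_norm; lra.
Unshelve. all: by end_near.
Qed.

Section Shells.
Context {R : realType}.
Variables (mu : {sigma_finite_measure set (measurableTypeR R) -> \bar R}) (C s : R).
Hypotheses (s_gt0 : (0 < s)%R) (mu_fin : mu setT < +oo)
  (mu_itv : forall x y, (0 < y - x <= 1)%R ->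
     mu `]x, y]%classic <= (C * (y - x) `^ s)%:E).

Lemma measure_atom0 (t : R) : mu [set t] = 0.
Proof.
apply/eqP; rewrite eq_le measure_ge0 andbT.
apply/lee_addgt0Pr => e e0; rewrite add0e.
pose D : R := (`|C| + 1)%R.
have D0 : (0 < D)%R by rewrite ltr_wpDl.
pose r : R := Num.min 1%R ((e / D) `^ s^-1)%R.
have r0 : (0 < r)%R by rewrite lt_min ltr01/= powR_gt0// divr_gt0.
have r1 : (r <= 1)%R by rewrite ge_min lexx.
apply: (@le_trans _ _ (mu `](t - r)%R, t]%classic)).
  apply: le_measure; rewrite ?inE//.
  by move=> _ ->; rewrite /= in_itv/= lexx andbT ltrBlDr ltrDl.
have tr : (t - (t - r) = r)%R by rewrite opprB addrC subrK.
apply: (le_trans (mu_itv _)); first by rewrite tr r0.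
rewrite tr lee_fin; apply: (@le_trans _ _ (D * (e / D))%R).
  apply: (@le_trans _ _ (D * r `^ s)%R).
    by rewrite ler_wpM2r ?powR_ge0// (le_trans (ler_norm C))// lerDl.
  rewrite ler_wpM2l//; first exact: ltW.
  have -> : (e / D = ((e / D) `^ s^-1) `^ s)%R.
    by rewrite -powRrM mulVf ?gt_eqF// powRr1// ltW// divr_gt0.
  by apply: le_powRl; [exact: ltW|exact: ltW|rewrite /r ge_min lexx orbT].
by rewrite mulrC divfK ?gt_eqF.
Qed.

(** Pairs are sorted by the dyadic size of their distance, on which the
probability of a small increment depends. *)
Definition shell (k : nat) : set (measurableTypeR R * measurableTypeR R) :=
  [set p | (2 ^- k.+1 < `|p.2 - p.1| <= 2 ^- k)%R].

Lemma measurable_shell k : measurable (shell k).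
Proof.
have m1 := @measurable_pair_dist R.
rewrite -[X in measurable X]setTI.
exact: (m1 measurableT _ (measurable_itv `](2 ^- k.+1)%R, (2 ^- k)%R])).
Qed.

Lemma frostman_constant_ge0 : (0 <= C)%R.
Proof.
have := mu_itv (x := 0%R) (y := 1%R); rewrite subr0 ltr01 lexx => /(_ isT).
rewrite powR1 mulr1 => h; rewrite -lee_fin; exact: le_trans h.
Qed.

Lemma shell_measure_le k :
  (mu \x mu) (shell k) <= (2 * C * (2 ^- k) `^ s * fine (mu setT))%:E.
Proof.
have C0 := frostman_constant_ge0.
rewrite EFinM fineK; last by rewrite ge0_fin_numE.
rewrite /product_measure1.
apply: (@le_trans _ _ (\int[mu]_t (cst (2 * C * (2 ^- k) `^ s)%:E t))).
  apply: ge0_le_integral => //.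
  - by apply: measurable_fun_xsection; exact: measurable_shell.
  move=> t _ /=; have h0 := half_expn_gt0 R k.
  have h1 : (2 ^- k <= 1 :> R)%R by rewrite invf_le1 ?exprn_gt0// exprn_ege1// ler1n.
  apply: (@le_trans _ _ (mu ([set (t - 2 ^- k)%R] `|`
      (`](t - 2 ^- k)%R, t]%classic `|` `]t, (t + 2 ^- k)%R]%classic)))).
    apply: le_measure; rewrite ?inE//.
    - by apply: measurable_xsection; exact: measurable_shell.
    - by apply: measurableU => //; apply: measurableU.
    move=> x; rewrite /xsection /= inE /shell/= => /andP[_].
    rewrite ler_norml => /andP[a1 a2].
    have [->|xn] := eqVneq x (t - 2 ^- k)%R; [by left|right].
    have [xt|xt] := leP x t; [left|right]; rewrite /= in_itv/=.
      by rewrite xt andbT lt_neqAle eq_sym xn/=; lra.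
    by rewrite xt/=; lra.
  apply: (@le_trans _ _ (mu [set (t - 2 ^- k)%R] +
      (mu `](t - 2 ^- k)%R, t]%classic + mu `]t, (t + 2 ^- k)%R]%classic))).
    apply: (le_trans (measureU2 _ _ _)) => //; first exact: measurableU.
    by apply: leeD => //; exact: measureU2.
  rewrite measure_atom0 add0e.
  have -> : (2 * C * (2 ^- k) `^ s = C * (2 ^- k) `^ s + C * (2 ^- k) `^ s :> R)%R by ring.
  rewrite EFinD; apply: leeD; apply: (le_trans (mu_itv _)).
  - by rewrite opprB addrC subrK h0.
  - by rewrite opprB addrC subrK.
  - by rewrite addrC addKr h0.
  - by rewrite addrC addKr.
by rewrite integral_cst.
Qed.

End Shells.

Section Increments.
Context {disp : measure_display} {T : measurableType disp} {R : realType}.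
Variables (P : probability T R) (d : nat) (alpha : R) (B : 'I_d -> R -> {RV P >-> R}).
Hypotheses (alpha_gt0 : (0 < alpha)%R) (B_fbm : is_fbm alpha `[0%R, 1%R] B).

(** Increments are measurable with respect to the sigma-algebra of their own
coordinate, to which independence applies. *)
Lemma small_increment_sigma_algebra i s t r :
  `[0%R, 1%R]%classic s -> `[0%R, 1%R]%classic t ->
  process_sigma_algebra `[0%R, 1%R] (B i)
    [set w | (`|B i t w - B i s w| <= r)%R].
Proof.
move=> s01 t01; rewrite /process_sigma_algebra.
set G := (X in <<s X >>).
pose T' := g_sigma_algebraType G.
have mB u : `[0%R, 1%R]%classic u -> measurable_fun setT (B i u : T' -> measurableTypeR R).
  by move=> u01 _ U mU; rewrite setTI; apply: sub_sigma_algebra; exists u => //; exists U.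
have mD : measurable_fun setT (fun w : T' => `|B i t w - B i s w|%R : measurableTypeR R).
  by apply: measurableT_comp => //; apply: measurable_funB; exact: mB.
have := mD measurableT _ (measurable_itv `]-oo, r]).
rewrite setTI.
suff -> : (fun w : T' => `|B i t w - B i s w|%R) @^-1` `]-oo, r] =
  [set w | (`|B i t w - B i s w| <= r)%R] by [].
by apply/seteqP; split=> w /=; rewrite in_itv.
Qed.

(** In each coordinate the probability is at most min(1, x) <= x^theta, with x the
small-ball bound; the exponent theta is a free parameter that makes the
energy finite when alpha d is not smaller than the dimension of mu. *)
Lemma small_increments_prob (theta s t r : R) :
  (0 <= theta <= 1)%R -> (0 <= r)%R -> s != t ->
  `[0%R, 1%R]%classic s -> `[0%R, 1%R]%classic t ->
  P [set w | forall i, (`|B i t w - B i s w| <= r)%R] <=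
  ((4 * r / `|t - s| `^ alpha) `^ (theta * d%:R))%:E.
Proof.
move=> /andP[th0 th1] r0 st s01 t01.
pose E i := [set w | (`|B i t w - B i s w| <= r)%R].
have ts0 : (0 < `|t - s|)%R by rewrite normr_gt0 subr_eq0 eq_sym.
rewrite (_ : mkset _ = \bigcap_(i in [set` [set: 'I_d]%SET]) E i); last first.
  apply/seteqP; split=> w /= Ew => [i _|i]; first exact: Ew.
  by apply: Ew; rewrite /= inE.
rewrite (fbm_independent B_fbm); last first.
  by move=> i _; exact: small_increment_sigma_algebra.
pose x : R := (4 * r / `|t - s| `^ alpha)%R.
have x0 : (0 <= x)%R by rewrite divr_ge0 ?powR_ge0// mulr_ge0.
have mE i : measurable (E i).
  have := @small_increment_sigma_algebra i s t r s01 t01; apply: smallest_sub.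
    exact: sigma_algebra_measurable.
  by move=> _ [u u01 [U mU <-]]; rewrite -[X in measurable X]setTI; exact: measurable_funP.
have PE i : P (E i) <= (x `^ theta)%:E.
  have inc := fbm_increment alpha_gt0 (fbm_components B_fbm i) s01 t01.
  have := gaussian_small_ball (powR_gt0 _ ts0) inc r0.
  rewrite (mulrC 2%R) powRrM powR_mulrn ?powR_ge0// sqrtr_sqr ger0_norm ?powR_ge0//.
  rewrite -/x => Px; have [x1|x1] := leP x 1%R; last first.
    apply: (le_trans (probability_le1 P (mE i))); rewrite lee_fin -(powRr0 x).
    by apply: ler_powR; rewrite // ltW.
  apply: (le_trans Px); rewrite lee_fin.
  move: x0; rewrite le_eqVlt => /predU1P[<-|xp]; first exact: powR_ge0.
  rewrite -{1}[x]powRr1; last exact: ltW.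
  by apply: ger_powR; rewrite ?xp.
have PEf i : P (E i) = (fine (P (E i)))%:E by rewrite fineK// fin_num_measure.
rewrite (eq_bigr (fun i => (fine (P (E i)))%:E)) // prodEFin lee_fin.
have -> : (x `^ (theta * d%:R) = \prod_(i in [set: 'I_d]%SET) x `^ theta)%R.
  by rewrite prodr_const cardsT card_ord powRrM powR_mulrn// powR_ge0.
apply: ler_prod => i _; rewrite fine_ge0//=.
by rewrite -lee_fin -PEf.
Qed.

End Increments.

Lemma product_measure_ysection d1 d2 (T1 : measurableType d1)
    (T2 : measurableType d2) (R : realType)
    (m1 : {sigma_finite_measure set T1 -> \bar R})
    (m2 : {sigma_finite_measure set T2 -> \bar R}) (A : set (T1 * T2)) :
  measurable A -> (m1 \x m2) A = \int[m2]_y m1 (ysection A y).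
Proof.
move=> mA; transitivity (\int[m1]_x fubini_F m2 (EFin \o \1_A) x).
  by rewrite indic_fubini_tonelli_FE.
by rewrite indic_fubini_tonelli// indic_fubini_tonelli_GE.
Qed.

(** Stated as the existence of a structure on the product, so that the product
can itself be a factor in Fubini's theorem. *)
Lemma sigma_finite_product d1 d2 (T1 : measurableType d1)
    (T2 : measurableType d2) (R : realType)
    (m1 : {sigma_finite_measure set T1 -> \bar R})
    (m2 : {sigma_finite_measure set T2 -> \bar R}) :
  m1 setT < +oo -> m2 setT < +oo ->
  exists nu : {sigma_finite_measure set (T1 * T2)%type -> \bar R},
    forall A, nu A = (m1 \x m2) A.
Proof.
move=> m1fin m2fin.
have sf : sigma_finite setT (m1 \x m2)%E.
  exists (fun=> setT) => [|_]; first by rewrite bigcup_const.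
  split=> //; rewrite -setXTT product_measure1E//.
  by rewrite lte_mul_pinfty// ge0_fin_numE.
pose mix := Measure_isSigmaFinite.Build _ _ _ (m1 \x m2)%E sf.
pose nu : {sigma_finite_measure set (T1 * T2)%type -> \bar R} :=
  HB.pack (m1 \x m2)%E mix.
by exists nu.
Qed.

Section Energy.
Context {disp : measure_display} {T : measurableType disp} {R : realType}.
Variables (P : probability T R) (d : nat) (alpha H : R) (B : 'I_d -> R -> {RV P >-> R}).
Hypotheses (alpha_gt0 : (0 < alpha)%R) (B_fbm : is_fbm alpha `[0%R, 1%R] B).
Variables (mu : {sigma_finite_measure set (measurableTypeR R) -> \bar R}) (C s : R).
Hypotheses (s_gt0 : (0 < s)%R) (mu_fin : mu setT < +oo)
  (mu_itv : forall x y, (0 < y - x <= 1)%R ->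
     mu `]x, y]%classic <= (C * (y - x) `^ s)%:E)
  (mu_unit : mu (~` `[0%R, 1%R]) = 0).
Variable pairs_measure : {sigma_finite_measure set (measurableTypeR R * measurableTypeR R)%type -> \bar R}.
Hypothesis pairs_measureE : forall D, pairs_measure D = (mu \x mu) D.
Variables (theta beta : R).
Hypotheses (theta01 : (0 <= theta <= 1)%R) (theta_s : (alpha * (theta * d%:R) < s)%R)
  (beta_lt : (beta < s + (H - alpha) * (theta * d%:R))%R).

Let clipped (w : T) (t : R) : 'rV[R]_d := sample_path B w (clip t).

Lemma measurable_joint_path i : measurable_fun setT
  (fun p : T * measurableTypeR R => B i (clip p.2) p.1 : measurableTypeR R).
Proof.
apply: (@measurable_continuous_process _ _ _ (fun t w => B i t w)).
  by move=> t; exact: (@measurable_funPT _ _ _ _ (B i t)).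
by move=> w; exact: (@fbm1_continuous _ _ _ _ _ _ _ (fbm_components B_fbm i) w).
Qed.

Lemma measurable_path w i : measurable_fun setT
  (fun t : measurableTypeR R => clipped w t ord0 i : measurableTypeR R).
Proof.
rewrite (_ : (fun t => _) = (fun t => B i (clip t) w)).
  exact: (measurable_fun_pair2 w (measurable_joint_path i)).
by apply/funext => t; rewrite mxE.
Qed.

Definition close_increments n : set (T * (measurableTypeR R * measurableTypeR R)) :=
  [set q | [/\ `[0%R, 1%R]%classic q.2.1, `[0%R, 1%R]%classic q.2.2 &
    forall i, (`|B i (clip q.2.2) q.1 - B i (clip q.2.1) q.1| <= (2 ^- n) `^ H)%R]].

Lemma measurable_close_increments n : measurable (close_increments n).
Proof.
have mq1 : measurable_fun setT (fun q : T * (measurableTypeR R * measurableTypeR R) => q.2.1).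
  by apply: measurableT_comp.
have mq2 : measurable_fun setT (fun q : T * (measurableTypeR R * measurableTypeR R) => q.2.2).
  by apply: measurableT_comp.
rewrite (_ : close_increments n =
  (fun q : T * (measurableTypeR R * measurableTypeR R) => q.2.1) @^-1` `[0%R, 1%R] `&`
  ((fun q : T * (measurableTypeR R * measurableTypeR R) => q.2.2) @^-1` `[0%R, 1%R] `&`
  \bigcap_(i in [set: 'I_d]) ((fun q : T * (measurableTypeR R * measurableTypeR R) =>
     `|B i (clip q.2.2) q.1 - B i (clip q.2.1) q.1|%R) @^-1` `]-oo, ((2 ^- n) `^ H)%R]))).
  apply: measurableI; last apply: measurableI.
  - by rewrite -[X in measurable X]setTI; apply: mq1.
  - by rewrite -[X in measurable X]setTI; apply: mq2.
  apply: fin_bigcap_measurable => [|i _]; first exact: finite_finset.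
  have m2 : measurable_fun setT (fun q : T * (measurableTypeR R * measurableTypeR R) =>
      `|B i (clip q.2.2) q.1 - B i (clip q.2.1) q.1|%R).
    apply: measurableT_comp => //; apply: measurable_funB.
      exact: (measurableT_comp (measurable_joint_path i) (measurable_fun_pair measurable_fst mq2)).
    exact: (measurableT_comp (measurable_joint_path i) (measurable_fun_pair measurable_fst mq1)).
  rewrite -[X in measurable X]setTI; exact: m2.
apply/seteqP; split=> q /=.
  by move=> [q1 q2 q3]; split=> //; split=> // i _; rewrite /= in_itv/=.
by move=> [q1 [q2 q3]]; split=> // i; have := q3 i I; rewrite /= in_itv.
Qed.

Let tau : R := (theta * d%:R)%R.
Let total : R := fine (mu setT).

Definition close_at_scale n k := close_increments n `&` (setT `*` shell k).

Lemma close_at_scale_le n k : (P \x pairs_measure) (close_at_scale n k) <=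
  (4 `^ tau * (2^-1 `^ (H * tau)) ^+ n * (2^-1 `^ (- (alpha * tau))) ^+ k.+1 *
   (2 * C * (2^-1 `^ s) ^+ k * total))%:E.
Proof.
set c := (X in (X * (2 * C * _ * total))%R).
have tau0 : (0 <= tau)%R by case/andP: theta01 => ? _; rewrite mulr_ge0.
have c0 : (0 <= c)%R by rewrite /c !mulr_ge0 ?exprn_ge0 ?powR_ge0.
have mD : measurable (close_at_scale n k).
  apply: measurableI; first exact: measurable_close_increments.
  by apply: measurableX => //; exact: measurable_shell.
have -> : (P \x pairs_measure) (close_at_scale n k) =
    \int[pairs_measure]_p P (ysection (close_at_scale n k) p).
  exact: product_measure_ysection.
apply: (@le_trans _ _ (\int[pairs_measure]_p (c%:E * (\1_(shell k) p)%:E))).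
  apply: ge0_le_integral => //.
  - exact: measurable_fun_ysection.
  - apply: measurable_funeM; apply/measurable_EFinP.
    by apply: measurable_indic; exact: measurable_shell.
  move=> p _; have [pk|pk] := pselect (shell k p); last first.
    rewrite (_ : ysection _ _ = set0) ?measure0.
      by rewrite mule_ge0// lee_fin.
    apply/seteqP; split=> // w; rewrite /ysection/= inE => -[_ [_ /= pk']].
    exact: pk.
  rewrite indicE mem_set// mule1.
  have [[p1 p2]|np] := pselect (`[0%R, 1%R]%classic p.1 /\ `[0%R, 1%R]%classic p.2); last first.
    rewrite (_ : ysection _ _ = set0) ?measure0 ?lee_fin//.
    apply/seteqP; split=> // w; rewrite /ysection/= inE => -[[q1 q2 _] _].
    by apply: np.
  have h0 := half_expn_gt0 R k.+1; have hn := half_expn_gt0 R n.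
  have /andP[pk1 _] : (2 ^- k.+1 < `|p.2 - p.1| <= 2 ^- k)%R := pk.
  have dp0 : (0 < `|p.2 - p.1|)%R by exact: lt_trans pk1.
  have pn : p.1 != p.2 by move: dp0; rewrite normr_gt0 subr_eq0 eq_sym.
  have -> : ysection (close_at_scale n k) p =
      [set w | forall i, (`|B i p.2 w - B i p.1 w| <= (2 ^- n) `^ H)%R].
    apply/seteqP; split=> w; rewrite /ysection/= inE.
      by move=> [[/= _ _ h] _] i; have := h i; rewrite !clip_id.
    by move=> h; split=> //=; split=> //= i; rewrite !clip_id.
  apply: (le_trans (small_increments_prob alpha_gt0 B_fbm theta01 (powR_ge0 _ _) pn p1 p2)).
  rewrite lee_fin -/tau /c.
  apply: (@le_trans _ _ ((4 * (2 ^- n) `^ H / (2 ^- k.+1) `^ alpha) `^ tau)%R).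
    apply: le_powRl => //; rewrite ler_wpM2l ?mulr_ge0 ?powR_ge0// lef_pV2 ?posrE ?powR_gt0//.
    by apply: le_powRl; rewrite ltW.
  rewrite powRM ?mulr_ge0 ?invr_ge0 ?powR_ge0// powRM ?powR_ge0//.
  rewrite -powRN -!powRrM !half_expn_powR mulNr.
  exact: lexx.
rewrite ge0_integralZl//; last first.
  apply/measurable_EFinP; apply: measurable_indic; exact: measurable_shell.
rewrite integral_indic//; last exact: measurable_shell.
rewrite setIT (EFinM c); apply: lee_wpmul2l; first by rewrite lee_fin.
have := shell_measure_le s_gt0 mu_fin mu_itv k.
by rewrite -pairs_measureE half_expn_powR.
Qed.

Let u : R := (2^-1 `^ (H * tau))%R.
Let v : R := (2^-1 `^ (s - alpha * tau))%R.
Let K : R := (4 `^ tau * 2^-1 `^ (- (alpha * tau)) * (2 * C * total))%R.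

Let K_ge0 : (0 <= K)%R.
Proof.
rewrite !mulr_ge0 ?powR_ge0 ?fine_ge0//; exact: (frostman_constant_ge0 mu_itv).
Qed.

Let v_ge0 : (0 <= v)%R. Proof. exact: powR_ge0. Qed.

Let v_lt1 : (v < 1)%R.
Proof. by apply: half_powR_lt1; rewrite subr_gt0. Qed.

Definition near_increments n : set (T * (measurableTypeR R * measurableTypeR R)) :=
  close_increments n `&` (setT `*` [set p | (0 < `|p.2 - p.1| <= 2 ^- n)%R]).

Lemma measurable_near_increments n : measurable (near_increments n).
Proof.
apply: measurableI; first exact: measurable_close_increments.
apply: measurableX => //.
have m1 := @measurable_pair_dist R.
rewrite -[X in measurable X]setTI.
exact: (m1 measurableT _ (measurable_itv `]0%R, (2 ^- n)%R])).
Qed.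

(** The shells k >= n contribute a geometric series of ratio
v = 2^-(s - alpha tau), and u v is the ratio of the resulting sequence in n. *)
Lemma close_increments_le n : (P \x pairs_measure) (near_increments n) <=
  (K / (1 - v) * (u * v) ^+ n)%:E.
Proof.
have mD k : measurable (close_at_scale n k).
  apply: measurableI; first exact: measurable_close_increments.
  by apply: measurableX => //; exact: measurable_shell.
apply: (@le_trans _ _ (\sum_(0 <= k <oo) (P \x pairs_measure) (close_at_scale n (n + k)))).
  apply: measure_sigma_subadditive => //; first exact: measurable_near_increments.
  move=> q [q1 [_ /= /andP[q2 q3]]].
  have : (0 < `|q.2.2 - q.2.1| <= 1)%R.
    rewrite q2 (le_trans q3)// invf_le1 ?exprn_gt0// exprn_ege1// ler1n//.
  move=> /exists_dyadic_scale[k [k1 k2]].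
  have nk : (n <= k)%N.
    rewrite -ltnS ltnNge; apply/negP => kn.
    have : (2 ^- n <= 2 ^- k.+1 :> R)%R.
      by rewrite lef_pV2 ?posrE// ler_weXn2l ?ler1n.
    by move=> /(le_trans q3) /(lt_le_trans k1); rewrite ltxx.
  exists (k - n)%N => //; rewrite subnKC//; split=> //; split=> //=.
  by rewrite /shell/= k1.
apply: (@le_trans _ _ (\sum_(0 <= k <oo) (K * (u * v) ^+ n * v ^+ k)%:E)).
  apply: lee_nneseries => [k _ _|k _]; first exact: measure_ge0.
  apply: (le_trans (close_at_scale_le _ _)); rewrite lee_fin.
  have half0 : (0 < 2^-1 :> R)%R by rewrite invr_gt0.
  have vE : (v = 2^-1 `^ (- (alpha * tau)) * 2^-1 `^ s)%R.
    by rewrite -powRD ?(gt_eqF half0) ?implybT// addrC.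
  rewrite /K /u vE; move: (2^-1 `^ s)%R (2^-1 `^ (- _))%R (2^-1 `^ (H * tau))%R => x y z.
  rewrite le_eqVlt; apply/orP; left; apply/eqP.
  rewrite exprS !exprMn !exprD; ring.
rewrite nneseries_geometric ?v_ge0// lee_fin mulrAC.
exact: lexx.
Qed.

(** The expected energy is a geometric series of ratio
2^-(s + (H - alpha) tau - beta) < 1.  The measure mu lives on [0, 1], so that
pairs outside of the unit square can be discarded. *)
Lemma energy_ae : {ae P, forall w,
  \sum_(0 <= n <oo) (((2 ^+ n) `^ beta)%:E *
    (mu \x mu) (close_pairs (clipped w) H n : set (measurableTypeR R * measurableTypeR R))) < +oo}.
Proof.
pose g n w := ((2 ^+ n) `^ beta)%:E * pairs_measure (xsection (near_increments n) w).
have g0 n w : 0 <= g n w by rewrite mule_ge0// lee_fin powR_ge0.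
have mgx n : measurable_fun setT (fun w => pairs_measure (xsection (near_increments n) w)).
  by apply: measurable_fun_xsection; exact: measurable_near_increments.
have mg n : measurable_fun setT (g n) by exact: measurable_funeM.
have half0 : (0 < 2^-1 :> R)%R by rewrite invr_gt0.
pose rho : R := (2^-1 `^ (H * tau + (s - alpha * tau) - beta))%R.
have rho01 : (0 <= rho < 1)%R.
  rewrite powR_ge0/=; apply: half_powR_lt1.
  rewrite subr_gt0; apply: (lt_le_trans beta_lt); rewrite -/tau.
  by rewrite (_ : H * tau + (s - alpha * tau) = s + (H - alpha) * tau)%R//; ring.
have int_fin : \int[P]_w (\sum_(0 <= n <oo) g n w) < +oo.
  rewrite integral_nneseries//.
  apply: (@le_lt_trans _ _ (\sum_(0 <= n <oo) (K / (1 - v) * rho ^+ n)%:E)); last first.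
    by rewrite nneseries_geometric// ltry.
  apply: lee_nneseries => [n _ _|n _]; first exact: integral_ge0.
  rewrite /g ge0_integralZl ?lee_fin ?powR_ge0//.
  apply: (@le_trans _ _ (((2 ^+ n) `^ beta)%:E * (K / (1 - v) * (u * v) ^+ n)%:E)).
    by rewrite lee_wpmul2l ?lee_fin ?powR_ge0//; exact: close_increments_le.
  rewrite -EFinM lee_fin.
  have -> : (((2 ^+ n) `^ beta) = (2^-1 `^ (- beta)) ^+ n :> R)%R.
    have hn := half_expn_gt0 R n.
    have p0 : ((2 ^- n) `^ beta != 0 :> R)%R by rewrite gt_eqF// powR_gt0.
    apply: (mulIf p0); rewrite -half_expn_powR powRN mulVf//.
    by rewrite -powRM ?ltW// mulfV ?powR1// expf_neq0.
  have -> : (rho = 2^-1 `^ (- beta) * (u * v))%R.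
    rewrite /rho /u /v -!powRD ?(gt_eqF half0) ?implybT//.
    by congr (_ `^ _)%R; ring.
  by rewrite mulrCA -exprMn.
have ig : P.-integrable setT (fun w => \sum_(0 <= n <oo) g n w).
  apply/integrableP; split; first exact: ge0_emeasurable_sum.
  under eq_integral do rewrite gee0_abs ?nneseries_ge0//.
  exact: int_fin.
have [N [mN N0 gN]] := integrable_ae measurableT ig.
exists N; split=> // w /= nfin; apply: gN => /= gfin; apply: nfin.
have {gfin} := gfin I; rewrite ge0_fin_numE ?nneseries_ge0//.
apply: le_lt_trans; apply: lee_nneseries => [n _ _|n _].
  by rewrite mule_ge0// lee_fin powR_ge0.
rewrite /g lee_wpmul2l ?lee_fin ?powR_ge0//.
have mI : measurable (~` `[0%R, 1%R] : set (measurableTypeR R)) by exact: measurableC.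
have mx : measurable (xsection (near_increments n) w).
  by apply: measurable_xsection; exact: measurable_near_increments.
apply: (@le_trans _ _ ((mu \x mu) (xsection (near_increments n) w `|`
    ((~` `[0%R, 1%R]) `*` setT `|` setT `*` (~` `[0%R, 1%R]))))).
  apply: le_measure; rewrite ?inE.
  - by apply: measurable_close_pairs => i; exact: measurable_path.
  - by apply: measurableU => //; apply: measurableU; exact: measurableX.
  move=> p [p1 p2].
  have [q1|] := pselect (`[0%R, 1%R]%classic p.1); last by right; left.
  have [q2|] := pselect (`[0%R, 1%R]%classic p.2); last by right; right.
  left; rewrite /xsection/= inE; split=> //; split=> // i.
  by have := p2 i; rewrite !mxE.
apply: (@le_trans _ _ ((mu \x mu) (xsection (near_increments n) w) +
    ((mu \x mu) ((~` `[0%R, 1%R]) `*` setT) + (mu \x mu) (setT `*` (~` `[0%R, 1%R]))))).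
  apply: (le_trans (measureU2 _ _ _)) => //.
    by apply: measurableU; exact: measurableX.
  by apply: leeD => //; apply: measureU2; exact: measurableX.
rewrite !product_measure1E//.
rewrite [X in X * _ + _](_ : _ = 0)// [X in _ + _ * X](_ : _ = 0)//.
by rewrite mul0e mule0 !adde0 -pairs_measureE.
Qed.

End Energy.

(** * Dimensions *)

Lemma lee_archimedean (R : realType) (x : \bar R) (a b : R) : (0 <= b)%R ->
  (forall n : nat, x <= (a + b / n.+1%:R)%:E) -> x <= a%:E.
Proof.
move=> b0 xab; apply/lee_addgt0Pr => e e0.
apply: (le_trans (xab (Num.truncn (b / e)))); rewrite -EFinD lee_fin lerD2l.
rewrite ler_pdivrMr ?ltr0n// mulrC -ler_pdivrMr// ltW//; exact: truncnS_gt.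
Qed.

Section ParabolicDimension.
Context {R : realType} {d : nat}.
Implicit Types (F G : set (R * 'rV[R]_d)) (H beta : R).

Lemma le_parabolic_content H beta F G : F `<=` G ->
  parabolic_content H beta F <= parabolic_content H beta G.
Proof.
move=> FG; apply: le_ereal_inf => _ [delta [a [b [d0 cov ->]]]].
by exists delta, a, b; split=> //; exact: subset_trans cov.
Qed.

(** A cover of cost less than 1 has all its sides below 1, and then a larger
exponent decreases its cost. *)
Lemma parabolic_content_eq0_le H (beta beta' : R) F :
  (0 < beta)%R -> (beta <= beta')%R ->
  parabolic_content H beta F = 0 -> parabolic_content H beta' F = 0.
Proof.
move=> beta0 bb' F0; apply/eqP; rewrite eq_le parabolic_content_ge0 andbT.
apply/lee_addgt0Pr => e e0; rewrite add0e.
pose e' : R := Num.min e 1%R.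
have e'0 : (0 < e')%R by rewrite lt_min e0/=.
have : parabolic_content H beta F < e'%:E by rewrite F0 lte_fin.
move=> /ereal_inf_lt[_ [delta [a [b [d0 cov ->]]]] sum_lt].
apply: (@le_trans _ _ (\sum_(0 <= j <oo) (delta j `^ beta')%:E)).
  by apply: ereal_inf_lbound; exists delta, a, b.
apply: (@le_trans _ _ (\sum_(0 <= j <oo) (delta j `^ beta)%:E)); last first.
  by apply: (le_trans (ltW sum_lt)); rewrite lee_fin ge_min lexx.
have p0 j : 0 <= (delta j `^ beta)%:E by rewrite lee_fin powR_ge0.
apply: lee_nneseries => [j _ _|j _]; first by rewrite lee_fin powR_ge0.
rewrite lee_fin; have := d0 j; rewrite le_eqVlt => /predU1P[<-|dj].
  by rewrite !powR0// gt_eqF// (lt_le_trans beta0).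
have dj1 : (delta j <= 1)%R.
  rewrite leNgt; apply/negP => dj1.
  have : (delta j `^ beta)%:E < 1%:E.
    apply: (@le_lt_trans _ _ (\sum_(0 <= j <oo) (delta j `^ beta)%:E)).
      by rewrite (@nneseriesD1 _ _ j)// leeDl// nneseries_ge0.
    by apply: (lt_le_trans sum_lt); rewrite lee_fin ge_min lexx orbT.
  rewrite lte_fin ltNge -(powRr0 (delta j)) ler_powR//; exact: ltW.
by apply: ger_powR; rewrite ?dj.
Qed.

Lemma parabolic_dim_ge0 H F : 0 <= parabolic_dim H F.
Proof. by apply: le_ereal_inf_tmp => _ [b [b0 _] <-]; rewrite lee_fin ltW. Qed.

Lemma parabolic_dim_ge H beta F :
  0 < parabolic_content H beta F -> beta%:E <= parabolic_dim H F.
Proof.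
move=> Fb; apply: le_ereal_inf_tmp => _ [b [b0 Fb0] <-]; rewrite lee_fin leNgt.
apply/negP => /ltW bb; move: Fb.
by rewrite (parabolic_content_eq0_le b0 bb Fb0) ltxx.
Qed.

Lemma parabolic_dim_le H beta F : (0 < beta)%R ->
  parabolic_content H beta F = 0 -> parabolic_dim H F <= beta%:E.
Proof. by move=> beta0 F0; apply: ereal_inf_lbound; exists beta. Qed.

End ParabolicDimension.

Section HausdorffDimension.
Context {R : realType}.
Variable A : set R.

Lemma hausdorff_dim_ge0 : 0 <= hausdorff_dim A.
Proof. by apply: le_ereal_inf_tmp => _ [b [b0 _] <-]; rewrite lee_fin ltW. Qed.

Lemma hausdorff_measure_neq0 (s : R) : (0 < s)%R -> s%:E < hausdorff_dim A ->
  hausdorff_measure s A <> 0.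
Proof.
move=> s0 sA As0; move: sA; apply/negP; rewrite -leNgt.
by apply: ereal_inf_lbound; exists s.
Qed.

(** A Frostman measure of exponent s > 1 on [0, 1] would have total mass at most
2^n C 2^(-ns) for every n. *)
Lemma hausdorff_dim_unit_le1 : measurable (A : set (measurableTypeR R)) -> A `<=` `[0%R, 1%R] -> hausdorff_dim A <= 1.
Proof.
move=> mA A01; apply/lee_addgt0Pr => e e0; apply: ereal_inf_lbound.
exists (1 + e)%R => //; split; first by rewrite addr_gt0.
set s : R := (1 + e)%R.
have s0 : (0 < s)%R by rewrite addr_gt0.
apply: contrapT => /(frostman s0 mA A01)[K [C [mu [cK KA muK /andP[mu0 mu_fin] mu_itv]]]].
move: mu0; apply/negP; rewrite -leNgt.
have C0 := frostman_constant_ge0 mu_itv.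
have muI : mu (~` `[0%R, 1%R]) = 0.
  apply/eqP; rewrite eq_le measure_ge0 andbT -muK.
  apply: le_measure; rewrite ?inE.
  - exact: measurableC.
  - by apply: measurableC; exact: closed_measurable.
  - by apply: subsetC; exact: subset_trans A01.
have split_bound n : mu setT <= (C * (2^-1 `^ e) ^+ n)%:E.
  pose J k : set (measurableTypeR R) := `](k%:R * 2 ^- n)%R, (k.+1%:R * 2 ^- n)%R]%classic.
  have hn := half_expn_gt0 R n.
  have Jle k : mu (J k) <= (C * (2 ^- n) `^ s)%:E.
    have kE : (k.+1%:R * 2 ^- n - k%:R * 2 ^- n = 2 ^- n :> R)%R.
      by rewrite -mulrBl -natrB// subSnn mul1r.
    apply: (le_trans (mu_itv _ _ _)); rewrite kE// hn/= invf_le1 ?exprn_gt0//.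
    by rewrite exprn_ege1// ler1n.
  have mU : measurable (\big[setU/set0]_(k < 2 ^ n) J k).
    by apply: bigsetU_measurable => k _; exact: measurable_itv.
  apply: (@le_trans _ _ (mu (~` `[0%R, 1%R] `|` ([set 0%R] `|` \big[setU/set0]_(k < 2 ^ n) J k)))).
    apply: le_measure; rewrite ?inE//.
      apply: measurableU; first exact: measurableC.
      by apply: measurableU.
    move=> x _; have [x01|] := pselect (`[0%R, 1%R]%classic x); last by left.
    right; have [->|x0] := eqVneq x 0%R; [by left|right].
    have [k [kn xk]] : exists k, (k < 2 ^ n)%N /\ J k x.
      pose y : R := (x * 2 ^+ n)%R; pose t := Num.truncn y.
      move: x01; rewrite /= in_itv/= => /andP[x_ge0 x_le1].
      have p0 : (0 < 2 ^+ n :> R)%R by exact: exprn_gt0.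
      have y0 : (0 < y)%R by rewrite mulr_gt0// lt0r x0.
      have yn : (y <= 2 ^+ n)%R by rewrite -[leRHS]mul1r ler_pM2r.
      have ty : (t%:R <= y)%R by rewrite truncn_le// ltW.
      have yt : (y < t.+1%:R)%R by exact: truncnS_gt.
      have JE k : (k%:R < y <= k.+1%:R)%R -> J k x.
        by rewrite /J /= in_itv/= ltr_pdivrMr// ler_pdivlMr.
      have lt2 k : (k%:R < y)%R -> (k < 2 ^ n)%N.
        by move=> ky; rewrite -(ltr_nat R) natrX (lt_le_trans ky).
      move: ty; rewrite le_eqVlt => /predU1P[tE|ty]; last first.
        by exists t; split; [exact: lt2|apply: JE; rewrite ty ltW].
      have t0 : (0 < t)%N by rewrite -(ltr0n R) tE.
      have t1y : (t.-1%:R < y)%R by rewrite -tE ltr_nat prednK.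
      by exists t.-1; split; [exact: lt2|apply: JE; rewrite t1y prednK// tE/=].
    by rewrite -bigcup_mkord; exists k.
  apply: (le_trans (measureU2 _ _ _)); first exact: measurableC.
    by apply: measurableU.
  rewrite [X in X + _](_ : _ = 0)// add0e.
  apply: (le_trans (measureU2 _ _ _)) => //.
  rewrite [X in X + _](_ : _ = 0) ?add0e; last exact: (measure_atom0 s0 mu_itv).
  apply: (@le_trans _ _ (\sum_(k < 2 ^ n) mu (J k))).
    by apply: (@Boole_inequality _ _ _ mu J) => k _; exact: measurable_itv.
  apply: (@le_trans _ _ (\sum_(k < 2 ^ n) (C * (2 ^- n) `^ s)%:E)).
    by apply: lee_sum.
  rewrite sumEFin lee_fin sumr_const card_ord -[leLHS]mulr_natl mulrCA ler_wpM2l//.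
  rewrite /s powRD ?(gt_eqF hn) ?implybT// powRr1 ?(ltW hn)// mulrA natrX mulfV ?expf_neq0//.
  by rewrite mul1r half_expn_powR.
apply/lee_addgt0Pr => e' e'0; rewrite add0e.
have C1 : (0 < C + 1)%R by rewrite ltr_wpDl.
have [n nP] := exists_half_expn_lt (powR_gt0 e^-1 (divr_gt0 e'0 C1)).
apply: (le_trans (split_bound n)); rewrite -half_expn_powR lee_fin.
apply: (@le_trans _ _ ((C + 1) * (e' / (C + 1)))%R); last by rewrite mulrC divfK ?gt_eqF.
apply: ler_pM; rewrite ?powR_ge0 ?lerDl//.
have -> : (e' / (C + 1) = ((e' / (C + 1)) `^ e^-1) `^ e)%R.
  by rewrite -powRrM mulVf ?gt_eqF// powRr1// ltW// divr_gt0.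
by apply: le_powRl; rewrite ?ltW// half_expn_gt0.
Qed.

End HausdorffDimension.

Section MainBounds.
Context {disp : measure_display} {T : measurableType disp} {R : realType}.
Variables (P : probability T R) (d : nat) (alpha H : R)
  (B : 'I_d -> R -> {RV P >-> R}) (A : set R).
Hypotheses (d_ge1 : (1 <= d)%N) (alpha_gt0 : (0 < alpha)%R)
  (alpha_le_H : (alpha <= H)%R) (B_fbm : is_fbm alpha `[0%R, 1%R] B)
  (A_sub : A `<=` `[0%R, 1%R]) (A_borel : measurable (A : set (measurableTypeR R))).

Let H_gt0 : (0 < H)%R. Proof. exact: lt_le_trans alpha_le_H. Qed.

Local Notation graph w := (graph_over A (sample_path B w)).

Lemma graph_content_gt0_ae (s theta beta : R) :
  (0 < s)%R -> hausdorff_measure s A <> 0 -> (0 <= theta <= 1)%R ->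
  (alpha * (theta * d%:R) < s)%R -> (0 < beta)%R ->
  (beta < s + (H - alpha) * (theta * d%:R))%R ->
  {ae P, forall w, 0 < parabolic_content H beta (graph w)}.
Proof.
move=> s0 As0 th01 ths beta0 beta_lt.
have [K [C [mu [cK KA muK /andP[mu0 mu_fin] mu_itv]]]] := frostman s0 A_borel A_sub As0.
have mK : measurable (K : set (measurableTypeR R)) by exact: closed_measurable.
have muI : mu (~` `[0%R, 1%R]) = 0.
  apply/eqP; rewrite eq_le measure_ge0 andbT -muK.
  apply: le_measure; rewrite ?inE; [exact: measurableC|exact: measurableC|].
  by apply: subsetC; exact: subset_trans A_sub.
have [nu nuE] := sigma_finite_product mu_fin mu_fin.
have := energy_ae alpha_gt0 B_fbm s0 mu_fin mu_itv muI nuE th01 ths beta_lt.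
apply: filterS => w energy_fin.
have K_pos := parabolic_content_gt0 H_gt0 beta0 (measurable_path B_fbm w) mu_fin
  (measure_atom0 s0 mu_itv) muK mu0 mK energy_fin.
apply: (lt_le_trans K_pos); apply: le_parabolic_content => _ [t Kt <-].
exists t; first exact: KA.
by rewrite clip_id//; apply: A_sub; exact: KA.
Qed.

(** With lam < 1, the exponents s = lam D and tau = lam^2 min(d, D / alpha)
satisfy alpha tau < s, and they admit beta = lam^3 m, where m is the claimed
bound; lam then tends to 1 along a sequence. *)
Lemma graph_dim_ge_ae (D : R) : (0 < D)%R -> hausdorff_dim A = D%:E ->
  {ae P, forall w,
    (D + (H - alpha) * Num.min d%:R (D / alpha))%:E <= parabolic_dim H (graph w)}.
Proof.
move=> D0 dimA.
pose tau : R := Num.min d%:R (D / alpha)%R.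
pose m : R := (D + (H - alpha) * tau)%R.
have dR0 : (0 < d%:R :> R)%R by rewrite ltr0n.
have tau0 : (0 <= tau)%R by rewrite le_min ltW//= divr_ge0// ltW.
have m0 : (0 < m)%R by rewrite ltr_wpDr// mulr_ge0// subr_ge0.
pose lam n : R := (1 - n.+2%:R^-1)%R.
have lam01 n : (0 < lam n < 1)%R.
  rewrite subr_gt0 invf_lt1 ?ltr0n// ltr1n/= /lam ltrBlDr ltrDl invr_gt0 ltr0n.
  by [].
have : {ae P, forall w, forall n,
    0 < parabolic_content H (lam n ^+ 3 * m) (graph w)}.
  apply: ae_foralln => n; have /andP[l0 l1] := lam01 n.
  have l2 : (0 < lam n ^+ 2)%R by exact: exprn_gt0.
  apply: (@graph_content_gt0_ae (lam n * D)%R (lam n ^+ 2 * tau / d%:R)%R).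
  - exact: mulr_gt0.
  - apply: hausdorff_measure_neq0; first exact: mulr_gt0.
    by rewrite dimA lte_fin gtr_pMl.
  - apply/andP; split.
      by apply: divr_ge0; [apply: mulr_ge0 => //; exact: ltW|exact: ltW].
    rewrite ler_pdivrMr// mul1r.
    apply: (@le_trans _ _ (1 * tau)%R); last by rewrite mul1r ge_min lexx.
    by rewrite ler_wpM2r// exprn_ile1 ?ltW.
  - rewrite divfK ?gt_eqF//.
    apply: (@le_lt_trans _ _ (lam n ^+ 2 * D)%R).
      rewrite mulrCA ler_wpM2l//; first exact: ltW.
      by rewrite mulrC -ler_pdivlMr// ge_min lexx orbT.
    by rewrite ltr_pM2r// expr2 gtr_pMl.
  - by rewrite mulr_gt0// exprn_gt0.
  rewrite divfK ?gt_eqF//.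
  apply: (@lt_le_trans _ _ (lam n ^+ 2 * m)%R).
    by rewrite ltr_pM2r// exprS gtr_pMl.
  rewrite /m mulrDr lerD//.
    by rewrite ler_wpM2r ?(ltW D0)// expr2 ger_pMl// ltW.
  by rewrite mulrCA.
apply: filterS => w content_pos; rewrite -/tau -/m.
have [|pd_fin] := eqVneq (parabolic_dim H (graph w)) +oo; first by move=> ->; rewrite leey.
have pdE : parabolic_dim H (graph w) = (fine (parabolic_dim H (graph w)))%:E.
  by rewrite fineK// ge0_fin_numE ?parabolic_dim_ge0// ltey.
rewrite pdE; apply: (@lee_archimedean _ _ _ (3 * m)%R); first by rewrite mulr_ge0// ltW.
move=> n; rewrite lee_fin -lerBlDr.
have := parabolic_dim_ge (content_pos n); rewrite pdE lee_fin; apply: le_trans.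
have /andP[l0 l1] := lam01 n.
have n20 : (0 < n.+2%:R^-1 :> R)%R by rewrite invr_gt0 ltr0n.
have n12 : (n.+2%:R^-1 <= n.+1%:R^-1 :> R)%R by rewrite lef_pV2 ?posrE ?ltr0n// ler_nat.
have : (1 - 3 * n.+1%:R^-1 <= lam n ^+ 3)%R.
  have n21 : (n.+2%:R^-1 < 1 :> R)%R by rewrite invf_lt1 ?ltr0n// ltr1n.
  move: n12 n20 n21; rewrite /lam; move: (n.+2%:R^-1)%R (n.+1%:R^-1)%R => x y xy x0 x1.
  have x3 : (0 <= x * x * (3 - x))%R.
    by rewrite !mulr_ge0 ?(ltW x0)// subr_ge0 (le_trans (ltW x1))// ler1n.
  have -> : ((1 - x) ^+ 3 = 1 - 3 * x + x * x * (3 - x))%R by ring.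
  rewrite -addrA; apply: lerD => //; rewrite -[leLHS]addr0; apply: lerD => //.
  by rewrite lerN2 ler_wpM2l.
move=> /(ler_wpM2r (ltW m0)); rewrite mulrBl mul1r mulrAC; exact.
Qed.

(** The Hölder exponents gamma n = alpha (n + 1) / (n + 2) increase to alpha. *)
Lemma graph_dim_le_ae : {ae P, forall w,
  parabolic_dim H (graph w) <= (H / alpha)%:E * hausdorff_dim A /\
  parabolic_dim H (graph w) <= hausdorff_dim A + (d%:R * (H - alpha))%:E}.
Proof.
pose gamma n : R := (alpha * (n.+1%:R / n.+2%:R))%R.
have gamma0 n : (0 < gamma n)%R by rewrite mulr_gt0// divr_gt0 ?ltr0n.
have gamma_lt n : (gamma n < alpha)%R.
  by rewrite gtr_pMr// ltr_pdivrMr ?ltr0n// mul1r ltr_nat.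
have : {ae P, forall w, forall n i,
    locally_holder (gamma n) `[0%R, 1%R] (fun t => B i t w)}.
  apply: ae_foralln => n; apply: filter_forall => i.
  by apply: (fbm_locally_holder (fbm_components B_fbm i)); rewrite gamma0 gamma_lt.
apply: filterS => w holder.
have holderA n i : locally_holder (gamma n) A (fun t => sample_path B w t ord0 i).
  have [N [C NC]] := holder n i; exists N, C => x y Ax Ay xy.
  by rewrite !mxE; apply: NC => //; exact: A_sub.
have gH n : (gamma n <= H)%R by rewrite ltW// (lt_le_trans (gamma_lt n)).
split.
  rewrite -lee_pdivrMl ?divr_gt0//.
  apply: le_ereal_inf_tmp => _ [s [s0 As0] <-].
  rewrite lee_pdivrMl ?divr_gt0// -EFinM.
  apply: (@lee_archimedean _ _ _ (H / alpha * s)%R).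
    by rewrite mulr_ge0 ?divr_ge0// ltW.
  move=> n; rewrite (_ : _ + _ = s * H / gamma n)%R; last first.
    by rewrite /gamma; field; rewrite ?gt_eqF//.
  apply: parabolic_dim_le; first by rewrite divr_gt0// mulr_gt0.
  exact: (parabolic_content_holder_box (gamma0 n) (gH n) s0 As0 (holderA n)).
rewrite -leeBlDr//.
apply: le_ereal_inf_tmp => _ [s [s0 As0] <-].
rewrite leeBlDr// -EFinD.
apply: (@lee_archimedean _ _ _ (d%:R * alpha)%R); first by rewrite mulr_ge0// ltW.
move=> n; apply: (@le_trans _ _ (s + d%:R * (H - gamma n))%:E).
  apply: parabolic_dim_le; first by rewrite ltr_wpDr// mulr_ge0// subr_ge0.
  exact: (parabolic_content_holder_grid (gamma0 n) (gH n) s0 As0 (holderA n)).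
rewrite lee_fin -addrA lerD2l -mulrA -mulrDr ler_wpM2l//.
rewrite /gamma (_ : (n.+1%:R / n.+2%:R = 1 - n.+2%:R^-1 :> R)%R); last first.
  by rewrite -[X in (X / _)%R](addrK 1%R) natr1 mulrBl mulfV ?pnatr_eq0// mul1r.
rewrite mulrBr mulr1 opprB addrCA addrC lerD2l ler_wpM2l ?(ltW alpha_gt0)//.
by rewrite lef_pV2 ?posrE ?ltr0n// ler_nat.
Qed.

End MainBounds.

Theorem theorem2p9 (R : realType) (disp : measure_display)
    (T : measurableType disp) (P : probability T R) (d : nat) (alpha H : R)
    (B : 'I_d -> R -> {RV P >-> R}) (A : set R)
    (P_complete : measure_is_complete P)
    (d_ge1 : (1 <= d)%N)
    (alpha_gt0 : (0 < alpha)%R) (alpha_le_H : (alpha <= H)%R)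
    (H_lt1 : (H < 1)%R)
    (B_fbm : is_fbm alpha `[0%R, 1%R] B)
    (A_sub : A `<=` `[0%R, 1%R]) (A_borel : measurable A) :
  {ae P, forall w,
     parabolic_dim H (graph_over A (sample_path B w)) =
     mine ((H / alpha)%:E * hausdorff_dim A)
          (hausdorff_dim A + (d%:R * (H - alpha))%:E)} /\
  ((alpha < H)%R -> 0 < hausdorff_dim A ->
   {ae P, forall w,
     hausdorff_dim A < parabolic_dim H (graph_over A (sample_path B w))}).
Proof.
have dim_fin : hausdorff_dim A = (fine (hausdorff_dim A))%:E.
  rewrite fineK// ge0_fin_numE ?hausdorff_dim_ge0//.
  by apply: (le_lt_trans (hausdorff_dim_unit_le1 A_borel A_sub)); exact: ltry.
move: (fine _) dim_fin => D dimA.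
have D0 : (0 <= D)%R by rewrite -lee_fin -dimA hausdorff_dim_ge0.
have minE : mine ((H / alpha)%:E * hausdorff_dim A)
    (hausdorff_dim A + (d%:R * (H - alpha))%:E) =
    (D + (H - alpha) * Num.min d%:R (D / alpha))%:E.
  rewrite dimA -EFinM -EFinD -EFin_min; congr EFin.
  have -> : (H / alpha * D = D + (H - alpha) * (D / alpha))%R.
    by field; rewrite gt_eqF.
  rewrite minr_pMr ?subr_ge0// addr_minr.
  by rewrite minC [(d%:R * _)%R]mulrC.
have main : {ae P, forall w,
     parabolic_dim H (graph_over A (sample_path B w)) =
     mine ((H / alpha)%:E * hausdorff_dim A)
          (hausdorff_dim A + (d%:R * (H - alpha))%:E)}.
  have lower : {ae P, forall w, mine ((H / alpha)%:E * hausdorff_dim A)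
          (hausdorff_dim A + (d%:R * (H - alpha))%:E) <=
       parabolic_dim H (graph_over A (sample_path B w))}.
    rewrite minE; have := D0; rewrite le_eqVlt => /predU1P[D00|Dp].
      apply: nearW => w; rewrite -D00 mul0r add0r (min_idPr _)//.
      by rewrite mulr0 parabolic_dim_ge0.
    exact: (graph_dim_ge_ae d_ge1 alpha_gt0 alpha_le_H B_fbm A_sub A_borel Dp dimA).
  move: (graph_dim_le_ae alpha_gt0 alpha_le_H B_fbm A_sub) lower.
  apply: filterS2 => w [le1 le2] ge; apply/eqP; rewrite eq_le ge andbT.
  by rewrite le_min le1.
split=> // alpha_lt_H dim_pos.
apply: filterS main => w ->; rewrite minE dimA lte_fin ltrDl.
rewrite mulr_gt0 ?subr_gt0// lt_min ltr0n d_ge1/= divr_gt0//.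
by rewrite -lte_fin -dimA.
Qed.
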